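(* Let $\Theta=(\theta_m)_{m\ge1}$ be a sequence of non-negative real numbers and let $S_n$ be endowed with $\mathbb{P}_\Theta$. Assume that $g_\Theta$ is of class $\mathcal{F}(r,\theta)$ or of class $e\mathcal{F}(r,\theta,\gamma)$. Then for each $b\in\mathbb{N}$, as $n\to\infty$, $$\big(C_1^{(n)},C_2^{(n)},\dots,C_b^{(n)}\big)\xrightarrow{d}(Y_1,\dots,Y_b),$$ where $Y_1,\dots,Y_b$ are independent Poisson random variables with $\mathbb{E}[Y_m]=\frac{\theta_m}{m}r^m$. Moreover, for integers $c_1,\dots,c_b$: if $g_\Theta\in\mathcal{F}(r,\theta)$ then $$\Big|\mathbb{P}_\Theta\big[C_1^{(n)}=c_1,\dots,C_b^{(n)}=c_b\big]-\mathbb{P}\big[Y_1=c_1,\dots,Y_b=c_b\big]\Big|=O\Big(\frac1n\Big),$$ and if $g_\Theta\in e\mathcal{F}(r,\theta,\gamma)$ then $$\Big|\mathbb{P}_\Theta\big[C_1^{(n)}=c_1,\dots,C_b^{(n)}=c_b\big]-\mathbb{P}\big[Y_1=c_1,\dots,Y_b=c_b\big]\Big|=O\Big(\frac{\log n}{n^\gamma}\Big).$$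
   Context: For $\sigma$ in the symmetric group $S_n$, $C_m^{(n)}(\sigma)$ is the number of cycles of length $m$ in the disjoint cycle decomposition of $\sigma$ (zero if $m>n$). The weighted measure on $S_n$ is $\mathbb{P}_\Theta[\sigma]=\frac{1}{h_n n!}\prod_{m=1}^n\theta_m^{C_m^{(n)}(\sigma)}$, with normalization $h_n=\frac1{n!}\sum_{\sigma\in S_n}\prod_{m=1}^n\theta_m^{C_m^{(n)}(\sigma)}$ (defined whenever $h_n>0$). Put $g_\Theta(t)=\sum_{k\ge1}\frac{\theta_k}{k}t^k$. A Poisson variable of mean $0$ is identically $0$. For $0<r<R$ and $0<\phi<\pi/2$ let $\Delta_0(r,R,\phi)=\{z\in\mathbb{C}: |z|<R,\ z\ne r,\ |\arg(z-r)|>\phi\}$. For $r>0$ and $\theta\ge0$, a function $g$ is of class $\mathcal{F}(r,\theta)$ if there are $R>r$ and $0<\phi<\pi/2$ such that $g$ is holomorphic in $\Delta_0(r,R,\phi)$, and there is a constant $K$ with $g(t)=\theta\log\frac{1}{1-t/r}+K+O(t-r)$ as $t\to r$. For $r>0$, $\theta\ge0$ and $0<\gamma\le1$, a function $g$ is of class $e\mathcal{F}(r,\theta,\gamma)$ if $g(t)=\theta\log\frac{1}{1-t/r}+g_0(t)$ with $g_0$ analytic in $\{|t|<r\}$ and $[t^n]g_0=O(r^{-n}n^{-1-\gamma})$, where $[t^n]g_0$ is the coefficient of $t^n$. For the formal power series $g_\Theta$, being of such a class means that it converges near $0$ and its sum (analytically continued if necessary) has the stated properties.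
   Formalization: The formal theorem assumes θ > 0 instead of θ ≥ 0; for θ = 0 the claim fails, e.g. Θ = (1,0,0,…) gives g(t) = t in F(r,0) and eF(r,0,γ), but C_1 = n almost surely, so it does not converge to a Poisson variable of mean r. *)

(* Defs.v *)
From HB Require Import structures.
From mathcomp Require Import all_boot all_order all_algebra all_fingroup.
From mathcomp Require Import all_classical all_reals all_analysis.
From mathcomp Require Import complex.
Set Implicit Arguments.
Unset Strict Implicit.
Unset Printing Implicit Defensive.
Import Order.TTheory GRing.Theory Num.Theory.
Import numFieldNormedType.Exports.
Local Open Scope classical_set_scope.
Local Open Scope ring_scope.
Local Open Scope complex_scope.

Section Complex.
Variable R : realType.

(* The ascription to numClosedFieldType is what gives R[i] its topology, norm
   and complex derivative; the norm |z| of z : C is itself a (real) element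
   of C, hence the casts %:C and complex.Re below. *)
Definition C : numClosedFieldType := complex (R : rcfType).

(* Principal argument, with values in ]-pi, pi]; its value at 0 is irrelevant. *)
Definition carg (z : C) : R :=
  let a := acos (complex.Re z / complex.Re `|z|) in
  if 0 <= complex.Im z then a else - a.

(* Principal branch of the logarithm. *)
Definition clog (z : C) : C := Complex (ln (complex.Re `|z|)) (carg z).

Definition holomorphic_on (D : set C) (g : C -> C) : Prop :=
  forall z, D z -> derivable g z 1.

Definition has_expansion_at0 (a : nat -> C) (g : C -> C) : Prop :=
  \forall t \near (0 : C), series (fun n => a n * t ^+ n) @ \oo --> g t.

Definition Delta0 (r rho phi : R) : set C :=
  [set z | `|z| < rho%:C /\ z != r%:C /\ phi < `|carg (z - r%:C)| ].

Definition singular_log (r theta : R) (t : C) : C :=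
  theta%:C * clog (1 / (1 - t / r%:C)).

Definition classF (r theta : R) (g : C -> C) : Prop :=
  [/\ 0 < r, 0 <= theta &
   exists rho phi : R,
   [/\ r < rho, 0 < phi < pi / 2%:R,
       holomorphic_on (Delta0 r rho phi) g &
       exists K : C, let F := within (Delta0 r rho phi) (nbhs (r%:C : C)) in
       (fun t : C => g t - (singular_log r theta t + K)) =O_F
       (fun t : C => t - r%:C)]].

Definition class_eF (r theta gamma : R) (g : C -> C) : Prop :=
  [/\ 0 < r, 0 <= theta, 0 < gamma <= 1 &
   exists g0 : C -> C,
   [/\ holomorphic_on [set t | `|t| < r%:C] g0,
       forall t : C, `|t| < r%:C -> g t = singular_log r theta t + g0 t &
       exists2 a : nat -> C, has_expansion_at0 a g0 &
       a =O_\oo (fun n => (r ^- n * n%:R `^ (- 1 - gamma))%:C : C)]].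

(* A formal power series belongs to a class of functions when it converges
   near 0 and its sum extends to a function of that class. *)
Definition series_of_class (cls : (C -> C) -> Prop) (a : nat -> C) : Prop :=
  exists2 g : C -> C, has_expansion_at0 a g & cls g.

(* The coefficients of g_Theta; the one of t^0 is Theta 0 / 0 = 0. *)
Definition g_coef (Theta : nat -> R) (k : nat) : C := (Theta k / k%:R)%:C.

End Complex.

Section WeightedMeasure.
Variables (R : realType) (Theta : nat -> R).

Definition cycle_count (m n : nat) (s : 'S_n) : nat :=
  #|[set c in porbits s | #|c| == m]|.

Definition weight (n : nat) (s : 'S_n) : R :=
  \prod_(1 <= m < n.+1) Theta m ^+ cycle_count m s.

Definition h_norm (n : nat) : R := n`!%:R^-1 * \sum_(s : 'S_n) weight s.

(* Identically 0 (instead of undefined) for the n such that h_norm n = 0. *)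
Definition PTheta (n : nat) (s : 'S_n) : R := (h_norm n * n`!%:R)^-1 * weight s.

Definition Pr_Theta (n : nat) (A : {set 'S_n}) : R := \sum_(s in A) PTheta s.

Definition E_Theta (n : nat) (f : 'S_n -> R) : R :=
  \sum_(s : 'S_n) PTheta s * f s.

(* Index i : 'I_b stands for the cycle length i + 1, here and below. *)
Definition cycle_counts (b n : nat) (s : 'S_n) : 'rV[R]_b :=
  \row_(i < b) (cycle_count i.+1 s)%:R.

End WeightedMeasure.

Section RandomVectors.
Context (R : realType) (d : measure_display) (T : measurableType d).
Variables (P : probability T R) (b : nat).
Implicit Type Y : 'I_b -> {RV P >-> nat}.

Definition mutually_independent Y : Prop :=
  forall (J : {set 'I_b}) (A : 'I_b -> set nat),
    fine (P [set w | forall i, i \in J -> A i (Y i w)]) =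
    \prod_(i in J) fine (P (Y i @^-1` A i)).

Definition poisson_rv (Z : {RV P >-> nat}) (lambda : R) : Prop :=
  (* the last argument of poisson_prob is a dummy *)
  forall A : set nat, distribution P Z A = poisson_prob lambda 0%N A.

Definition rv_vector Y (w : T) : 'rV[R]_b := \row_(i < b) (Y i w)%:R.

Definition cycles_cvg_in_distribution (Theta : nat -> R) Y : Prop :=
  forall f : 'rV[R]_b -> R, continuous f -> bounded_fun f ->
    (fun n => (E_Theta Theta (fun s : 'S_n => f (cycle_counts R b s)))%:E) @ \oo
      --> ('E_P[f \o rv_vector Y])%E.

Definition pmf_diff (Theta : nat -> R) Y (c : 'I_b -> int) (n : nat) : R :=
  `| Pr_Theta Theta
       [set s : 'S_n | [forall i : 'I_b, (cycle_count i.+1 s)%:Z == c i]]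
     - fine (P [set w | forall i : 'I_b, (Y i w)%:Z = c i]) |.

End RandomVectors.

(* Main.v *)
Require Import Defs.
From HB Require Import structures.
From mathcomp Require Import all_boot all_order all_algebra all_fingroup.
From mathcomp Require Import all_classical all_reals all_analysis.
From mathcomp Require Import measurable_realfun complex.
From mathcomp Require Import ring lra zify.
Set Implicit Arguments.
Unset Strict Implicit.
Unset Printing Implicit Defensive.
Import Order.TTheory GRing.Theory Num.Theory.
Import numFieldNormedType.Exports.
Local Open Scope classical_set_scope.
Local Open Scope ring_scope.

(* Put al k = Theta_k r^k. The class hypotheses give al k - theta = O(phi k) with
   phi k = 1/k, resp. k^-gamma. For class eF this is a comparison of Taylor
   coefficients. For class F, the coefficient of u = g - singular_log - K is an
   integral of u(z) z^(-n-1) dz; substituting z = r exp v turns the contour into two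
   segments from v = -1/n in directions c + i and c - i, where u = O(|v|) and
   |exp (-n v)| = exp (1 - n c t), so that the integral is O(1/n^2).
   Summing over the cycle through a point gives
     P_Theta[C_1 = c_1, ..., C_b = c_b] = prod_i (Theta_i / i)^c_i / c_i! * e_(n-s) / h_n
   with s = sum_i i c_i, h_n = [t^n] exp g_Theta and
   e_n = [t^n] exp (sum_(k > b) Theta_k t^k / k). After rescaling by r, h is a
   perturbation of the coefficients of (1 - t)^-theta; its increments are O(h_n phi n),
   hence e_(n-s) / h_n = exp (- sum_(i <= b) al i / i) + O(phi n). Convergence in
   distribution follows from convergence of the point probabilities by truncation to
   finite boxes. *)

(** * Coefficients of the exponential of a power series *)

(** Everything is measured against d_n, the coefficient of t^n in (1 - t)^-theta, whose recurrence
    (n + 1) d_(n+1) = (n + theta) d_n yields doubling, partial sums and increments without Gamma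
    asymptotics. Positivity of theta makes d_n positive and its partial sums O(n d_n). The delicate
    estimate is the lower bound h_n >= c d_n, without which small increments say nothing about a
    ratio; it comes from inverting the perturbation, that is from writing d as the convolution of h
    with a summable sequence.

    On the analytic side only complex differentiability is available, so moving the contour rests on
    Goursat's lemma, proved by bisection for real 1-forms. In the variable v the contour closes up
    modulo the period 2 pi i, and pushing it towards Re v = -infinity isolates one Taylor
    coefficient. Since the coefficients are real, imaginary parts of the integrals suffice and every
    integral is a real one. The vertex v = -1/n stays left of the singularity v = 0 and keeps |exp
    (-n v)| equal to e there. *)

Section ExpSeq.
Variable R : realType.
Implicit Types (al be : nat -> R).

(** The recurrence n e_n = sum_j al_j e_(n-j) refers to all earlier values, so stage [n] returns the
    whole table up to index [n]; this keeps the recursion structural. Entries of index above [n] are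
    meaningless. *)
Fixpoint expseq_upto al n : nat -> R :=
  if n is m.+1 then
    fun k => if (k <= m)%N then expseq_upto al m k
             else m.+1%:R^-1 * \sum_(j < m.+1) al j.+1 * expseq_upto al m (m - j)%N
  else fun _ => 1.

(* The coefficient of t^n in exp (\sum_(k >= 1) al k / k * t^k). *)
Definition expseq al n : R := expseq_upto al n n.

Lemma expseq_uptoE al n k : (k <= n)%N -> expseq_upto al n k = expseq al k.
Proof.
elim: n => [|n IH]; first by rewrite leqn0 => /eqP ->.
rewrite leq_eqVlt => /predU1P[-> //|]; rewrite ltnS => kn.
by rewrite /= kn IH.
Qed.

Lemma expseq0 al : expseq al 0 = 1. Proof. by []. Qed.

Lemma expseqS al n :
  n.+1%:R * expseq al n.+1 = \sum_(j < n.+1) al j.+1 * expseq al (n - j).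
Proof.
rewrite /expseq /= ltnn mulrA divff ?pnatr_eq0 // mul1r.
by apply: eq_bigr => j _; rewrite expseq_uptoE ?leq_subr.
Qed.

(** The recurrence is F' = L' F for F = exp L, read coefficientwise; together with F(0) = 1 it
    determines F. It serves to recognise exponentials. *)
Lemma expseq_uniq al (x : nat -> R) : x 0%N = 1 ->
  (forall n, n.+1%:R * x n.+1 = \sum_(j < n.+1) al j.+1 * x (n - j)%N) ->
  forall n, x n = expseq al n.
Proof.
move=> x0 xS; elim/ltn_ind => -[|n] IH; first by rewrite x0.
apply: (mulfI (x := n.+1%:R)); first by rewrite pnatr_eq0.
rewrite xS expseqS; apply: eq_bigr => j _.
by rewrite IH // ltnS leq_subr.
Qed.

Lemma eq_expseq al be : (forall k, (0 < k)%N -> al k = be k) ->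
  forall n, expseq al n = expseq be n.
Proof.
move=> e; apply: expseq_uniq => // n; rewrite expseqS.
by apply: eq_bigr => j _; rewrite e.
Qed.

Lemma expseqS_mul al n : n%:R * expseq al n =
  \sum_(j < n.+1) (if (j : nat) is 0 then 0 else al j) * expseq al (n - j).
Proof.
case: n => [|n]; first by rewrite big_ord1 !mul0r.
rewrite expseqS [RHS]big_ord_recl mul0r add0r.
by apply: eq_bigr => j _; rewrite /= /bump /= add1n subSS.
Qed.

Definition conv (u v : nat -> R) n := \sum_(i < n.+1) u i * v (n - i)%N.

(** The product of two exponentials solves X Q' = (A + B) Q, whose coefficients form the defining
    recurrence for the sum of the exponents. Series are truncated to polynomials of degree at most
    n, so the equation is only claimed for coefficients of index at most n. *)
Lemma expseqD al be n :
  expseq (fun k => al k + be k) n = conv (expseq al) (expseq be) n.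
Proof.
(* The exponent has no constant term: [expseq] never reads [al 0]. *)
pose z a k : R := if k is 0 then 0 else a k.
pose PP a : {poly R} := \poly_(i < n.+1) expseq a i.
pose AA a : {poly R} := \poly_(i < n.+1) z a i.
have PPE a k : (k <= n)%N -> (PP a)`_k = expseq a k.
  by move=> kn; rewrite coef_poly ltnS kn.
have AAE a k : (k <= n)%N -> (AA a)`_k = z a k.
  by move=> kn; rewrite coef_poly ltnS kn.
have DP a k : (k <= n)%N -> ('X * (PP a)^`())`_k = (AA a * PP a)`_k.
  move=> kn; rewrite coefXM coefM.
  transitivity (\sum_(i < k.+1) z a i * expseq a (k - i)); last first.
    apply: eq_bigr => i _; rewrite AAE ?PPE //.
      exact: leq_trans (leq_subr _ _) kn.
    by apply: leq_trans kn; rewrite -ltnS.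
  rewrite -expseqS_mul; case: k kn => [|k] kn /=; first by rewrite mul0r.
  by rewrite coef_deriv PPE // mulr_natl.
have mulE (p q p' q' : {poly R}) : (forall k, (k <= n)%N -> p`_k = p'`_k) ->
    (forall k, (k <= n)%N -> q`_k = q'`_k) ->
    forall k, (k <= n)%N -> (p * q)`_k = (p' * q')`_k.
  move=> pp' qq' k kn; rewrite !coefM; apply: eq_bigr => i _.
  rewrite pp' ?qq' //; first exact: leq_trans (leq_subr _ _) kn.
  by apply: leq_trans kn; rewrite -ltnS.
pose Q := PP al * PP be.
have QE k : (k <= n)%N -> Q`_k = conv (expseq al) (expseq be) k.
  move=> kn; rewrite coefM; apply: eq_bigr => i _.
  rewrite !PPE //; first exact: leq_trans (leq_subr _ _) kn.
  by apply: leq_trans kn; rewrite -ltnS.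
have DQ k : (k <= n)%N -> ('X * Q^`())`_k = ((AA al + AA be) * Q)`_k.
  move=> kn.
  have -> : 'X * Q^`() = ('X * (PP al)^`()) * PP be + PP al * ('X * (PP be)^`()).
    by rewrite /Q derivM; ring.
  have -> : (AA al + AA be) * Q = (AA al * PP al) * PP be + PP al * (AA be * PP be).
    by rewrite /Q; ring.
  rewrite coefD [RHS]coefD; congr (_ + _).
    exact: (mulE _ _ _ _ (DP al)).
  exact: (mulE _ _ _ _ _ (DP be)).
suff H : forall k, (k <= n)%N -> expseq (fun i => al i + be i) k = Q`_k.
  by rewrite H // QE.
elim/ltn_ind => -[|k] IH kn.
  by rewrite QE // /conv big_ord1 /= !expseq0 mulr1.
apply: (mulfI (x := k.+1%:R)); first by rewrite pnatr_eq0.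
have := DQ _ kn; rewrite coefXM /= coef_deriv => DQk.
rewrite [RHS]mulr_natl DQk.
rewrite coefM big_ord_recl coefD !AAE // addr0 mul0r add0r expseqS.
apply: eq_bigr => j _; have jn : (lift ord0 j <= n)%N.
  exact: leq_trans (ltn_ord j) kn.
rewrite coefD !AAE //=.
rewrite subSS IH //; first by rewrite ltnS leq_subr.
by apply: leq_trans (ltnW kn); exact: leq_subr.
Qed.

Lemma expseq_ge0 al : (forall k, (0 < k)%N -> 0 <= al k) ->
  forall n, 0 <= expseq al n.
Proof.
move=> al0; elim/ltn_ind => -[|n] IH; first by rewrite expseq0.
rewrite -(pmulr_rge0 _ (ltr0Sn R n)) expseqS; apply: sumr_ge0 => j _.
by rewrite mulr_ge0 ?al0 ?IH // ltnS leq_subr.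
Qed.

Lemma expseq_majorant al be : (forall k, (0 < k)%N -> `|al k| <= be k) ->
  forall n, `|expseq al n| <= expseq be n.
Proof.
move=> ab; elim/ltn_ind => -[|n] IH; first by rewrite !expseq0 normr1.
rewrite -(ler_pM2l (ltr0Sn R n)) -{1}(ger0_norm (ler0n R n.+1)) -normrM.
rewrite !expseqS; apply: le_trans (ler_norm_sum _ _ _) _; apply: ler_sum => j _.
by rewrite normrM ler_pM ?ab ?IH // ltnS leq_subr.
Qed.

Lemma expseq_scale al (x : R) n :
  expseq (fun k => al k * x ^+ k) n = expseq al n * x ^+ n.
Proof.
apply/esym; move: n; apply: expseq_uniq => [|n]; first by rewrite expseq0 mulr1.
rewrite mulrA expseqS mulr_suml; apply: eq_bigr => j _.
have -> : x ^+ n.+1 = x ^+ j.+1 * x ^+ (n - j)%N.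
  by rewrite -exprD addSn subnKC // -ltnS.
by rewrite mulrACA.
Qed.

(** A constant sequence c stands for exp (c log (1 / (1 - t))) = (1 - t)^-c; this is the ratio of
    its consecutive binomial coefficients. *)
Lemma expseq_cstS (c : R) n :
  n.+1%:R * expseq (fun=> c) n.+1 = (n%:R + c) * expseq (fun=> c) n.
Proof.
case: n => [|n]; first by rewrite expseqS big_ord1 add0r.
rewrite expseqS big_ord_recl subn0 mulrDl addrC; congr (_ + _).
by rewrite expseqS; apply: eq_bigr => j _; rewrite /= /bump /= add1n subSS.
Qed.

Lemma expseq_cst_sum (c : R) n :
  c * \sum_(j < n.+1) expseq (fun=> c) j = n.+1%:R * expseq (fun=> c) n.+1.
Proof.
rewrite expseqS mulr_sumr (reindex_inj rev_ord_inj) /=.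
by apply: eq_bigr => j _; rewrite subSS.
Qed.

Lemma expseq1 n : expseq (fun=> 1) n = 1.
Proof.
elim: n => [|n IH]; first by rewrite expseq0.
apply: (mulfI (x := n.+1%:R)); first by rewrite pnatr_eq0.
by rewrite expseq_cstS IH -natr1.
Qed.

(** Subtracting 1 from every [al k] multiplies the series by 1 - t, so the shifted sequence lists
    the increments of [expseq al]. *)
Lemma expseq_partial_sum al n :
  expseq al n = \sum_(i < n.+1) expseq (fun k => al k - 1) i.
Proof.
rewrite (@eq_expseq al (fun k => (al k - 1) + 1)); last by move=> k _; ring.
by rewrite expseqD; apply: eq_bigr => i _; rewrite expseq1 mulr1.
Qed.

End ExpSeq.

Lemma sum_ord_support (V : zmodType) (f : nat -> V) b N : (b <= N)%N ->
  (forall k, (b < k)%N -> f k = 0) -> \sum_(j < N.+1) f j = \sum_(j < b.+1) f j.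
Proof.
move=> bN fb; rewrite -!(big_mkord xpredT f).
rewrite (@big_cat_nat _ _ _ b.+1) //= -[RHS]addr0; congr (_ + _).
rewrite big_nat_cond big1 // => j; by move=> /andP[/andP[bj _] _]; rewrite fb.
Qed.

Ltac nneg := repeat first [ by [] | by apply: ltW | apply: mulr_ge0 | apply: addr_ge0
  | apply: exprn_ge0 | rewrite invr_ge0 | apply: sumr_ge0 => ? _ ].

Ltac pos := solve [ by [] | apply: mulr_gt0; pos | rewrite invr_gt0; pos
  | apply: exprn_gt0; pos | apply: ltr_wpDl; [by nneg | pos]
  | apply: ltr_pwDl; [pos | by nneg] ].

(** * Partial sums of exponential series and their limits at t = 1 *)

Section ExpSeqSum.
Variable R : realType.
Implicit Types (al be : nat -> R).

(** Mean value theorem on [0, 1] for P(x) exp (-L(x)), where P truncates exp L: this function is 1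
    at 0 and its derivative is -exp (-L) (A P - P'). By the recurrence the defect A P - P' has no
    coefficient below degree N, so a partial sum is compared with its limit without infinite
    series. *)
Lemma expseq_poly_MVT al N :
  let P := \poly_(k < N.+1) expseq al k in
  let A := \poly_(i < N) al i.+1 in
  exists2 c : R, 0 <= c <= 1 & exists2 e : R,
    0 <= e <= expR (\sum_(j < N.+1) `|al j / j%:R|) &
  1 - (\sum_(k < N.+1) expseq al k) * expR (- \sum_(j < N.+1) al j / j%:R)
    = e * (A * P - P^`()).[c].
Proof.
move=> P A; pose L := \poly_(j < N.+1) (al j / j%:R).
have LA : L^`() = A.
  apply/polyP => i; rewrite coef_deriv !coef_poly ltnS.
  case: ltnP => // _; last by rewrite mul0rn.
  by rewrite -[LHS]mulr_natr divfK // pnatr_eq0.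
pose G (x : R) : R := P.[x] * expR (- L.[x]).
pose dG (x : R) : R := - (expR (- L.[x]) * (A * P - P^`()).[x]).
have dGE (x : R) : is_derive x (1 : R) G (dG x).
  apply: is_derive_eq.
  rewrite LA /dG hornerD hornerN hornerM /GRing.scale /=; ring.
have cG : {within `[0, 1], continuous G}.
  apply: derivable_within_continuous => x _.
  exact: ex_derive.
have [c c01 Gc] := MVT_segment (ler01 : 0 <= 1 :> R) (fun x _ => dGE x) cG.
rewrite in_itv /= in c01.
exists c => //; exists (expR (- L.[c])).
  rewrite expR_ge0 /= ler_expR.
  apply: le_trans (ler_norm _) _; rewrite normrN horner_poly.
  apply: le_trans (ler_norm_sum _ _ _) _; apply: ler_sum => j _.
  case/andP: c01 => c0 c1.
  by rewrite normrM normrX (ger0_norm c0) ler_piMr // exprn_ile1.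
have G0 : G 0 = 1.
  by rewrite /G !horner_coef0 !coef_poly /= invr0 mulr0 oppr0 expR0 mulr1.
have G1 : G 1 = (\sum_(k < N.+1) expseq al k) * expR (- \sum_(j < N.+1) al j / j%:R).
  rewrite /G /P /L !horner_poly.
  by congr (_ * expR (- _)); apply: eq_bigr => i _; rewrite expr1n mulr1.
rewrite G1 G0 in Gc.
by rewrite -opprB Gc /dG subr0 mulr1 opprK.
Qed.

Lemma expseq_poly_coef al N m :
  let P := \poly_(k < N.+1) expseq al k in
  let A := \poly_(i < N) al i.+1 in
  (A * P - P^`())`_m = if (m < N)%N then 0 else (A * P)`_m.
Proof.
move=> P A; rewrite coefB coef_deriv coef_poly ltnS.
case: ltnP => mN; last by rewrite mul0rn subr0.
rewrite coefM -mulr_natl expseqS; apply/eqP; rewrite subr_eq0; apply/eqP.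
apply: eq_bigr => j _; rewrite !coef_poly.
have jm : (j <= m)%N by rewrite -ltnS.
by rewrite (leq_ltn_trans jm mN) ltnS (leq_trans (leq_subr _ _) (ltnW mN)).
Qed.

(** The defect A P - P' has nonnegative coefficients, so P exp (-L) does not exceed its initial
    value 1. *)
Lemma expseq_sum_le al N : (forall k, (0 < k)%N -> 0 <= al k) ->
  \sum_(k < N.+1) expseq al k <= expR (\sum_(j < N.+1) al j / j%:R).
Proof.
move=> al0; have [c /andP[c0 _] [e /andP[e0 _] E]] := expseq_poly_MVT al N.
have : 0 <= 1 - (\sum_(k < N.+1) expseq al k) * expR (- \sum_(j < N.+1) al j / j%:R).
  rewrite E mulr_ge0 // horner_coef sumr_ge0 // => m _.
  rewrite mulr_ge0 ?exprn_ge0 // expseq_poly_coef; case: ifP => // _.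
  rewrite coefM sumr_ge0 // => i _; rewrite !coef_poly.
  by rewrite mulr_ge0 //; case: ifP => // _; rewrite ?al0 // expseq_ge0.
by rewrite subr_ge0 expRN ler_pdivrMr ?expR_gt0 // mul1r.
Qed.

(** The exponential of a polynomial is entire. Rescaling t to 2 t bounds [2 ^+ n] times a
    coefficient by a partial sum of the majorant series at 2, hence by the exponential of a finite
    sum. *)
Lemma expseq_geometric al b : (forall k, (b < k)%N -> al k = 0) ->
  exists C, forall n, `|expseq al n| <= C * 2^-1 ^+ n.
Proof.
move=> alb.
pose S : R := \sum_(j < b.+1) `|al j| * 2 ^+ j / j%:R.
exists (expR S) => n.
rewrite exprVn ler_pdivlMr ?exprn_gt0 //.
pose be k : R := `|al k|.
apply: le_trans (_ : expseq be n * 2 ^+ n <= _).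
  by rewrite ler_wpM2r ?exprn_ge0 //; apply: expseq_majorant.
rewrite -expseq_scale.
pose ga k : R := be k * 2 ^+ k.
have ga0 k : 0 <= ga k by rewrite /ga /be mulr_ge0 ?normr_ge0 ?exprn_ge0.
apply: le_trans (_ : \sum_(k < (n + b).+1) expseq ga k <= _).
  have nb : (n < (n + b).+1)%N by rewrite ltnS leq_addr.
  rewrite (bigD1 (Ordinal nb)) //= lerDl sumr_ge0 // => i _.
  exact: expseq_ge0.
apply: le_trans (expseq_sum_le _ _) _ => //.
rewrite ler_expR (@sum_ord_support _ (fun j => ga j / j%:R) b) ?leq_addl //.
by move=> k bk; rewrite /ga /be alb // normr0 !mul0r.
Qed.

Lemma expseq_sum_cvg al b : (forall k, (b < k)%N -> al k = 0) ->
  exists C, forall N, (b <= N)%N ->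
   `|\sum_(k < N.+1) expseq al k - expR (\sum_(j < b.+1) al j / j%:R)|
     <= C * 2^-1 ^+ N.
Proof.
move=> alb; have [C C_le] := expseq_geometric alb.
have C0 : 0 <= C by have := le_trans (normr_ge0 _) (C_le 0%N); rewrite expr0 mulr1.
pose SA : R := \sum_(j < b.+1) `|al j / j%:R|.
pose SB : R := \sum_(j < b) `|al j.+1|.
pose L := \sum_(j < b.+1) al j / j%:R.
exists (expR L * expR SA * (SB * (C * 2 ^+ b) * 2)) => N bN.
have [c /andP[c0 c1] [e /andP[e0 eS] E]] := expseq_poly_MVT al N.
rewrite (@sum_ord_support _ (fun j => al j / j%:R) b) -/L // in E; last first.
  by move=> k bk; rewrite alb // mul0r.
rewrite (@sum_ord_support _ (fun j => `|al j / j%:R|) b) -/SA // in eS; last first.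
  by move=> k bk; rewrite alb // mul0r normr0.
set S := \sum_(k < N.+1) _ in E *.
have -> : S - expR L = - (expR L * (1 - S * expR (- L))).
  by rewrite expRN mulrBr mulrCA divff ?gt_eqF ?expR_gt0 // !mulr1 opprB.
rewrite normrN normrM ger0_norm ?expR_ge0 // -!mulrA ler_pM2l ?expR_gt0 // E.
rewrite normrM (ger0_norm e0) ler_pM // horner_coef.
set Q := (X in \sum_(i < size X) _).
apply: le_trans (ler_norm_sum _ _ _) _.
(* Only the coefficients of A below degree b are nonzero, so the matching coefficients of P have
   index above m - b; hence the factor 2^b. *)
pose h m : R := SB * (C * 2 ^+ b) * 2^-1 ^+ m.
have h0 m : 0 <= h m.
  by nneg.
have Qm m : `|Q`_m| <= if (m < N)%N then 0 else h m.
  rewrite /Q expseq_poly_coef; case: ltnP => mN; first by rewrite normr0.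
  rewrite coefM; apply: le_trans (ler_norm_sum _ _ _) _.
  have bm := leq_trans bN mN.
  pose g j : R := `|al j.+1| * (C * 2 ^+ b * 2^-1 ^+ m).
  apply: le_trans (_ : \sum_(j < m.+1) g j <= _).
    apply: ler_sum => j _; rewrite normrM /g.
    have jm : (j <= m)%N by rewrite -ltnS.
    have [bj|jb] := leqP b j.
      rewrite coef_poly; case: ifP => _; rewrite ?alb ?normr0 ?mul0r //.
    rewrite ler_pM //.
      by rewrite coef_poly; case: ifP; rewrite // normr0.
    rewrite coef_poly; case: ifP => _; last first.
      by rewrite normr0; nneg.
    apply: le_trans (C_le _) _; rewrite -mulrA ler_wpM2l // -ler_pdivrMl ?exprn_gt0 //.
    have -> : 2^-1 ^+ m = 2^-1 ^+ (m - j) * 2^-1 ^+ j :> R by rewrite -exprD subnK.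
    rewrite mulrC ler_wpM2l ?exprn_ge0 //.
    rewrite -exprVn ler_wiXn2l ?invr_ge0 ?invf_le1 ?ler1n //; exact: ltnW.
  rewrite -mulr_suml /h -!mulrA ler_wpM2r //.
    by nneg.
  rewrite (@sum_ord_support _ (fun j => `|al j.+1|) b) // => [|k bk]; last by rewrite alb ?normr0 // ltnW.
  by rewrite big_ord_recr /= alb // normr0 addr0.
apply: le_trans (_ : \sum_(i < size Q) (if (i < N)%N then 0 else h i) <= _).
  apply: ler_sum => i _; rewrite normrM -[leRHS]mulr1 ler_pM //.
  by rewrite normrX (ger0_norm c0) exprn_ile1.
rewrite -(big_mkord xpredT (fun i => if (i < N)%N then 0 else h i)).
have [sN|Ns] := leqP (size Q) N.
  rewrite big_nat_cond big1 => [|i /andP[/andP[_ iQ] _]].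
    by nneg.
  by rewrite (leq_trans iQ sN).
rewrite (@big_cat_nat _ _ _ N) //=; last exact: ltnW.
rewrite [X in X + _]big_nat_cond big1 ?add0r => [|i /andP[/andP[_ ->]] //].
have -> : \sum_(N <= i < size Q) (if (i < N)%N then 0 else h i) =
   \sum_(N <= i < size Q) h i.
  by apply: eq_big_nat => i /andP[Ni _]; rewrite ltnNge Ni.
rewrite -mulr_sumr -!mulrA; do 3! [apply: ler_wpM2l; first by nneg].
have geo M : \sum_(N <= i < N + M) (2^-1 : R) ^+ i = 2 * (2^-1 ^+ N - 2^-1 ^+ (N + M)).
  elim: M => [|M IH]; first by rewrite addn0 big_geq // subrr mulr0.
  rewrite addnS big_nat_recr ?leq_addr //= IH exprS; by field.
by rewrite -(subnKC (ltnW Ns)) geo ler_pM2l // gerBl; nneg.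
Qed.

End ExpSeqSum.

(** * Exponentials of sequences of size [phi] *)

Section Decay.
Variable R : realType.
Variable phi : nat -> R.

(* What the perturbation argument needs to know of phi n = n^-gamma, 0 < gamma <= 1. *)
Definition decay_rate := [/\
  forall n, (0 < n)%N -> n%:R^-1 <= phi n,
  forall m n, (0 < m)%N -> (0 < n)%N -> (n <= 2 * m)%N -> phi m <= 2 * phi n,
  exists B, forall N, \sum_(j < N) phi j.+1 / j.+1%:R <= B &
  forall e : R, 0 < e -> exists K, forall k, (K <= k)%N -> phi k <= e].

(** Each term is charged either to a uniform bound on [v] and the sum of |u|, or to a uniform bound
    on [u] and the sum of |v|. In the applications [B] selects the first half of the range, where n
    - k is comparable to n. *)
Lemma conv_split (u v : nat -> R) (B : pred nat) n (U V us vs : R) :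
  \sum_(k < n.+1) `|u k| <= U -> \sum_(k < n.+1) `|v k| <= V ->
  0 <= us -> 0 <= vs ->
  (forall k, (k <= n)%N -> B k -> `|v (n - k)%N| <= vs) ->
  (forall k, (k <= n)%N -> ~~ B k -> `|u k| <= us) ->
  `|conv u v n| <= U * vs + us * V.
Proof.
move=> uU vV us0 vs0 Bv Bu.
apply: le_trans (ler_norm_sum _ _ _) _.
apply: le_trans (_ : \sum_(k < n.+1) (`|u k| * vs + us * `|v (n - k)%N|) <= _).
  apply: ler_sum => k _; rewrite normrM.
  have kn : (k <= n)%N by rewrite -ltnS.
  have [Bk|Bk] := boolP (B k).
    by rewrite -[leLHS]addr0 lerD ?mulr_ge0 // ler_wpM2l // Bv.
  by rewrite -[leLHS]add0r lerD ?mulr_ge0 // ler_wpM2r // Bu.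
rewrite big_split /= -mulr_suml -mulr_sumr lerD ?ler_wpM2r ?ler_wpM2l //.
rewrite (reindex_inj rev_ord_inj) /=; apply: le_trans vV.
by apply: ler_sum => i _; rewrite subSS subKn // -ltnS.
Qed.

Hypothesis phiP : decay_rate.

Let phi_gt0 n : (0 < n)%N -> 0 < phi n.
Proof.
by move=> n0; case: phiP => p1 _ _ _; apply: lt_le_trans (p1 _ n0);
  rewrite invr_gt0 ltr0n.
Qed.

Lemma decay_mean (e : R) : 0 < e ->
  exists K, forall k, (K <= k)%N -> \sum_(j < k) phi j.+1 <= e * k%:R.
Proof.
move=> e0; case: phiP => _ _ _ p4.
have [K HK] := p4 (e / 2) (divr_gt0 e0 (ltr0Sn _ 1)).
pose S := \sum_(j < K) phi j.+1.
have S0 : 0 <= S by apply: sumr_ge0 => j _; apply/ltW/phi_gt0.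
exists (K + (Num.truncn (S / (e / 2))).+1)%N => k kK.
have Kk : (K <= k)%N by apply: leq_trans kK; rewrite leq_addr.
rewrite -(big_mkord xpredT (fun j => phi j.+1)) (@big_cat_nat _ _ _ K) //=.
rewrite big_mkord -/S.
have -> : e * k%:R = e / 2 * k%:R + e / 2 * k%:R by field.
apply: lerD.
  rewrite -ler_pdivrMl ?divr_gt0 // mulrC; apply: ltW.
  apply: lt_le_trans (truncnS_gt _) _; rewrite ler_nat.
  by apply: leq_trans kK; rewrite leq_addl.
apply: le_trans (_ : \sum_(K <= j < k) (e / 2) <= _).
  rewrite !big_nat; apply: ler_sum => j /andP[Kj _]; apply: HK.
  exact: leqW.
rewrite sumr_const_nat -[leLHS]mulr_natr ler_wpM2l //; first exact/ltW/divr_gt0.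
by rewrite ler_nat leq_subr.
Qed.

(** The recurrence k F_k = sum_j e_j F_(k-j) of the majorant F is bootstrapped: F_k <= M phi k / k
    by strong induction. For j up to k/2 the induction hypothesis comes with a factor E that need
    not be small; the small Cesaro mean of [phi] compensates for it. *)
Lemma expseq_decay (ep : nat -> R) E :
  (forall k, (0 < k)%N -> `|ep k| <= E * phi k) ->
  exists C, forall k, (0 < k)%N -> `|expseq ep k| <= C * (phi k / k%:R).
Proof.
move=> epE.
wlog E0 : E epE / 0 < E.
  move=> H; apply: (H (`|E| + 1)); last by rewrite ltr_wpDl.
  move=> k k0; apply: le_trans (epE k k0) _; rewrite ler_pM2r ?phi_gt0 //.
  by rewrite -[leLHS]addr0 lerD ?ler_norm.
have [p1 p2 [B HB] p4] := phiP.
pose e k := E * phi k.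
have e0 k : (0 < k)%N -> 0 <= e k by move=> k0; rewrite mulr_ge0 ?ltW ?phi_gt0.
pose F := expseq e.
have F0 k : 0 <= F k by apply: expseq_ge0.
have FS N : \sum_(k < N.+1) F k <= expR (E * B).
  apply: le_trans (expseq_sum_le _ e0) _; rewrite ler_expR big_ord_recl invr0 mulr0 add0r.
  apply: le_trans (_ : E * \sum_(j < N) phi j.+1 / j.+1%:R <= _); last first.
    by rewrite ler_pM2l.
  by rewrite mulr_sumr; apply: ler_sum => j _; rewrite /e mulrA.
set S := expR (E * B) in FS.
have S0 : 0 < S by exact: expR_gt0.
(* With this mean the half that uses the induction hypothesis contributes (M / 4) phi k: the
   hypothesis at indices above k/2 loses a factor 4, from [phi] and from 1/k. *)
have [K HK] := decay_mean (e := (16 * E)^-1) ltac:(by rewrite invr_gt0 mulr_gt0).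
pose K0 := (K + 3)%N.
(* The term 8 E S makes the other half at most (M / 4) phi k; the sum makes the claim trivial below
   [K0]. *)
pose M := 8 * E * S + \sum_(k < K0) F k * (phi k / k%:R)^-1.
have inv0 k : 0 <= (phi k / k%:R)^-1.
  case: k => [|k]; first by rewrite invr0 mulr0 invr0.
  by rewrite invr_ge0 divr_ge0 // ltW // phi_gt0.
have sum0 : 0 <= \sum_(k < K0) F k * (phi k / k%:R)^-1.
  by apply: sumr_ge0 => k _; rewrite mulr_ge0.
have M0 : 0 <= M by rewrite addr_ge0 // !mulr_ge0 // ltW.
have pk0 k : (0 < k)%N -> 0 < phi k / k%:R by move=> k0; rewrite divr_gt0 ?phi_gt0 ?ltr0n.
suff HM k : (0 < k)%N -> F k <= M * (phi k / k%:R).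
  exists M => k k0; apply: le_trans (HM k k0); apply: expseq_majorant => j j0.
  exact: epE.
elim/ltn_ind: k => k IH k0.
have [kK|Kk] := ltnP k K0.
  rewrite -ler_pdivrMr ?pk0 // /M (bigD1 (Ordinal kK)) //= addrCA lerDl.
  rewrite addr_ge0 //; first by rewrite !mulr_ge0 // ltW.
  by apply: sumr_ge0 => i _; rewrite mulr_ge0.
have [n kn] : exists n, k = n.+1 by exists k.-1; rewrite prednK.
rewrite mulrA ler_pdivlMr ?ltr0n // [leLHS]mulrC.
pose u j := e j.+1.
have -> : k%:R * F k = conv u F n by rewrite /F kn expseqS.
apply: le_trans (ler_norm _) _.
apply: le_trans (@conv_split u F (fun j => 2 * j.+1 <= k)%N n (E * ((16 * E)^-1 * k%:R)) S (2 * e k) (4 * M * (phi k / k%:R)) _ _ _ _ _ _) _.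
- apply: le_trans (_ : E * \sum_(j < k) phi j.+1 <= _).
    rewrite mulr_sumr kn; apply: ler_sum => j _.
    by rewrite ger0_norm // /u e0.
  by rewrite ler_pM2l // HK // (leq_trans _ Kk) // leq_addr.
- apply: le_trans (FS n); apply: ler_sum => j _.
  by rewrite ger0_norm.
- by rewrite mulr_ge0 // e0.
- by rewrite !mulr_ge0 // ?invr_ge0 // ltW // phi_gt0.
- move=> j jn j2; rewrite ger0_norm //.
  have nj0 : (0 < n - j)%N by lia.
  apply: le_trans (IH _ _ nj0) _; first by lia.
  rewrite (mulrC 4) -mulrA; apply: ler_wpM2l => //.
  rewrite ler_pdivrMr ?ltr0n //.
  have -> : 4 * (phi k / k%:R) * (n - j)%:R = 2 * phi k * ((2 * (n - j))%:R / k%:R).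
    by rewrite natrM; ring.
  apply: le_trans (p2 _ k nj0 k0 _) _; first by lia.
  apply: ler_peMr; first by apply/ltW/mulr_gt0; rewrite ?phi_gt0.
  by rewrite ler_pdivlMr ?ltr0n // mul1r ler_nat; lia.
- move=> j jn; rewrite -ltnNge => j2; rewrite ger0_norm ?e0 // /u /e.
  rewrite mulrCA ler_pM2l //; apply: p2 => //; lia.
have -> : E * ((16 * E)^-1 * k%:R) * (4 * M * (phi k / k%:R)) = M / 4 * phi k.
  have kn0 : k%:R != 0 :> R by rewrite pnatr_eq0 -lt0n.
  have En0 : E != 0 by rewrite gt_eqF.
  by field; rewrite ?kn0 ?En0.
have -> : 2 * e k * S = (8 * E * S) / 4 * phi k by rewrite /e; field.
rewrite -mulrDl ler_pM2r ?phi_gt0 //.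
have : 8 * E * S <= M by rewrite lerDl.
lra.
Qed.

End Decay.

Lemma leq_half_sub k n : (2 * k <= n)%N -> (n <= 2 * (n - k))%N.
Proof. by lia. Qed.

Lemma leq_add2S_bounds N K n : (N + 2 * K + 1 <= n)%N ->
  [/\ (0 < n)%N, (N <= n)%N & (K < n)%N].
Proof. by move=> ?; split; lia. Qed.

Lemma ltn_sqr_sub m n : (m <= n)%N -> (n - m <= (n - m) ^ 2)%N.
Proof. by rewrite -mulnn; nia. Qed.

Lemma sqr_le_half_sub m n : (2 * m < n)%N -> (n ^ 2 <= 4 * (n - m) ^ 2)%N.
Proof. by rewrite -!mulnn; nia. Qed.

Lemma ltn_half_gt0 k n : (n < 2 * k)%N -> (0 < k)%N.
Proof. by lia. Qed.

Lemma sub_half_gt0 k n : (0 < n)%N -> (2 * k <= n)%N -> (0 < n - k)%N.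
Proof. by lia. Qed.

Lemma summable_tail (R : realType) (u : nat -> R) S (e : R) :
  (forall k, 0 <= u k) -> (forall n, \sum_(k < n.+1) u k <= S) -> 0 < e ->
  exists K, forall n, \sum_(K.+1 <= k < n.+1) u k <= e.
Proof.
move=> u0 HS e0; pose s n := \sum_(k < n.+1) u k.
have nd : nondecreasing_seq s.
  by apply/nondecreasing_seqP => n; rewrite [leRHS]big_ord_recr /= lerDl.
have ub : has_ubound (range s) by exists S => _ [n _ <-]; exact: HS.
have := nondecreasing_cvgn nd ub; set l := sup _ => cl.
have lub n : s n <= l by apply: ub_le_sup => //; exists n.
move/cvgrPdist_le: cl => /(_ _ e0) [K _ HK].
exists K => n; have [nK|Kn] := leqP n K; first by rewrite big_geq // ltW.
have := HK K (leqnn K) => /=; rewrite ger0_norm ?subr_ge0 //.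
have := lub n; rewrite {1}/s -(big_mkord xpredT u).
by rewrite (@big_cat_nat _ _ _ K.+1) ?leqW //= big_mkord -/(s K); lra.
Qed.

(** * Perturbation of (1 - t)^-theta *)

Section Smooth.
Variables (R : realType) (theta : R).
Hypothesis theta_gt0 : 0 < theta.

Let d : nat -> R := expseq (fun=> theta).
Let dd : nat -> R := expseq (fun=> theta - 1).

Lemma binseqS n : n.+1%:R * d n.+1 = (n%:R + theta) * d n.
Proof. exact: expseq_cstS. Qed.

Lemma binseq_gt0 n : 0 < d n.
Proof.
elim: n => [|n IH]; first exact: ltr01.
rewrite -(pmulr_rgt0 _ (ltr0Sn R n)) binseqS.
by rewrite mulr_gt0 // ltr_wpDl.
Qed.

(** The recurrence gives (n + 1) d_(n+1) = (n + theta) d_n >= n d_n. This replaces d_n ~ n^(theta -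
    1) / Gamma(theta): doubling and 1/n <= d_n / theta both follow from it. *)
Lemma mul_binseq_ndecr m n : (m <= n)%N -> m%:R * d m <= n%:R * d n.
Proof.
elim: n => [|n IH]; first by rewrite leqn0 => /eqP ->.
rewrite leq_eqVlt ltnS => /predU1P[->//|/IH]; move/le_trans; apply.
by rewrite binseqS ler_pM2r ?binseq_gt0 // lerDl ltW.
Qed.

Lemma binseq_doubling m n : (m <= n)%N -> (n <= 2 * m)%N -> d m <= 2 * d n.
Proof.
move=> mn nm; case: m => [|m] in mn nm *.
  have -> : n = 0%N by lia.
  by rewrite ler_peMl ?ler1n // ltW // binseq_gt0.
rewrite -(ler_pM2l (ltr0Sn R m)); apply: le_trans (mul_binseq_ndecr mn) _.
by rewrite mulrCA mulrA ler_pM2r ?binseq_gt0 // -natrM ler_nat.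
Qed.

Lemma binseq_ge n : (0 < n)%N -> n%:R^-1 <= theta^-1 * d n.
Proof.
move=> n0; rewrite ler_pdivlMl // -div1r mulrA mulr1 ler_pdivrMr ?ltr0n // mulrC.
have := mul_binseq_ndecr n0; rewrite mul1r.
by have := binseqS 0; rewrite mul1r add0r /d expseq0 mulr1 => ->.
Qed.

Lemma binseq_sum n : (0 < n)%N ->
  \sum_(j < n.+1) d j <= (theta^-1 + 1) * (n%:R * d n).
Proof.
move=> n0; have := expseq_cst_sum theta n; rewrite -/d => E.
rewrite -(ler_pM2l theta_gt0) E binseqS mulrA mulrDr mulr1 divff ?gt_eqF //.
rewrite mulrA ler_pM2r ?binseq_gt0 // mulrDl mul1r lerD2l.
by rewrite ler_peMr ?ler1n // ltW.
Qed.

Lemma dbinseqE n : dd n.+1 = d n.+1 - d n.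
Proof.
rewrite /d !(expseq_partial_sum (fun=> theta)) big_ord_recr /= [X in X - _]addrC.
by rewrite addrK.
Qed.

Lemma dbinseqM n : (n%:R + theta) * dd n.+1 = (theta - 1) * d n.+1.
Proof. by rewrite dbinseqE mulrBr -binseqS -natr1; ring. Qed.

Lemma dbinseq_le : exists C, forall n, (0 < n)%N -> `|dd n| <= C * (d n / n%:R).
Proof.
(* Chosen so that n + theta >= mu (n + 1) for all n. *)
pose mu := Num.min 1 theta.
have mu0 : 0 < mu by rewrite lt_min ltr01.
exists (`|theta - 1| / mu) => -[//|n] _.
have nt : 0 < n%:R + theta by rewrite ltr_wpDl.
rewrite -(ler_pM2l nt) -{1}(ger0_norm (ltW nt)) -normrM dbinseqM normrM.
rewrite (ger0_norm (ltW (binseq_gt0 _))).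
have -> : (n%:R + theta) * (`|theta - 1| / mu * (d n.+1 / n.+1%:R)) =
  `|theta - 1| * d n.+1 * ((n%:R + theta) / (mu * n.+1%:R)).
  by field; rewrite (gt_eqF mu0) nat1r pnatr_eq0.
apply: ler_peMr; first by rewrite mulr_ge0 // ltW // binseq_gt0.
rewrite ler_pdivlMr ?mulr_gt0 // mul1r -natr1 mulrDr mulr1 lerD //; last first.
  by rewrite ge_min lexx orbT.
by rewrite ler_piMl // ge_min lexx.
Qed.

(** From index 1 on the increments have the constant sign of theta - 1, so their absolute values
    telescope to |d_n - 1|. *)
Lemma dbinseq_sum n : \sum_(i < n.+1) `|dd i| <= 2 + d n.
Proof.
rewrite big_ord_recl /= /dd expseq0 normr1 -/dd.
suff : \sum_(i < n) `|dd i.+1| <= 1 + d n by lra.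
have sumE : \sum_(i < n) dd i.+1 = d n - 1.
  have := expseq_partial_sum (fun=> theta) n; rewrite -/d -/dd big_ord_recl /dd expseq0 -/dd.
  by move=> ->; rewrite [X in X - 1]addrC addrK.
have dn := binseq_gt0 n.
have sgn i : (n%:R + theta) != 0 by rewrite gt_eqF // ltr_wpDl.
have [t1|t1] := lerP 1 theta.
  rewrite (eq_bigr (fun i : 'I_n => dd i.+1)) ?sumE; first lra.
  move=> i _; rewrite ger0_norm //.
  rewrite -(pmulr_rge0 _ (_ : 0 < i%:R + theta)) ?ltr_wpDl // dbinseqM.
  by rewrite mulr_ge0 ?subr_ge0 // ltW // binseq_gt0.
rewrite (eq_bigr (fun i : 'I_n => - dd i.+1)) ?sumrN ?sumE; first lra.
move=> i _; rewrite ler0_norm //.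
rewrite -(pmulr_rle0 _ (_ : 0 < i%:R + theta)) ?ltr_wpDl // dbinseqM.
by rewrite nmulr_rle0 ?subr_lt0 // ltW // binseq_gt0.
Qed.

Variables (phi al : nat -> R) (E : R).
Hypothesis phiP : decay_rate phi.
Hypothesis al_le : forall k, (0 < k)%N -> `|al k - theta| <= E * phi k.

Let H := expseq al.
(** The coefficients of the quotient of the perturbed series by (1 - t)^-theta; [f'] below belongs
    to the inverse quotient. By [expseq_decay] both are O(phi k / k), hence summable. *)
Let f := expseq (fun k => al k - theta).
Let f' := expseq (fun k => theta - al k).

Let phi_gt0 n : (0 < n)%N -> 0 < phi n.
Proof.
by move=> n0; case: phiP => p1 _ _ _; apply: lt_le_trans (p1 _ n0);
  rewrite invr_gt0 ltr0n.
Qed.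

Lemma decay_bounded : exists2 M, 0 < M & forall n, (0 < n)%N -> phi n <= M.
Proof.
case: phiP => _ p2 _ _; exists (2 * phi 1%N) => [|n n0].
  by rewrite mulr_gt0 ?phi_gt0.
by apply: p2 => //; lia.
Qed.

Lemma decay_half k n C : 0 <= C -> (0 < k)%N -> (k <= n)%N -> (n < 2 * k)%N ->
  C * (phi k / k%:R) <= 4 * C * (phi n / n%:R).
Proof.
move=> C0 k0 kn nk; case: phiP => _ p2 _ _.
have n0 : (0 < n)%N by lia.
rewrite (mulrC 4) -!mulrA; apply: ler_wpM2l => //.
rewrite mulrA ler_pdivlMr ?ltr0n // -mulrA mulrC.
have -> : k%:R^-1 * n%:R * phi k = phi k * (n%:R / k%:R) by ring.
apply: le_trans (_ : 2 * phi n * 2 <= _); last by lra.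
apply: ler_pM; [exact/ltW/phi_gt0|by rewrite divr_ge0|by apply: p2 => //; lia|].
by rewrite ler_pdivrMr ?ltr0n // -natrM ler_nat; lia.
Qed.

Lemma expseq_decay_sum (u : nat -> R) C : u 0%N = 1 ->
  (forall k, (0 < k)%N -> `|u k| <= C * (phi k / k%:R)) ->
  exists2 S, 0 < S & forall n, \sum_(k < n.+1) `|u k| <= S.
Proof.
move=> u0 uC; case: phiP => _ _ [B HB] _.
have C0 : 0 <= C.
  have := le_trans (normr_ge0 _) (uC 1%N isT).
  by rewrite pmulr_lge0 // divr_gt0 // phi_gt0.
have B0 : 0 <= B by have := HB 0%N; rewrite big_ord0.
exists (1 + C * B) => [|n]; first by rewrite ltr_wpDr // mulr_ge0.
rewrite big_ord_recl u0 normr1 lerD2l.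
apply: le_trans (_ : C * \sum_(j < n) phi j.+1 / j.+1%:R <= _).
  by rewrite mulr_sumr; apply: ler_sum => j _; exact: uC.
by rewrite ler_wpM2l.
Qed.

Lemma expseq_binseqE n : H n = conv f d n.
Proof.
rewrite -expseqD; apply: eq_expseq => k _; by rewrite subrK.
Qed.

Lemma binseq_expseqE n : d n = conv f' H n.
Proof.
rewrite -expseqD; apply: eq_expseq => k _; by rewrite subrK.
Qed.

(** In the convolution of [f] and [d], for k <= n/2 doubling bounds d_(n-k) and [f] is summable; for
    k > n/2 the factor phi n / n in the bound on f_k cancels the n in the partial sums of [d]. *)
Lemma expseq_upper : exists2 C, 0 < C & forall n, `|H n| <= C * d n.
Proof.
have [C HC] := expseq_decay phiP al_le; rewrite -/f in HC.
have [S S0 HS] := expseq_decay_sum (expseq0 _) HC.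
have [M M0 HM] := decay_bounded.
have C0 : 0 <= C.
  have := le_trans (normr_ge0 _) (HC 1%N isT).
  by rewrite pmulr_lge0 // divr_gt0 // phi_gt0.
have t0 : 0 < theta^-1 by rewrite invr_gt0.
have C1 : 0 <= 4 * C * M * (theta^-1 + 1).
  by nneg.
exists (S * 2 + 4 * C * M * (theta^-1 + 1) + 1) => [|n].
  by pos.
have dn := binseq_gt0 n.
case: (posnP n) => [->|n0].
  rewrite /H expseq0 normr1 /d expseq0 mulr1 lerDr addr_ge0 //.
  by nneg.
rewrite expseq_binseqE.
have pn := phi_gt0 n0.
have nn : 0 < n%:R :> R by rewrite ltr0n.
apply: le_trans (@conv_split _ f d (fun k => 2 * k <= n)%N n S
  ((theta^-1 + 1) * (n%:R * d n)) (4 * C * (phi n / n%:R)) (2 * d n) _ _ _ _ _ _) _ => //.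
- apply: le_trans (binseq_sum n0); apply: ler_sum => i _.
  by rewrite ger0_norm // ltW // binseq_gt0.
- by nneg.
- by nneg.
- move=> k kn kn2; rewrite ger0_norm; last exact/ltW/binseq_gt0.
  by apply: binseq_doubling; rewrite ?leq_subr ?leq_half_sub.
- move=> k kn; rewrite -ltnNge => nk.
  have k0 := ltn_half_gt0 nk.
  by apply: le_trans (HC _ k0) _; apply: decay_half.
have -> : 4 * C * (phi n / n%:R) * ((theta^-1 + 1) * (n%:R * d n)) =
   phi n * (4 * C * (theta^-1 + 1)) * d n.
   by field; rewrite (gt_eqF theta_gt0) (gt_eqF nn).
rewrite mulrA -mulrDl ler_pM2r // -addrA lerD2l.
apply: le_trans (_ : M * (4 * C * (theta^-1 + 1)) <= _); last first.
  by rewrite -[leLHS]addr0 lerD // le_eqVlt; apply/orP; left; apply/eqP; ring.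
by apply: ler_wpM2r; [nneg|exact: HM].
Qed.

Let D := expseq (fun k => al k - 1).

Lemma expseq_diffE n : H n.+1 - H n = D n.+1.
Proof.
by rewrite /H !(expseq_partial_sum al) big_ord_recr /= -/D [X in X - _]addrC addrK.
Qed.

(** Multiplying by 1 - t turns [d] into [dd], so [D] is the convolution of [f] and [dd]. Early k
    gain 1/n <= phi n from [dd], late k gain phi n / n from [f]. The constant 2 in the bound on the
    sum of |dd| is absorbed through 1/n <= d_n / theta. *)
Lemma expseq_diff_le : exists2 C, 0 < C &
  forall n, (0 < n)%N -> `|D n| <= C * (d n * phi n).
Proof.
have [C HC] := expseq_decay phiP al_le; rewrite -/f in HC.
have [S S0 HS] := expseq_decay_sum (expseq0 _) HC.
have [Cd HCd] := dbinseq_le.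
have C0 : 0 <= C.
  have := le_trans (normr_ge0 _) (HC 1%N isT).
  by rewrite pmulr_lge0 // divr_gt0 // phi_gt0.
have Cd0 : 0 <= Cd.
  have := le_trans (normr_ge0 _) (HCd 1%N isT).
  by rewrite pmulr_lge0 // divr_gt0 // binseq_gt0.
have t0 : 0 < theta^-1 by rewrite invr_gt0.
exists (S * (4 * Cd) + 4 * C * (2 / theta + 1) + 1).
  by pos.
move=> n n0; have dn := binseq_gt0 n.
have pn := phi_gt0 n0.
have nn : 0 < n%:R :> R by rewrite ltr0n.
have -> : D n = conv f dd n.
  by rewrite -expseqD; apply: eq_expseq => k _; ring.
apply: le_trans (@conv_split _ f dd (fun k => 2 * k <= n)%N n S
  (2 + d n) (4 * C * (phi n / n%:R)) (4 * Cd * (d n / n%:R)) _ _ _ _ _ _) _ => //.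
- exact: dbinseq_sum.
- by nneg.
- by nneg.
- move=> k kn kn2; have nk0 := sub_half_gt0 n0 kn2.
  apply: le_trans (HCd _ nk0) _; rewrite (mulrC 4) -!mulrA; apply: ler_wpM2l => //.
  rewrite mulrA ler_pdivlMr //.
  have -> : d (n - k)%N / (n - k)%:R * n%:R = d (n - k)%N * (n%:R / (n - k)%:R) by ring.
  apply: le_trans (_ : 2 * d n * 2 <= _); last by lra.
  apply: ler_pM; rewrite ?divr_ge0 //; first exact/ltW/binseq_gt0.
    by apply: binseq_doubling; rewrite ?leq_subr ?leq_half_sub.
  by rewrite ler_pdivrMr ?ltr0n // -natrM ler_nat leq_half_sub.
- move=> k kn; rewrite -ltnNge => nk.
  have k0 := ltn_half_gt0 nk.
  by apply: le_trans (HC _ k0) _; apply: decay_half.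
have p1 : n%:R^-1 <= phi n by case: phiP => p1 _ _ _; apply: p1.
have n1 : n%:R^-1 <= theta^-1 * d n by apply: binseq_ge.
have nV1 : n%:R^-1 <= 1 :> R by rewrite invf_le1 // ler1n.
have h1 : S * (4 * Cd) * (d n / n%:R) <= S * (4 * Cd) * (d n * phi n).
  by apply: ler_wpM2l; [nneg|rewrite ler_pM2l].
have h2 : 4 * C * phi n * (2 / n%:R + d n / n%:R) <=
    4 * C * phi n * (2 * (theta^-1 * d n) + d n * 1).
  by apply: ler_wpM2l; [nneg|apply: lerD; rewrite ler_pM2l].
have h3 : 0 <= d n * phi n by nneg.
have -> : S * (4 * Cd * (d n / n%:R)) + 4 * C * (phi n / n%:R) * (2 + d n) =
  S * (4 * Cd) * (d n / n%:R) + 4 * C * phi n * (2 / n%:R + d n / n%:R) by ring.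
have -> : (S * (4 * Cd) + 4 * C * (2 / theta + 1) + 1) * (d n * phi n) =
  S * (4 * Cd) * (d n * phi n) + 4 * C * phi n * (2 * (theta^-1 * d n) + d n * 1)
  + d n * phi n by ring.
lra.
Qed.

(** The square lets one bound serve all m. For n <= 2 m the increments add up to a term linear in n
    - m. For m < n/2 both values are O(n d_n), and n <= n^2 phi n while n <= 2 (n - m). *)
Lemma expseq_shift_le : exists2 C, 0 < C & forall m n, (0 < n)%N -> (m <= n)%N ->
  `|H m - H n| <= C * (n - m)%:R ^+ 2 * (d n * phi n).
Proof.
have [C C0 HC] := expseq_upper.
have [CD CD0 HD] := expseq_diff_le.
have t0 : 0 < theta^-1 by rewrite invr_gt0.
have t1 : 0 < theta^-1 + 1 by pos.
have [p1 p2 _ _] := phiP.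
exists (4 * CD + 4 * C * (theta^-1 + 1 + 1)).
  by pos.
move=> m n n0 mn.
have dn := binseq_gt0 n; have pn := phi_gt0 n0.
have dp : 0 < d n * phi n by rewrite mulr_gt0.
have nn : 0 < n%:R :> R by rewrite ltr0n.
have [nm|mn2] := leqP n (2 * m)%N.
  apply: le_trans (_ : 4 * CD * (n - m)%:R * (d n * phi n) <= _).
    have step k : (m <= k)%N -> (k <= n)%N ->
        `|H m - H k| <= 4 * CD * (k - m)%:R * (d n * phi n).
      elim: k => [|k IH] mk kn.
        move: mk; rewrite leqn0 => /eqP ->.
        by rewrite subrr normr0 subnn mulr0 mul0r.
      move: mk; rewrite leq_eqVlt => /predU1P[->|mk].
        by rewrite subrr normr0 subnn mulr0 mul0r.
      rewrite ltnS in mk.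
      have -> : (k.+1 - m)%:R = (k - m)%:R + 1 :> R by rewrite subSn // natr1.
      have nk2 : (n <= 2 * k.+1)%N by rewrite (leq_trans nm) // leq_mul2l leqW.
      rewrite mulrDr mulr1 mulrDl.
      have -> : H m - H k.+1 = (H m - H k) - (H k.+1 - H k) by ring.
      apply: le_trans (ler_normB _ _) _; apply: lerD; first by apply: IH => //; exact: ltnW.
      rewrite expseq_diffE; apply: le_trans (HD _ _) _ => //.
      have -> : 4 * CD * (d n * phi n) = CD * ((2 * d n) * (2 * phi n)) by ring.
      apply: ler_wpM2l; first exact: ltW.
      apply: ler_pM; [exact/ltW/binseq_gt0|exact/ltW/phi_gt0| |].
        exact: binseq_doubling.
      exact: p2.
    exact: step.
  apply: ler_wpM2r; first exact: ltW.
  apply: ler_pM => //; first by nneg.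
    by rewrite lerDl !mulr_ge0 // ltW // addr_gt0.
  by rewrite -natrX ler_nat ltn_sqr_sub.
apply: le_trans (ler_normB _ _) _.
apply: le_trans (_ : C * ((theta^-1 + 1 + 1) * (n%:R * d n)) <= _).
  apply: le_trans (lerD (HC m) (HC n)) _.
  rewrite -mulrDr; apply: ler_wpM2l; first exact: ltW.
  rewrite [leRHS]mulrDl mul1r; apply: lerD.
    apply: le_trans (binseq_sum n0).
    rewrite (bigD1 (Ordinal (mn : (m < n.+1)%N))) //= lerDl sumr_ge0 // => i _.
    exact/ltW/binseq_gt0.
  by rewrite ler_peMl ?ler1n // ltW.
apply: le_trans (_ : 4 * C * (theta^-1 + 1 + 1) * (n - m)%:R ^+ 2 * (d n * phi n) <= _); last first.
  apply: ler_wpM2r; first exact: ltW.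
  apply: ler_wpM2r; first exact: exprn_ge0.
  by rewrite lerDr mulr_ge0 // ltW.
have -> : 4 * C * (theta^-1 + 1 + 1) * (n - m)%:R ^+ 2 * (d n * phi n) =
   C * ((theta^-1 + 1 + 1) * (4 * (n - m)%:R ^+ 2 * phi n * d n)) by ring.
apply: ler_wpM2l; first exact: ltW.
apply: ler_wpM2l; first by rewrite ltW // addr_gt0.
apply: ler_wpM2r; first exact: ltW.
apply: le_trans (_ : n%:R ^+ 2 * n%:R^-1 <= _).
  by rewrite expr2 mulfK // gt_eqF.
apply: ler_pM; rewrite ?exprn_ge0 ?invr_ge0 ?p1 //.
by rewrite -!natrX -natrM ler_nat sqr_le_half_sub.
Qed.

Hypothesis al_ge0 : forall k, (0 < k)%N -> 0 <= al k.

(** Since [d] is the convolution of [f'] and [H], one gets d_n <= S H_n + d_n / 4 + W phi n d_n: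
    early k compare H_(n-k) with H_n by the shift bound, middle k use the small tail of [f'], late k
    its decay. For large n, W phi n <= 1/4 and half of d_n remains on the left. *)
Lemma expseq_lower : exists2 c, 0 < c &
  exists K, forall n, (K <= n)%N -> c * d n <= H n.
Proof.
have al_le' k : (0 < k)%N -> `|theta - al k| <= E * phi k.
  by move=> k0; rewrite distrC al_le.
have [C HC] := expseq_decay phiP al_le'; rewrite -/f' in HC.
have [S S0 HS] := expseq_decay_sum (expseq0 _) HC; rewrite -/f' in HS.
have [CH CH0 HH] := expseq_upper.
have [Cs Cs0 Hs] := expseq_shift_le.
have C0 : 0 <= C.
  have := le_trans (normr_ge0 _) (HC 1%N isT).
  by rewrite pmulr_lge0 // divr_gt0 // phi_gt0.
have t0 : 0 < theta^-1 by rewrite invr_gt0.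
have t1 : 0 < theta^-1 + 1 by pos.
have [p1 p2 _ p4] := phiP.
have H0 k : 0 <= H k by apply: expseq_ge0.
(* For the middle k, H_(n-k) <= 2 CH d_n; this tail makes their total d_n / 4. *)
have [K HK] : exists K, forall n, \sum_(K.+1 <= k < n.+1) `|f' k| <= (8 * CH)^-1.
  have e0 : 0 < (8 * CH)^-1 by rewrite invr_gt0 mulr_gt0.
  exact: (summable_tail _ HS e0).
pose W := S * (Cs * K%:R ^+ 2) + 4 * C * (CH * (theta^-1 + 1)).
have W0 : 0 <= W.
  by nneg.
have [N HN] := p4 (4 * (W + 1))^-1 ltac:(by rewrite invr_gt0 mulr_gt0 // ltr_wpDl).
exists (2 * S)^-1; first by rewrite invr_gt0 mulr_gt0.
exists (N + 2 * K + 1)%N => n nN.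
have [n0 Nn Kn] := leq_add2S_bounds nN.
have dn := binseq_gt0 n; have pn := phi_gt0 n0.
have nn : 0 < n%:R :> R by rewrite ltr0n.
rewrite mulrC ler_pdivrMr ?mulr_gt0 //.
pose b1 := \sum_(k < K.+1) `|f' k| * H (n - k)%N.
pose b2 := \sum_(K.+1 <= k < n.+1 | (2 * k <= n)%N) `|f' k| * H (n - k)%N.
pose b3 := \sum_(K.+1 <= k < n.+1 | (n < 2 * k)%N) `|f' k| * H (n - k)%N.
have split : d n <= b1 + b2 + b3.
  rewrite binseq_expseqE.
  apply: le_trans (_ : \sum_(k < n.+1) `|f' k| * H (n - k)%N <= _).
    apply: ler_sum => k _; apply: ler_wpM2r => //; exact: ler_norm.
  rewrite -(big_mkord xpredT (fun k => `|f' k| * H (n - k)%N)).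
  rewrite (@big_cat_nat _ _ _ K.+1) //=; last by rewrite ltnS ltnW.
  rewrite big_mkord -/b1 -addrA lerD2l.
  rewrite (bigID (fun k => 2 * k <= n)%N) /= -/b2 lerD2l.
  by under eq_bigl do rewrite -ltnNge.
have b1_le : b1 <= S * (H n + Cs * K%:R ^+ 2 * (d n * phi n)).
  apply: le_trans (_ : \sum_(k < K.+1) `|f' k| * (H n + Cs * K%:R ^+ 2 * (d n * phi n)) <= _).
    apply: ler_sum => k _; apply: ler_wpM2l => //.
    have kK : (k <= K)%N by rewrite -ltnS.
    have nk : (n - k <= n)%N by rewrite leq_subr.
    have := ler_norm (H (n - k)%N - H n) => h1.
    have := Hs _ _ n0 nk; rewrite subKn; last exact: leq_trans kK (ltnW Kn).
    move=> h2; suff : Cs * k%:R ^+ 2 * (d n * phi n) <= Cs * K%:R ^+ 2 * (d n * phi n) by lra.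
    apply: ler_wpM2r; first by nneg.
    by apply: ler_wpM2l; [exact: ltW|rewrite -!natrX ler_nat leq_exp2r].
  rewrite -mulr_suml; apply: ler_wpM2r => //.
  by nneg.
have b2_le : b2 <= (8 * CH)^-1 * (CH * (2 * d n)).
  apply: le_trans (_ : \sum_(K.+1 <= k < n.+1) `|f' k| * (CH * (2 * d n)) <= _); last first.
    by rewrite -mulr_suml; apply: ler_wpM2r => //; rewrite !mulr_ge0 // ltW.
  rewrite /b2 big_mkcond /=; apply: ler_sum => k _.
  have F0 : 0 <= `|f' k| * (CH * (2 * d n)) by nneg.
  case: ifP => // kn; apply: ler_wpM2l => //.
  apply: le_trans (ler_norm _) _; apply: le_trans (HH _) _.
  by rewrite ler_pM2l //; apply: binseq_doubling; rewrite ?leq_subr ?leq_half_sub.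
have b3_le : b3 <= 4 * C * (phi n / n%:R) * (CH * ((theta^-1 + 1) * (n%:R * d n))).
  apply: le_trans (_ : \sum_(0 <= k < n.+1) 4 * C * (phi n / n%:R) * (CH * d (n - k)%N) <= _).
    rewrite [leRHS](@big_cat_nat _ _ _ K.+1) //=; last by rewrite ltnS ltnW.
    rewrite -[leLHS]add0r; apply: lerD.
      apply: sumr_ge0 => k _; rewrite !mulr_ge0 ?invr_ge0 // ?ltW //.
      exact: binseq_gt0.
    rewrite /b3 big_mkcond /= !big_nat; apply: ler_sum => k /andP[Kk kn].
    have dk := binseq_gt0 (n - k).
    case: ifP => nk; last by nneg.
    apply: ler_pM => //.
      have k0 := ltn_half_gt0 nk.
      by apply: le_trans (HC _ k0) _; apply: decay_half.
    by apply: le_trans (ler_norm _) _; apply: HH.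
  rewrite -mulr_sumr -mulr_sumr; apply: ler_wpM2l.
    by nneg.
  apply: ler_wpM2l; first exact: ltW.
  apply: le_trans (binseq_sum n0).
  rewrite big_mkord (reindex_inj rev_ord_inj) /=.
  by apply: ler_sum => i _; rewrite subSS subKn // -ltnS.
have : phi n * (4 * (W + 1)) <= 1.
  by rewrite -ler_pdivlMr ?mulr_gt0 ?ltr_wpDl // mul1r HN.
move=> Wn.
have b2' : (8 * CH)^-1 * (CH * (2 * d n)) = d n / 4 by field; rewrite gt_eqF.
have b3' : 4 * C * (phi n / n%:R) * (CH * ((theta^-1 + 1) * (n%:R * d n))) =
  4 * C * (CH * (theta^-1 + 1)) * (d n * phi n).
  by field; rewrite (gt_eqF theta_gt0) (gt_eqF nn).
rewrite b2' in b2_le; rewrite b3' in b3_le.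
have WE : S * (H n + Cs * K%:R ^+ 2 * (d n * phi n)) + 4 * C * (CH * (theta^-1 + 1)) * (d n * phi n)
   = S * H n + W * (d n * phi n) by rewrite /W; ring.
have Wd : W * (d n * phi n) <= d n / 4.
  have -> : W * (d n * phi n) = d n * (W * phi n) by ring.
  apply: ler_wpM2l; first exact: ltW.
  by move: Wn; have : 0 < phi n by []; lra.
have -> : H n * (2 * S) = 2 * (S * H n) by ring.
lra.
Qed.

End Smooth.

Lemma sum_sqr_geometric (R : realType) N :
  \sum_(k < N) k.+1%:R ^+ 2 * 2^-1 ^+ k <= 12 :> R.
Proof.
suff -> : \sum_(k < N) k.+1%:R ^+ 2 * 2^-1 ^+ k =
    12 - 2 * (N%:R ^+ 2 + 4 * N%:R + 6) * 2^-1 ^+ N :> R.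
  by rewrite gerBl; nneg.
elim: N => [|N IH]; first by rewrite big_ord0 expr0; ring.
by rewrite big_ord_recr /= IH [2^-1 ^+ N.+1]exprS -(natr1 N); field.
Qed.

(** Removing the indices up to b multiplies the series by the exponential of a polynomial, with
    coefficients p_k and value rho at 1. The numerator minus rho H_n splits into sum_k p_k
    (H_(n-s-k) - H_n), where geometric p_k beat the quadratic shift bound, and (sum_k p_k - rho)
    H_n, which is exponentially small relative to [d n]. The lower bound on H_n permits the
    division. *)
Lemma expseq_ratio (R : realType) (theta E : R) (phi al : nat -> R) b s :
  0 < theta -> decay_rate phi ->
  (forall k, (0 < k)%N -> `|al k - theta| <= E * phi k) ->
  (forall k, (0 < k)%N -> 0 <= al k) ->
  exists C K, forall n, (K <= n)%N -> [/\ (s <= n)%N, 0 < expseq al n &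
    `|expseq (fun k => if (k <= b)%N then 0 else al k) (n - s) / expseq al n
      - expR (- \sum_(j < b) al j.+1 / j.+1%:R)| <= C * phi n].
Proof.
move=> t0 phiP al_le al0.
have [c c0 [K HK]] := expseq_lower t0 phiP al_le al0.
have [CH CH0 HH] := expseq_upper t0 phiP al_le.
have [Cs Cs0 Hs] := expseq_shift_le t0 phiP al_le.
pose be k := if (k <= b)%N then - al k else 0.
have beb k : (b < k)%N -> be k = 0 by rewrite /be ltnNge; case: leqP.
have [Cp HCp] := expseq_geometric beb.
have [Cq HCq] := expseq_sum_cvg beb.
have -> : - \sum_(j < b) al j.+1 / j.+1%:R = \sum_(j < b.+1) be j / j%:R.
  rewrite big_ord_recl invr0 mulr0 add0r -sumrN; apply: eq_bigr => j _.
  by rewrite /be /= /bump /= add1n ltn_ord mulNr.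
set rho := expR _ in HCq *.
have Cp0 : 0 <= Cp by have := le_trans (normr_ge0 _) (HCp 0%N); rewrite expr0 mulr1.
have Cq0 : 0 <= Cq.
  have := le_trans (normr_ge0 _) (HCq b (leqnn _)).
  by rewrite pmulr_lge0 //; pos.
have EE n : expseq (fun k => if (k <= b)%N then 0 else al k) n =
    conv (expseq be) (expseq al) n.
  rewrite -expseqD; apply: eq_expseq => k _; rewrite /be.
  by case: ifP; rewrite ?addNr ?add0r.
set EB := expseq (fun k => if _ then _ else _) in EE *.
pose d := expseq (fun=> theta) : nat -> R.
(* 12 bounds the sum of (k + 1)^2 2^-k, the shift s + k is at most (s + 1) (k + 1), and 2^s comes
   from 2^-(n-s) <= 2^s / n. *)
pose V := 12 * Cp * Cs * s.+1%:R ^+ 2 + CH * Cq * 2 ^+ s.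
exists (V / c), (K + s + b + 1)%N => n nK.
have [Kn sn n0 bns] : [/\ (K <= n)%N, (s <= n)%N, (0 < n)%N & (b <= n - s)%N].
  by clear -nK; split; lia.
have dn : 0 < d n by exact: binseq_gt0.
have pn : n%:R^-1 <= phi n by case: phiP => + _ _ _; apply.
have pn0 : 0 < phi n by apply: lt_le_trans pn; rewrite invr_gt0 ltr0n.
have Hn := HK n Kn.
have Hn0 : 0 < expseq al n by apply: lt_le_trans Hn; rewrite mulr_gt0.
split=> //.
have -> : EB (n - s)%N / expseq al n - rho = (EB (n - s)%N - rho * expseq al n) / expseq al n.
  by rewrite mulrBl mulfK // gt_eqF.
rewrite normrM normfV (ger0_norm (ltW Hn0)) ler_pdivrMr //.
apply: le_trans (_ : V * (d n * phi n) <= _); last first.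
  have -> : V / c * phi n * expseq al n = V * (phi n / c * expseq al n) by ring.
  apply: ler_wpM2l; first by nneg.
  by rewrite mulrAC ler_pdivlMr // -mulrA mulrC -mulrA ler_pM2l //.
have -> : EB (n - s)%N - rho * expseq al n =
    \sum_(k < (n - s).+1) expseq be k * (expseq al (n - s - k)%N - expseq al n)
    + (\sum_(k < (n - s).+1) expseq be k - rho) * expseq al n.
  rewrite EE mulrBl mulr_suml addrA -big_split /=; congr (_ - _).
  by apply: eq_bigr => k _; ring.
apply: le_trans (ler_normD _ _) _; rewrite /V [leRHS]mulrDl; apply: lerD.
  apply: le_trans (ler_norm_sum _ _ _) _.
  have -> : 12 * Cp * Cs * s.+1%:R ^+ 2 * (d n * phi n) =
    Cp * Cs * s.+1%:R ^+ 2 * (d n * phi n) * 12 by ring.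
  apply: le_trans (_ : Cp * Cs * s.+1%:R ^+ 2 * (d n * phi n) *
     \sum_(k < (n - s).+1) k.+1%:R ^+ 2 * 2^-1 ^+ k <= _); last first.
    by apply: ler_wpM2l; [nneg|exact: sum_sqr_geometric].
  rewrite mulr_sumr; apply: ler_sum => k _; rewrite normrM.
  have kn : (k <= n - s)%N by rewrite -ltnS.
  have nk : (n - s - k <= n)%N by rewrite -subnDA leq_subr.
  apply: le_trans (ler_pM (normr_ge0 _) (normr_ge0 _) (HCp k) (Hs _ _ n0 nk)) _.
  have -> : Cp * Cs * s.+1%:R ^+ 2 * (d n * phi n) * (k.+1%:R ^+ 2 * 2^-1 ^+ k) =
    Cp * 2^-1 ^+ k * (Cs * (s.+1%:R * k.+1%:R) ^+ 2 * (d n * phi n)) by ring.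
  apply: ler_wpM2l; first by nneg.
  apply: ler_wpM2r; first by nneg.
  apply: ler_wpM2l; first by nneg.
  rewrite ler_pXn2r ?nnegrE // -natrM ler_nat.
  have -> : (n - (n - s - k) = s + k)%N by clear -kn sn; lia.
  by clear; nia.
rewrite normrM.
apply: le_trans (ler_pM (normr_ge0 _) (normr_ge0 _) (HCq _ bns) (HH n)) _.
have -> : CH * Cq * 2 ^+ s * (d n * phi n) = CH * Cq * d n * (2 ^+ s * phi n) by ring.
have -> : Cq * 2^-1 ^+ (n - s) * (CH * d n) = CH * Cq * d n * 2^-1 ^+ (n - s) by ring.
apply: ler_wpM2l; first by nneg.
rewrite -ler_pdivrMl ?exprn_gt0 // -exprVn -exprD subnKC //.
apply: le_trans pn; rewrite exprVn lef_pV2 ?posrE ?ltr0n ?exprn_gt0 //.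
by rewrite -natrX ler_nat ltnW // ltn_expl.
Qed.

Lemma decay_rate_powR (R : realType) (g : R) : 0 < g -> g <= 1 ->
  decay_rate (fun n => n%:R `^ (- g)).
Proof.
move=> g0 g1; split.
- move=> n n0; rewrite -powR_inv1 ?ler0n //; apply: ler_powR; rewrite ?ler1n //.
  by rewrite lerN2.
- move=> m n m0 n0 nm; rewrite !powRN.
  rewrite -(ler_pV2 (x := _ * _)) ?inE ?unitfE ?gt_eqF ?mulr_gt0 ?invr_gt0 ?powR_gt0 ?ltr0n //.
  rewrite invfM !invrK ler_pdivrMl // -[2]/(2%:R).
  apply: le_trans (_ : (2 * m)%:R `^ g <= _).
    by apply: ge0_ler_powR; rewrite ?nnegrE ?ler0n ?ler_nat ?ltW.
  rewrite natrM powRM ?ler0n //; apply: ler_wpM2r; first exact: powR_ge0.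
  by rewrite -[leRHS]powRr1 ?ler0n //; apply: ler_powR; rewrite ?ler1n.
- exists (1 + g^-1) => -[|N]; first by rewrite big_ord0; nneg.
  rewrite big_ord_recl /= powR1 divr1 lerD2l.
  (* Comparison with a telescoping sum. It reduces to 1 + g / (j + 2) <= ((j + 2) / (j + 1))^g,
     which follows from exp x >= 1 + x and from ln (1 + x) <= x at x = -1 / (j + 2). *)
  apply: le_trans (_ : \sum_(j < N) g^-1 * (j.+1%:R `^ (- g) - j.+2%:R `^ (- g)) <= _).
    apply: ler_sum => j _; rewrite /= /bump /= add1n.
    have a0 : 0 < j.+1%:R :> R by rewrite ltr0n.
    have b0 : 0 < j.+2%:R :> R by rewrite ltr0n.
    rewrite ler_pdivlMl //.
    have : 1 + g / j.+2%:R <= (j.+2%:R / j.+1%:R) `^ g.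
      rewrite /powR gt_eqF ?divr_gt0 //; apply: le_trans (expR_ge1Dx _).
      rewrite lerD2l ler_pM2l // -lerN2 -lnV ?posrE ?divr_gt0 // invf_div.
      have -> : j.+1%:R / j.+2%:R = 1 + - j.+2%:R^-1 :> R.
        by rewrite -{1}(addrK 1 j.+1%:R) natr1 mulrBl divff ?gt_eqF // mul1r.
      by apply: le_ln1Dx; rewrite ltrNr opprK invf_lt1 // ltr1n.
    have -> : (j.+2%:R / j.+1%:R) `^ g = j.+2%:R `^ g * j.+1%:R `^ (- g) :> R.
      by rewrite powRM ?invr_ge0 ?ler0n // -[j.+1%:R^-1]powR_inv1 ?ler0n // -powRrM mulN1r.
    move=> h.
    have pb : 0 < j.+2%:R `^ (- g) :> R by rewrite powR_gt0.
    have := ler_wpM2l (ltW pb) h; rewrite mulrA powRN mulVf ?mul1r ?gt_eqF ?powR_gt0 //.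
    rewrite mulrDr mulr1 => h2; have -> : g * ((j.+2%:R `^ g)^-1 / j.+2%:R) =
      (j.+2%:R `^ g)^-1 * (g / j.+2%:R) by ring.
    by rewrite lerBrDl.
  rewrite -mulr_sumr; apply: ler_piMr; first by nneg.
  have tel M : \sum_(j < M) (j.+1%:R `^ (- g) - j.+2%:R `^ (- g)) =
      1 - M.+1%:R `^ (- g) :> R.
    elim: M => [|M IH]; first by rewrite big_ord0 powR1 subrr.
    by rewrite big_ord_recr /= IH; ring.
  by rewrite tel gerBl powR_ge0.
- move=> e e0.
  pose K := (Num.truncn ((e^-1) `^ g^-1)).+1; exists K => k Kk.
  have k0 : 0 < k%:R :> R by rewrite ltr0n (leq_trans _ Kk).
  rewrite powRN -[e]invrK lef_pV2 ?posrE ?powR_gt0 ?invr_gt0 //.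
  have -> : e^-1 = ((e^-1) `^ g^-1) `^ g.
    by rewrite -powRrM mulVf ?gt_eqF // powRr1 // invr_ge0 ltW.
  apply: ge0_ler_powR; rewrite ?nnegrE ?powR_ge0 ?ler0n ?ltW //.
  apply: lt_le_trans (truncnS_gt _) _.
  by rewrite ler_nat.
Qed.

(** * The law of the cycle counts *)

Section CycleDecomposition.
Variable T : finType.
Implicit Types (A B : {set T}) (s u v : {perm T}) (x y : T).

Lemma perm_onP A s : reflect (forall y, y \notin A -> s y = y) (perm_on A s).
Proof.
apply: (iffP idP) => [sA y|sA]; first exact: out_perm sA.
by apply/fintype.subsetP => y; rewrite inE; apply: contraR => /sA ->.
Qed.

(** Permutations of A are permutations of the ambient type supported in A, so that removing a cycle
    changes A and never the type. Fixed points in A count as cycles of length 1. *)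
Definition cycles A s : {set {set T}} := [set porbit s y | y in A]%SET.

Definition cyclic_perm x B u := perm_on B u && (porbit u x == B).

Lemma expgp_agree B s u x i : (forall y, y \in B -> s y = u y) ->
  (forall y, y \in B -> u y \in B) -> x \in B ->
  (s ^+ i)%g x = (u ^+ i)%g x /\ (u ^+ i)%g x \in B.
Proof.
move=> su uB xB; elim: i => [|i [IH IB]]; first by rewrite !expg0 perm1.
by rewrite !expgSr !permM IH su //; split=> //; apply: uB.
Qed.

Lemma porbit_agree B s u x : (forall y, y \in B -> s y = u y) ->
  (forall y, y \in B -> u y \in B) -> x \in B -> porbit s x = porbit u x.
Proof.
move=> su uB xB; apply/setP => y; apply/porbitP/porbitP => -[i ->]; exists i;
  by have [] := expgp_agree i su uB xB.
Qed.

Lemma perm_on_stable A s y : perm_on A s -> y \in A -> s y \in A.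
Proof. by move=> sA yA; rewrite perm_closed. Qed.

Lemma porbit_sub A s x : perm_on A s -> x \in A -> porbit s x \subset A.
Proof.
move=> sA xA; apply/fintype.subsetP => y /porbitP[i ->].
by have [] := expgp_agree i (fun y _ => erefl (s y)) (fun y => perm_on_stable sA) xA.
Qed.

Lemma porbit_astabs s x : s \in ('N(porbit s x | 'P))%g.
Proof.
apply/astabsP => y /=.
by rewrite /aperm porbit_sym -[RHS]porbit_sym -(porbit_perm s 1 y) expg1.
Qed.

Lemma cyclic_restr_perm s x : cyclic_perm x (porbit s x) (restr_perm (porbit s x) s).
Proof.
rewrite /cyclic_perm restr_perm_on /=; apply/eqP/esym.
have xB := porbit_id s x.
apply: (@porbit_agree (porbit s x)) => // y yB.
  by rewrite restr_permE // porbit_astabs.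
by rewrite perm_on_stable // restr_perm_on.
Qed.

(** The product acts as [u] on [B] and as [v] off [B]. Hence multiplication by the cycle [u] is a
    bijection from the permutations supported in A minus B onto those supported in A whose cycle
    through x is [u]. *)
Lemma cyclic_mulP A B u v x : x \in B -> B \subset A -> cyclic_perm x B u ->
  [&& perm_on A (u * v)%g, porbit (u * v)%g x == B &
      restr_perm B (u * v)%g == u] = perm_on (A :\: B) v.
Proof.
move=> xB BA /andP[uB /eqP ux].
apply/and3P/idP => [[sA /eqP sx /eqP su]|vAB].
  apply/perm_onP => y; rewrite inE negb_and negbK => /orP[yB|yA].
    have [z zB yE] : exists2 z, z \in B & y = u z.
      by exists ((u^-1)%g y); rewrite ?permKV // -(perm_closed _ uB) permKV.
    rewrite yE -permM -[in RHS]su restr_permE //.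
    by rewrite -{1}sx porbit_astabs.
  have uy : u y = y by rewrite (out_perm uB) //; apply: contra yA; apply: fintype.subsetP.
  by rewrite -{1}uy -permM (out_perm sA).
have su y : y \in B -> (u * v)%g y = u y.
  move=> yB; rewrite permM (out_perm vAB) // inE negb_and negbK.
  by rewrite perm_on_stable.
have ox : porbit (u * v)%g x = B.
  by rewrite -[RHS]ux; apply: porbit_agree xB => // y; apply: perm_on_stable.
split; last 1 first.
- apply/eqP/permP => y; have [yB|yB] := boolP (y \in B).
    by rewrite restr_permE ?su // -{1}ox porbit_astabs.
  by rewrite (out_perm (restr_perm_on _ _)) // (out_perm uB).
- apply/perm_onP => y yA; have yB : y \notin B by apply: contra yA; apply: fintype.subsetP.
  by rewrite permM (out_perm uB) // (out_perm vAB) // inE (negbTE yA) andbF.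
- by rewrite ox.
Qed.

Lemma cycles_mul A B u v x : x \in B -> B \subset A -> cyclic_perm x B u ->
  perm_on (A :\: B) v -> cycles A (u * v)%g = B |: cycles (A :\: B) v.
Proof.
move=> xB BA uB vAB; have := cyclic_mulP v xB BA uB; rewrite vAB.
case/and3P => sA /eqP sx _; case/andP: uB => uB _.
rewrite /cycles -{1}(finset.setID A B) (finset.setIidPr BA) imsetU; congr (_ :|: _).
  apply/setP => C; rewrite inE; apply/imsetP/eqP => [[y yB ->]|->].
    by apply/eqP; rewrite -sx eq_porbit_mem sx.
  by exists x.
apply: eq_in_imset => y yAB; apply: (@porbit_agree (A :\: B)) => // z zAB.
  rewrite permM (out_perm uB) //; by move: zAB; rewrite inE => /andP[].
exact: perm_on_stable.
Qed.

Lemma notin_cycles A B s : B \notin cycles (A :\: B) s.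
Proof.
apply/imsetP => -[y yAB BE]; move: (porbit_id s y).
by rewrite -BE => yB; rewrite inE yB in yAB.
Qed.

(** Permutations are sorted by the orbit [B] of x and then by their restriction to [B]; the set of
    cycles does not depend on that restriction, hence the multiplicity. *)
Lemma sum_perm_on_cycle (V : zmodType) (F : {set {set T}} -> V) A x : x \in A ->
  \sum_(s | perm_on A s) F (cycles A s) =
  \sum_(B : {set T} | (x \in B) && (B \subset A))
    (\sum_(v | perm_on (A :\: B) v) F (B |: cycles (A :\: B) v))
      *+ #|[set u | cyclic_perm x B u]%SET|.
Proof.
move=> xA.
rewrite (partition_big (fun s => porbit s x) (fun B => (x \in B) && (B \subset A))) /=;
  last by move=> s sA; rewrite porbit_id porbit_sub.
apply: eq_bigr => B /andP[xB BA].
rewrite (partition_big (restr_perm B) (fun u => u \in [set u | cyclic_perm x B u]%SET)) /=;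
  last by move=> s /andP[sA /eqP <-]; rewrite inE cyclic_restr_perm.
rewrite -sumr_const; apply: eq_bigr => u; rewrite inE => uB.
rewrite (reindex_inj (mulgI u)) /=.
rewrite (eq_bigl (perm_on (A :\: B))); last first.
  by move=> v /=; rewrite -andbA; exact: cyclic_mulP xB BA uB.
by apply: eq_bigr => v vAB; rewrite (cycles_mul xB BA uB).
Qed.

Lemma sum_subset_card (V : zmodType) (f : nat -> V) A x : x \in A ->
  \sum_(B : {set T} | (x \in B) && (B \subset A)) f #|B| =
  \sum_(k < #|A|) f k.+1 *+ 'C(#|A|.-1, k).
Proof.
move=> xA; pose A' := A :\ x.
have cA : #|A| = #|A'|.+1 by rewrite (cardsD1 x) xA.
rewrite (reindex_onto (fun C => x |: C) (fun B => B :\ x)) /=; last first.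
  by move=> B /andP[xB _]; rewrite finset.setD1K.
rewrite (eq_bigl (fun C : {set T} => C \subset A')); last first.
  move=> C; rewrite finset.setU11 /= finset.subUset finset.sub1set xA /= finset.subsetD1.
  have [xC|xC] := boolP (x \in C); last by rewrite finset.setU1K // eqxx !andbT.
  by rewrite andbF; apply/negbTE/nandP; right; apply: contraTN xC => /eqP <-; rewrite finset.setD11.
rewrite (eq_bigr (fun C : {set T} => f #|C|.+1)); last first.
  by move=> C; rewrite finset.subsetD1 => /andP[_ xC]; rewrite cardsU1 xC.
rewrite (partition_big (fun C : {set T} => inord #|C| : 'I_#|A'|.+1) xpredT) //= cA /=.
apply: eq_bigr => k _.
rewrite (eq_bigl (fun C => C \in [set C : {set T} | C \subset A' & #|C| == k]%SET)); last first.
  move=> C; rewrite !inE; case CA: (C \subset A') => //=.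
  by rewrite -val_eqE /= inordK // ltnS subset_leq_card.
rewrite (eq_bigr (fun=> f k.+1)); last by move=> C; rewrite inE => /andP[_ /eqP ->].
by rewrite sumr_const cards_draws.
Qed.

(** With the constant 1 the decomposition reads |B|! = sum over C of the number of cyclic
    permutations of C times (|B| - |C|)!. For |B| = m + 1, induction makes each smaller size
    contribute m!, in total m m!, and (m + 1)! - m m! = m! is left for C = B. *)
Lemma card_cyclic_perm B x : x \in B ->
  #|[set u | cyclic_perm x B u]%SET| = (#|B|.-1)`!.
Proof.
have [n] := ubnP #|B|; elim: n => // n IH in B *; rewrite ltnS => Bn xB.
have B0 : (0 < #|B|)%N by apply/card_gt0P; exists x.
pose z k : int := if k == #|B| then (#|[set u | cyclic_perm x B u]%SET|)%:Z
  else ((k.-1)`! * (#|B| - k)`!)%N%:Z.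
have := sum_perm_on_cycle (fun=> 1 : int) xB.
have sum1 (C : {set T}) : \sum_(s | perm_on C s) (1 : int) = ((#|C|)`!)%:Z.
  by rewrite -card_perm -natz -sumr_const.
rewrite sum1.
rewrite (eq_bigr (fun C : {set T} => z #|C|)); last first.
  move=> C /andP[xC CB]; rewrite sum1 /z.
  have [cC|cC] := eqVneq #|C| #|B|.
    have -> : C = B by apply/eqP; rewrite eqEcard CB cC leqnn.
    by rewrite finset.setDv cards0 fact0 natz.
  have CltB : (#|C| < #|B|)%N by rewrite ltn_neqAle cC subset_leq_card.
  rewrite (IH C) ?(leq_trans CltB) // cardsD (finset.setIidPr CB).
  by rewrite -mulr_natr natz -PoszM mulnC.
rewrite sum_subset_card //.
rewrite /z; case: #|B| B0 => // m _ /=; rewrite big_ord_recr /= eqxx binn mulr1n.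
rewrite (eq_bigr (fun=> (m`!)%:Z)); last first.
  move=> k _; rewrite eqSS (ltn_eqF (ltn_ord k)) subSS.
  by rewrite -mulr_natr natz -PoszM mulnC bin_fact // ltnW.
rewrite sumr_const card_ord -mulr_natr natz -PoszM -PoszD => -[].
by rewrite factS mulSn mulnC addnC => /addnI.
Qed.

End CycleDecomposition.

(** * Total weight of the permutations with prescribed short cycle counts *)

Section CycleWeights.
Variables (R : realType) (w : nat -> R) (b : nat).
Implicit Types (c : nat -> nat).

Definition long_weights k := if (k <= b)%N then 0 else w k.

Definition short_cycle_size c := (\sum_(i < b) i.+1 * c i)%N.

Definition short_cycle_weight c : R :=
  \prod_(i < b) ((w i.+1 / i.+1%:R) ^+ c i / (c i)`!%:R).

(* 1/n! times the total weight of the permutations of n points having c i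
   cycles of length i + 1 for every i < b *)
Definition count_weight n c : R :=
  if (short_cycle_size c <= n)%N then
    short_cycle_weight c * expseq long_weights (n - short_cycle_size c)
  else 0.

(** Removes one cycle of length k + 1. The subtraction is truncated at 0, whence the guards on
    [c k == 0] below. *)
Definition decr_count k c := fun i => (c i - (i == k))%N.

Lemma decr_countk k c : decr_count k c k = (c k).-1.
Proof. by rewrite /decr_count eqxx subn1. Qed.

Lemma short_cycle_size_decr c k : (k < b)%N -> (0 < c k)%N ->
  short_cycle_size c = (k.+1 + short_cycle_size (decr_count k c))%N.
Proof.
move=> kb ck; rewrite /short_cycle_size (bigD1 (Ordinal kb)) //=.
rewrite [in RHS](bigD1 (Ordinal kb)) //= addnA decr_countk.
rewrite -mulnS prednK //; congr (_ + _)%N; apply: eq_bigr => i ik.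
by rewrite /decr_count (_ : (i : nat) == k = false) ?subn0 //; apply: negbTE.
Qed.

Lemma short_cycle_weight_decr c k : (k < b)%N -> (0 < c k)%N ->
  w k.+1 * short_cycle_weight (decr_count k c) =
  (k.+1 * c k)%:R * short_cycle_weight c.
Proof.
move=> kb ck; rewrite /short_cycle_weight (bigD1 (Ordinal kb)) //=.
rewrite [in RHS](bigD1 (Ordinal kb)) //= !mulrA decr_countk.
congr (_ * _); last first.
  apply: eq_bigr => i ik.
  by rewrite /decr_count (_ : (i : nat) == k = false) ?subn0 //; apply: negbTE.
rewrite -[in RHS](prednK ck) exprS factS !natrM.
have k0 : k.+1%:R != 0 :> R by rewrite pnatr_eq0.
have c0 : ((c k).-1).+1%:R != 0 :> R by rewrite pnatr_eq0.
have f0 : ((c k).-1)`!%:R != 0 :> R by rewrite pnatr_eq0 -lt0n fact_gt0.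
move: f0 c0 k0; move: (_`!%:R : R) (_.-1.+1%:R : R) (k.+1%:R : R) => x y z x0 y0 z0.
by field; rewrite x0 y0.
Qed.

Lemma decr_count_long c k : (b <= k)%N ->
  short_cycle_size (decr_count k c) = short_cycle_size c /\
  short_cycle_weight (decr_count k c) = short_cycle_weight c.
Proof.
move=> bk; split; apply: eq_bigr => i _;
  by rewrite /decr_count (_ : (i : nat) == k = false) ?subn0 // ltn_eqF // (leq_trans _ bk).
Qed.

(** The index k stands for the length k + 1 of the cycle through a given point. Short lengths
    contribute (k + 1) c_k times [count_weight n.+1 c], S times in total; long ones reproduce the
    exponential recurrence at n + 1 - S. The two factors add up to n + 1. *)
Lemma count_weight_rec n c : n.+1%:R * count_weight n.+1 c =
  \sum_(k < n.+1) w k.+1 * (if (k < b)%N && (c k == 0%N) then 0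
                            else count_weight (n - k) (decr_count k c)).
Proof.
set S := short_cycle_size c; set G := short_cycle_weight c.
pose e := expseq long_weights.
have short (k : 'I_n.+1) : (k < b)%N ->
    w k.+1 * (if (k < b)%N && (c k == 0%N) then 0
              else count_weight (n - k) (decr_count k c)) =
    (k.+1 * c k)%:R * count_weight n.+1 c.
  move=> kb; rewrite kb /=; have [->|ck] := posnP (c k).
    by rewrite mulr0 muln0 mul0r.
  rewrite /count_weight -/S.
  have SE := short_cycle_size_decr kb ck; rewrite -/S in SE.
  have kn : (k <= n)%N by rewrite -ltnS.
  have -> : (short_cycle_size (decr_count k c) <= n - k)%N = (S <= n.+1)%N.
    by rewrite SE; clear -kn; lia.
  case: ifP => Sn; last by rewrite !mulr0.
  rewrite mulrA short_cycle_weight_decr // -mulrA; congr (_ * (_ * e _)).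
  by rewrite SE; clear -kn; lia.
have long (k : 'I_n.+1) : ~~ (k < b)%N ->
    w k.+1 * (if (k < b)%N && (c k == 0%N) then 0
              else count_weight (n - k) (decr_count k c)) =
    (if (S <= n - k)%N then G * (long_weights k.+1 * e (n - k - S)%N) else 0).
  rewrite -leqNgt => bk; rewrite ltnNge bk /= /count_weight.
  have [-> ->] := decr_count_long c bk; rewrite -/S -/G.
  by case: ifP => _; rewrite ?mulr0 // /long_weights ltnNge bk /= mulrCA.
rewrite (bigID (fun k : 'I_n.+1 => (k < b)%N)) /=.
under eq_bigr => k kb do rewrite short //.
under [X in _ + X]eq_bigr => k kb do rewrite long //.
rewrite -mulr_suml /count_weight -/S -/G.
have [Sn|nS] := leqP S n.+1; last first.
  rewrite !mulr0 add0r big1 // => k _; rewrite ifN // -ltnNge.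
  exact: leq_ltn_trans (leq_subr _ _) (ltnW nS).
have -> : \sum_(k < n.+1 | (k < b)%N) (k.+1 * c k)%:R = S%:R :> R.
  rewrite -natr_sum; congr (_%:R); rewrite /S /short_cycle_size.
  rewrite -(big_mkord (fun k => (k < b)%N) (fun k => (k.+1 * c k)%N)).
  rewrite -(big_mkord xpredT (fun k => (k.+1 * c k)%N)).
  (* Lengths above n + 1 have [c k = 0], as otherwise S would exceed n + 1. *)
  rewrite [RHS](bigID (fun k => (k < n.+1)%N)) /= [X in (_ + X)%N]big_nat_cond.
  rewrite [X in (_ + X)%N]big1 ?addn0; last first.
    move=> k /andP[/andP[_ kb] nk]; apply/eqP; rewrite muln_eq0 /=; apply/eqP.
    have [//|ck] := posnP (c k).
    have := short_cycle_size_decr kb ck; rewrite -/S => SE.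
    by move: nk; rewrite -leqNgt => nk; exfalso; clear -nk SE Sn; lia.
  rewrite (big_nat_widen 0 n.+1 (maxn n.+1 b)) ?leq_maxl //.
  rewrite [RHS](big_nat_widen 0 b (maxn n.+1 b)) ?leq_maxr //.
  by apply: eq_bigl => k; rewrite andbC.
rewrite (eq_bigl (fun k : 'I_n.+1 => ~~ (k < b)%N)) //.
have -> : \sum_(i < n.+1 | ~~ (i < b)%N) (if (S <= n - i)%N then
    G * (long_weights i.+1 * e (n - i - S)%N) else 0) =
    G * ((n.+1 - S)%:R * e (n.+1 - S)%N).
  have -> : \sum_(i < n.+1 | ~~ (i < b)%N) (if (S <= n - i)%N then
      G * (long_weights i.+1 * e (n - i - S)%N) else 0) =
    G * \sum_(i < n.+1 | (S <= n - i)%N) long_weights i.+1 * e (n - i - S)%N.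
    rewrite mulr_sumr -big_mkcondr /= [RHS](bigID (fun i : 'I_n.+1 => (i < b)%N)) /=.
    rewrite [X in _ = X + _]big1 ?add0r.
      by apply: eq_bigl => i; rewrite andbC.
    by move=> i /andP[_ ib]; rewrite /long_weights ib mul0r mulr0.
  congr (_ * _); move: Sn; rewrite leq_eqVlt ltnS => /predU1P[SE|Sn].
    rewrite SE subnn mul0r big1 // => i ni.
    by exfalso; have := ltn_ord i; clear -ni; lia.
  rewrite subSn // expseqS.
  rewrite (big_ord_widen_cond n.+1 xpredT (fun j => long_weights j.+1 * e (n - S - j)%N));
    last by rewrite ltnS leq_subr.
  apply: eq_big => [i|i _]; first by rewrite /= ltnS; have := ltn_ord i; clear -Sn; lia.
  by rewrite subnAC.
have -> : n.+1%:R = S%:R + (n.+1 - S)%:R :> R by rewrite -natrD subnKC.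
by rewrite /e; ring.
Qed.

Lemma count_weight0 c :
  count_weight 0 c = if [forall i : 'I_b, c i == 0%N] then 1 else 0.
Proof.
rewrite /count_weight leqn0 /short_cycle_size sum_nat_eq0.
have -> : [forall i : 'I_b, i.+1 * c i == 0]%N = [forall i : 'I_b, c i == 0%N].
  by apply: eq_forallb => i; rewrite muln_eq0.
case: ifP => // /forallP c0; rewrite sub0n expseq0 mulr1.
by rewrite /short_cycle_weight big1 // => i _; rewrite (eqP (c0 i)) expr0 divr1.
Qed.

Variable T : finType.
Implicit Types (X : {set {set T}}) (A B : {set T}).

Definition size_count i X := #|[set C in X | #|C| == i]%SET|.

Lemma size_countU1 i B X : B \notin X ->
  size_count i (B |: X) = ((#|B| == i) + size_count i X)%N.
Proof.
move=> BX; rewrite /size_count (cardsD1 B) !inE eqxx /=; congr (_ + _)%N.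
apply: eq_card => C; rewrite !inE; have [->|CB] //= := eqVneq C B.
by rewrite (negbTE BX).
Qed.

(** Induction on |A| = m + 1, removing the cycle through a point: the binomial number of supports of
    size k + 1, the k! cycles on each and the (m - k)! of the induction hypothesis multiply to m!,
    and [count_weight_rec] remains. *)
Lemma sum_perm_on_weight A c :
  \sum_(s | perm_on A s) (if [forall i : 'I_b, size_count i.+1 (cycles A s) == c i]
      then \prod_(C in cycles A s) w #|C| else 0) =
  (#|A|)`!%:R * count_weight #|A| c.
Proof.
have [n] := ubnP #|A|; elim: n => // n IH in A c *; rewrite ltnS => An.
have [A0|] := posnP #|A|.
  have -> : A = finset.set0 by apply/eqP; rewrite -cards_eq0 A0.
  have c0 s : cycles (finset.set0 : {set T}) s = finset.set0 by rewrite /cycles imset0.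
  rewrite cards0 mul1r count_weight0.
  under eq_bigr => s _ do rewrite c0 big_set0.
  rewrite sumr_const card_perm cards0 mulr1n.
  congr (if _ then _ else _); apply: eq_forallb => i.
  rewrite eq_sym /size_count (_ : [set C in _ | _]%SET = finset.set0) ?cards0 //.
  by apply/setP => C; rewrite !inE.
case/card_gt0P => x xA.
rewrite (sum_perm_on_cycle (fun X => if [forall i : 'I_b, size_count i.+1 X == c i]
  then \prod_(C in X) w #|C| else 0) xA).
pose g k := w k.+1 * (if (k < b)%N && (c k == 0%N) then 0
   else count_weight (#|A| - k.+1) (decr_count k c)).
rewrite (eq_bigr (fun B : {set T} =>
   (#|B|.-1)`!%:R * (#|A| - #|B|)`!%:R * g #|B|.-1)); last first.
  move=> B /andP[xB BA]; rewrite card_cyclic_perm //.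
  have B0 : (0 < #|B|)%N by apply/card_gt0P; exists x.
  have cAB : (#|A :\: B| = #|A| - #|B|)%N by rewrite cardsD (finset.setIidPr BA).
  have ABn : (#|A :\: B| < n)%N.
    by rewrite cAB; have := subset_leq_card BA; clear -An B0; lia.
  pose k := #|B|.-1.
  rewrite -[LHS]mulr_natl -[RHS]mulrA -/k; congr (_ * _).
  rewrite /g (prednK B0).
  have Bk : #|B| = k.+1 by rewrite prednK.
  (* Removing [B] lowers the prescribed counts to [decr_count]; the prescription fails outright when
     [B] is short and its length has prescribed count 0. *)
  have okE v : [forall i : 'I_b, size_count i.+1 (B |: cycles (A :\: B) v) == c i] =
     ~~ ((#|B| <= b)%N && (c k == 0%N)) &&
     [forall i : 'I_b, size_count i.+1 (cycles (A :\: B) v) == decr_count k c i].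
    have kE i : (#|B| == i.+1) = (i == k) by rewrite -(prednK B0) eqSS eq_sym.
    apply/forallP/andP => [H|[ck /forallP H] i].
      split.
        apply/negP => /andP[]; rewrite Bk => kb /eqP ck; have := H (Ordinal kb).
        by rewrite size_countU1 ?notin_cycles //= kE eqxx ck.
      apply/forallP => i; have := H i.
      by rewrite size_countU1 ?notin_cycles // kE /decr_count => /eqP <-; rewrite addKn.
    rewrite size_countU1 ?notin_cycles // kE (eqP (H i)) /decr_count.
    have [ik|] := eqVneq (i : nat) k; last by rewrite add0n subn0.
    move: ck; rewrite Bk -ik ltn_ord /= -lt0n => ci.
    by rewrite subn1 add1n prednK.
  under eq_bigr => v _ do rewrite okE.
  case: ifP => guard /=.
    by rewrite !mulr0 big1.
  rewrite -cAB mulrCA -IH // mulr_sumr; apply: eq_bigr => v _.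
  by case: ifP => _; rewrite ?mulr0 // big_setU1 ?notin_cycles //= /k (prednK B0).
rewrite (sum_subset_card (fun k => (k.-1)`!%:R * (#|A| - k)`!%:R * g k.-1) xA).
have A0 : (0 < #|A|)%N by apply/card_gt0P; exists x.
rewrite /g; case: #|A| A0 => // m _ /=.
rewrite factS natrM mulrAC count_weight_rec mulrC mulr_sumr.
apply: eq_bigr => k _; have kn : (k <= m)%N by rewrite -ltnS.
rewrite subSS -[LHS]mulr_natl !mulrA -mulrA -[RHS]mulrA; congr (_ * _).
by rewrite -!natrM -(bin_fact kn) mulnA.
Qed.

End CycleWeights.

(** * The law of the cycle counts under [PTheta] *)

Section CycleCountLaw.
Variables (R : realType) (Theta : nat -> R).

Lemma cyclesT (T : finType) (s : {perm T}) : cycles [set: T]%SET s = porbits s.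
Proof.
by apply/setP => C; apply/imsetP/imsetP => -[x _ ->]; exists x; rewrite ?inE.
Qed.

Lemma weightE n (s : 'S_n) : weight Theta s = \prod_(C in porbits s) Theta #|C|.
Proof.
rewrite (partition_big (fun C : {set 'I_n} => inord #|C| : 'I_n.+1) xpredT) //=.
(* The block of orbits of size 0 is empty, so its factor is 1. *)
rewrite /weight big_add1 /= big_mkord [RHS]big_ord_recl /= [X in X * _]big1 ?mul1r.
  apply: eq_bigr => i _; rewrite /cycle_count -prodr_const; symmetry.
  rewrite (eq_bigr (fun=> Theta i.+1)).
    apply: eq_bigl => C; rewrite inE; congr (_ && _).
    rewrite -val_eqE /= inordK // ltnS.
    by apply: leq_trans (max_card _) _; rewrite card_ord.
  move=> C /andP[_ /eqP /(congr1 val)] /=; rewrite inordK => [->//|].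
  by rewrite ltnS; apply: leq_trans (max_card _) _; rewrite card_ord.
move=> C /andP[/imsetP[x _ ->] /eqP /(congr1 val)] /=.
rewrite inordK => [/eqP|]; first by rewrite (negbTE (card_porbit_neq0 s x)).
by rewrite ltnS; apply: leq_trans (max_card _) _; rewrite card_ord.
Qed.

Lemma sum_weight b n (c : nat -> nat) :
  \sum_(s : 'S_n | [forall i : 'I_b, cycle_count i.+1 s == c i]) weight Theta s =
  n`!%:R * count_weight Theta b n c.
Proof.
have := @sum_perm_on_weight R Theta b 'I_n [set: 'I_n]%SET c.
rewrite cardsT card_ord => <-; rewrite big_mkcond /=.
apply: eq_big => [s|s _]; first by apply/esym/perm_onP => x; rewrite inE.
by rewrite cyclesT weightE.
Qed.

(** The case b = 0 of the weighted count, where no length is prescribed. *)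
Lemma h_normE n : h_norm Theta n = expseq Theta n.
Proof.
rewrite /h_norm; have := @sum_weight 0 n (fun=> 0%N).
rewrite (eq_bigl xpredT) => [->|s]; last by apply/forallP => -[].
rewrite mulKf; last by rewrite pnatr_eq0 -lt0n fact_gt0.
rewrite /count_weight /short_cycle_size /short_cycle_weight !big_ord0 /= subn0 mul1r.
by apply: eq_expseq => -[].
Qed.

Lemma Pr_Theta_counts b n (c : nat -> nat) :
  Pr_Theta Theta [set s : 'S_n | [forall i : 'I_b, cycle_count i.+1 s == c i]]%SET =
  count_weight Theta b n c / expseq Theta n.
Proof.
rewrite /Pr_Theta /PTheta -mulr_sumr.
under eq_bigl => s do rewrite inE.
rewrite sum_weight h_normE invfM mulrC mulrACA mulrC.
by rewrite mulrA divfK // pnatr_eq0 -lt0n fact_gt0.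
Qed.

Lemma sum_PTheta n : expseq Theta n != 0 -> \sum_(s : 'S_n) PTheta Theta s = 1.
Proof.
move=> e0; have := @Pr_Theta_counts 0 n (fun=> 0%N).
rewrite /Pr_Theta (eq_bigl xpredT) => [->|s]; last by rewrite inE; apply/forallP => -[].
have -> : count_weight Theta 0 n (fun=> 0%N) = expseq Theta n; last by rewrite divff.
rewrite /count_weight /short_cycle_size /short_cycle_weight !big_ord0 /= subn0 mul1r.
by apply: eq_expseq => -[].
Qed.

End CycleCountLaw.

(** * Goursat's lemma on rectangles *)

Section SegmentIntegral.
Variable R : realType.
Implicit Types (f g F : R -> R) (a b c : R).

Definition sint f a b : R := (\int[lebesgue_measure]_(x in `[a, b]) f x)%R.

Definition cont_on f a b := forall x, a <= x <= b -> {for x, continuous f}.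

Lemma cont_on_integrable f a b : cont_on f a b ->
  (@lebesgue_measure R).-integrable `[a, b] (EFin \o f).
Proof.
move=> cf; apply: continuous_compact_integrable; first exact: segment_compact.
apply: continuous_in_subspaceT => x; rewrite inE /= in_itv /= => xab.
exact: cf.
Qed.

Lemma cont_onS f a b c d : a <= c -> d <= b -> cont_on f a b -> cont_on f c d.
Proof. by move=> ac db cf x /andP[cx xd]; apply: cf; rewrite (le_trans ac) ?(le_trans xd). Qed.

Lemma sint_cat f a c b : a <= c -> c <= b -> cont_on f a b ->
  sint f a b = sint f a c + sint f c b.
Proof.
move=> ac cb cf.
have := @Rintegral_itvB R f (BLeft a) (BRight b) c (cont_on_integrable cf).
rewrite !bnd_simp => /(_ ac cb) /=.
rewrite Rintegral_itv_obnd_cbnd; last first.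
  apply: integrableS (cont_on_integrable (cont_onS ac (lexx b) cf)) => //.
  by apply: subset_itvr; rewrite bnd_simp.
by rewrite /sint => <-; rewrite addrC subrK.
Qed.

Lemma sintD f g a b : cont_on f a b -> cont_on g a b ->
  sint (fun x => f x + g x) a b = sint f a b + sint g a b.
Proof. by move=> cf cg; apply: RintegralD => //; exact: cont_on_integrable. Qed.

Lemma sintB f g a b : cont_on f a b -> cont_on g a b ->
  sint (fun x => f x - g x) a b = sint f a b - sint g a b.
Proof. by move=> cf cg; apply: RintegralB => //; exact: cont_on_integrable. Qed.

Lemma sintZ f k a b : cont_on f a b -> sint (fun x => k * f x) a b = k * sint f a b.
Proof. by move=> cf; apply: RintegralZl => //; exact: cont_on_integrable. Qed.

Lemma eq_sint f g a b : (forall x, a <= x <= b -> f x = g x) -> sint f a b = sint g a b.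
Proof.
by move=> fg; apply: eq_Rintegral => x; rewrite inE /= in_itv /=; exact: fg.
Qed.

Lemma sint_le f g a b : cont_on f a b -> cont_on g a b ->
  (forall x, a <= x <= b -> f x <= g x) -> sint f a b <= sint g a b.
Proof.
move=> cf cg fg; apply: le_Rintegral => //; exact: cont_on_integrable.
Qed.

Lemma cont_on_norm f a b : cont_on f a b -> cont_on (fun x => `|f x|) a b.
Proof. by move=> cf x /cf; exact: cvg_norm. Qed.

Lemma sint_norm_le f g a b : cont_on f a b -> cont_on g a b ->
  (forall x, a <= x <= b -> `|f x| <= g x) -> `|sint f a b| <= sint g a b.
Proof.
move=> cf cg fg; apply: le_trans (_ : sint (fun x => `|f x|) a b <= _).
  by apply: le_normr_Rintegral => //; exact: cont_on_integrable.
by apply: sint_le => //; exact: cont_on_norm.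
Qed.

Lemma sint_cst k a b : a <= b -> sint (fun=> k) a b = k * (b - a).
Proof.
move=> ab; rewrite /sint Rintegral_cst //=; congr (_ * _).
transitivity (fine (lebesgue_measure [set` `[a, b]%R])) => //.
rewrite lebesgue_measure_itv /= lte_fin.
by case: ltgtP ab => // ->; rewrite subrr.
Qed.

Lemma sint_FTC F f a b : a <= b -> (forall x, is_derive x (1 : R) F (f x)) ->
  continuous f -> sint f a b = F b - F a.
Proof.
rewrite le_eqVlt => /predU1P[<- _ _|ab dF cf].
  by rewrite subrr /sint set_itv1 Rintegral_set1.
rewrite /sint /Rintegral (@continuous_FTC2 _ f F) //.
- exact: continuous_subspaceT.
- have cF x : {for x, continuous F}.
    by apply: differentiable_continuous; apply/derivable1_diffP; case: (dF x).
  split; first by move=> x _; case: (dF x).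
    exact: cvg_at_right_filter (cF a).
  exact: cvg_at_left_filter (cF b).
- by move=> x _; rewrite derive1E; case: (dF x).
Qed.

End SegmentIntegral.

Section Goursat.
Variable R : realType.
Implicit Types (P Q : R -> R -> R) (x t a c w h : R).

Definition lin_approx P x t p1 p2 := forall e, 0 < e -> exists2 d, 0 < d &
  forall x' t', `|x' - x| < d -> `|t' - t| < d ->
    `|P x' t' - P x t - (p1 * (x' - x) + p2 * (t' - t))|
      <= e * (`|x' - x| + `|t' - t|).

(* The 1-form P dx + Q dt is differentiable and closed at (x, t). *)
Definition closed_at P Q x t := exists p1 p2 q2,
  lin_approx P x t p1 p2 /\ lin_approx Q x t p2 q2.

Lemma lin_approx_continuous P x t p1 p2 : lin_approx P x t p1 p2 ->
  {for x, continuous (fun x => P x t)} /\ {for t, continuous (P x)}.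
Proof.
move=> H; have [d d0 Hd] := H 1 ltr01.
have main e : 0 < e -> exists2 d', 0 < d' & forall x' t', `|x' - x| < d' ->
    `|t' - t| < d' -> `|P x t - P x' t'| <= e.
  move=> e0; pose M := 2 + `|p1| + `|p2|.
  have M0 : 0 < M by rewrite /M; pos.
  exists (Num.min d (e / (M * 2))); first by rewrite lt_min d0 divr_gt0 ?mulr_gt0.
  move=> x' t'; rewrite !lt_min => /andP[xd xe] /andP[td te].
  have := Hd x' t' xd td; rewrite mul1r distrC.
  set u := x' - x in xe *; set v := t' - t in te *.
  have pu : `|p1 * u + p2 * v| <= `|p1| * `|u| + `|p2| * `|v|.
    by apply: le_trans (ler_normD _ _) _; rewrite !normrM.
  have ue : `|u| * (M * 2) <= e by rewrite -ler_pdivlMr ?mulr_gt0 // ltW.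
  have ve : `|v| * (M * 2) <= e by rewrite -ler_pdivlMr ?mulr_gt0 // ltW.
  have := normr_ge0 u; have := normr_ge0 v; have := normr_ge0 p1; have := normr_ge0 p2.
  move=> h2 h1 v0 u0 h.
  have : `|P x t - P x' t'| <= `|p1 * u + p2 * v - (P x' t' - P x t)| + `|p1 * u + p2 * v|.
    rewrite -[leLHS]normrN.
    have -> : - (P x t - P x' t') =
     - (p1 * u + p2 * v - (P x' t' - P x t)) + (p1 * u + p2 * v) by ring.
    by apply: le_trans (ler_normD _ _) _; rewrite normrN.
  move=> h3; apply: (le_trans h3).
  have k1 : `|p1| * `|u| + `|p2| * `|v| + (`|u| + `|v|) <= M * `|u| + M * `|v|.
    rewrite /M !mulrDl; have := mulr_ge0 h2 u0; have := mulr_ge0 h1 v0; lra.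
  have : M * `|u| + M * `|v| <= e by lra.
  lra.
split; apply/cvgrPdist_le => e e0; have [d' d'0 H'] := main e e0;
  apply/nbhs_ballP; exists d' => //= y yd; apply: H'; rewrite ?subrr ?normr0 //;
  by rewrite distrC.
Qed.

Lemma affine_continuous (k0 k1 k2 y : R) :
  continuous (fun z : R => k0 + k1 * (z - y) + k2).
Proof.
move=> z; apply: cvgD; last exact: cvg_cst.
apply: cvgD; first exact: cvg_cst.
apply: cvgM; first exact: cvg_cst.
by apply: cvgB; [exact: cvg_id|exact: cvg_cst].
Qed.

Definition bint P Q a c w h :=
  sint (fun x => P x c) a (a + w) + sint (Q (a + w)) c (c + h)
  - sint (fun x => P x (c + h)) a (a + w) - sint (Q a) c (c + h).

Definition closed_on P Q a c w h := forall x t, a <= x <= a + w ->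
  c <= t <= c + h -> closed_at P Q x t.

Lemma closed_on_cont P Q a c w h : 0 <= w -> 0 <= h -> closed_on P Q a c w h ->
  (forall t, c <= t <= c + h -> cont_on (fun x => P x t) a (a + w)) /\
  (forall x, a <= x <= a + w -> cont_on (Q x) c (c + h)).
Proof.
move=> w0 h0 H; split=> [t th x xw|x xw t th];
  have [p1 [p2 [q2 [HP HQ]]]] := H x t xw th.
  by have [] := lin_approx_continuous HP.
by have [] := lin_approx_continuous HQ.
Qed.

(** The affine parts cancel around the rectangle because the t-derivative of P and the x-derivative
    of Q are the same [p2]. Each side leaves an error of at most e (w + h) times its length, and the
    four sides give 2 e (w + h)^2. *)
Lemma bint_small P Q a c w h x t p1 p2 q2 d e : 0 <= w -> 0 <= h -> 0 <= e ->
  closed_on P Q a c w h -> a <= x <= a + w -> c <= t <= c + h ->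
  (forall x' t', `|x' - x| < d -> `|t' - t| < d ->
     `|P x' t' - P x t - (p1 * (x' - x) + p2 * (t' - t))|
       <= e * (`|x' - x| + `|t' - t|)) ->
  (forall x' t', `|x' - x| < d -> `|t' - t| < d ->
     `|Q x' t' - Q x t - (p2 * (x' - x) + q2 * (t' - t))|
       <= e * (`|x' - x| + `|t' - t|)) ->
  w < d -> h < d -> `|bint P Q a c w h| <= 2 * e * (w + h) ^+ 2.
Proof.
move=> w0 h0 e0 H xw th HP HQ wd hd.
have [cP cQ] := closed_on_cont w0 h0 H.
have ab : a <= a + w by rewrite lerDl.
have cb : c <= c + h by rewrite lerDl.
have dist x' : a <= x' <= a + w -> `|x' - x| <= w.
  by move: xw => /andP[? ?] /andP[? ?]; rewrite ler_norml; apply/andP; split; lra.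
have dist' t' : c <= t' <= c + h -> `|t' - t| <= h.
  by move: th => /andP[? ?] /andP[? ?]; rewrite ler_norml; apply/andP; split; lra.
have aff (k0 k1 k2 y b l : R) : 0 <= l ->
    sint (fun z => k0 + k1 * (z - y) + k2) b (b + l) =
    (k0 + k2) * l + k1 * (((b + l) - y) ^+ 2 - (b - y) ^+ 2) / 2.
  move=> l0; pose F z := (k0 + k2) * z + k1 * (z - y) ^+ 2 / 2.
  transitivity (F (b + l) - F b); last by rewrite /F; ring.
  apply: sint_FTC => [|z|z]; first by rewrite lerDl.
    apply: is_derive_eq; rewrite /GRing.scale /=; by field.
  exact: affine_continuous.
have affc (k0 k1 k2 y b l : R) : cont_on (fun z => k0 + k1 * (z - y) + k2) b l.
  by move=> z _; exact: affine_continuous.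
have estP t' : c <= t' <= c + h ->
   `|sint (fun x' => P x' t') a (a + w) -
     sint (fun x' => P x t + p1 * (x' - x) + p2 * (t' - t)) a (a + w)| <= e * (w + h) * w.
  move=> t'h; rewrite -sintB //; last exact: cP.
  have -> : e * (w + h) * w = sint (fun=> e * (w + h)) a (a + w).
    by rewrite sint_cst // addrAC subrr add0r.
  apply: sint_norm_le.
  - move=> z zw; apply: cvgB; first exact: cP.
    exact: affine_continuous.
  - by move=> z _; exact: cvg_cst.
  move=> x' x'w; rewrite -addrA opprD addrA.
  apply: le_trans (HP _ _ _ _) _; first exact: le_lt_trans (dist _ x'w) wd.
    exact: le_lt_trans (dist' _ t'h) hd.
  by rewrite ler_wpM2l // lerD ?dist ?dist'.
have estQ x' : a <= x' <= a + w ->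
   `|sint (Q x') c (c + h) -
     sint (fun t' => Q x t + q2 * (t' - t) + p2 * (x' - x)) c (c + h)| <= e * (w + h) * h.
  move=> x'w; rewrite -sintB //; last exact: cQ.
  have -> : e * (w + h) * h = sint (fun=> e * (w + h)) c (c + h).
    by rewrite sint_cst // addrAC subrr add0r.
  apply: sint_norm_le.
  - move=> z zw; apply: cvgB; first exact: cQ.
    exact: affine_continuous.
  - by move=> z _; exact: cvg_cst.
  move=> t' t'h; rewrite -addrA [q2 * _ + _]addrC opprD addrA.
  apply: le_trans (HQ _ _ _ _) _; first exact: le_lt_trans (dist _ x'w) wd.
    exact: le_lt_trans (dist' _ t'h) hd.
  by rewrite ler_wpM2l // lerD ?dist ?dist'.
have ca : c <= c <= c + h by rewrite lexx.
have cc : c <= c + h <= c + h by rewrite lexx andbT.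
have aa : a <= a <= a + w by rewrite lexx.
have ac : a <= a + w <= a + w by rewrite lexx andbT.
have := estP _ ca; have := estP _ cc; have := estQ _ aa; have := estQ _ ac.
rewrite !aff // /bint.
have -> : 2 * e * (w + h) ^+ 2 = 2 * (e * (w + h) * w) + 2 * (e * (w + h) * h) by ring.
rewrite !ler_norml => /andP[l1 u1] /andP[l2 u2] /andP[l3 u3] /andP[l4 u4].
apply/andP; split; lra.
Qed.

Lemma bint_split P Q a c w h : 0 <= w -> 0 <= h -> closed_on P Q a c w h ->
  bint P Q a c w h =
    bint P Q a c (w / 2) (h / 2) + bint P Q (a + w / 2) c (w / 2) (h / 2)
  + bint P Q a (c + h / 2) (w / 2) (h / 2)
  + bint P Q (a + w / 2) (c + h / 2) (w / 2) (h / 2).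
Proof.
move=> w0 h0 H; have [cP cQ] := closed_on_cont w0 h0 H.
rewrite /bint.
have -> : a + w / 2 + w / 2 = a + w by field.
have -> : c + h / 2 + h / 2 = c + h by field.
have catP t : c <= t <= c + h -> sint (fun x => P x t) a (a + w) =
    sint (fun x => P x t) a (a + w / 2) + sint (fun x => P x t) (a + w / 2) (a + w).
  by move=> th; apply: sint_cat (cP _ th); lra.
have catQ x : a <= x <= a + w -> sint (Q x) c (c + h) =
    sint (Q x) c (c + h / 2) + sint (Q x) (c + h / 2) (c + h).
  by move=> th; apply: sint_cat (cQ _ th); lra.
rewrite (catP c) ?(catP (c + h)) ?(catQ a) ?(catQ (a + w));
  try (apply/andP; split; lra).
ring.
Qed.

Lemma closed_onS P Q a c w h a' c' w' h' : a <= a' -> c <= c' ->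
  a' + w' <= a + w -> c' + h' <= c + h ->
  closed_on P Q a c w h -> closed_on P Q a' c' w' h'.
Proof.
move=> aa cc ww hh H x t /andP[x1 x2] /andP[t1 t2]; apply: H; apply/andP; split; lra.
Qed.

Lemma bint_bisect P Q a c w h : 0 <= w -> 0 <= h -> closed_on P Q a c w h ->
  exists a' c', [/\ a <= a', a' + w / 2 <= a + w, c <= c', c' + h / 2 <= c + h &
    `|bint P Q a c w h| <= 4 * `|bint P Q a' c' (w / 2) (h / 2)|].
Proof.
move=> w0 h0 H; rewrite (bint_split w0 h0 H).
set b1 := bint P Q a c _ _; set b2 := bint P Q (a + w / 2) c _ _.
set b3 := bint P Q a (c + h / 2) _ _; set b4 := bint P Q _ _ _ _.
have tri : `|b1 + b2 + b3 + b4| <= `|b1| + `|b2| + `|b3| + `|b4|.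
  do 3 (apply: le_trans (ler_normD _ _) _; rewrite lerD2r).
  exact: lexx.
set B := `|b1 + b2 + b3 + b4| in tri *.
have [h1|h1] := lerP B (4 * `|b1|); first by exists a, c; split=> //; lra.
have [h2|h2] := lerP B (4 * `|b2|); first by exists (a + w / 2), c; split=> //; lra.
have [h3|h3] := lerP B (4 * `|b3|); first by exists a, (c + h / 2); split=> //; lra.
by exists (a + w / 2), (c + h / 2); split=> //; rewrite -/b4; lra.
Qed.

(** Bisection: some quarter carries at least a quarter of the boundary integral, so at stage k at
    least W / 4^k survives. The nested rectangles shrink to a point where the form is closed, and
    there the integral is at most 2 e (w + h)^2 / 4^k with e as small as desired. *)
Theorem goursat P Q a c w h : 0 <= w -> 0 <= h -> closed_on P Q a c w h ->
  bint P Q a c w h = 0.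
Proof.
move=> w0 h0 H; apply/eqP; rewrite -normr_le0 leNgt; apply/negP => W0.
pose ok (k : nat) (z : R * R) := [/\ a <= z.1, z.1 + w / 2 ^+ k <= a + w, c <= z.2,
  z.2 + h / 2 ^+ k <= c + h &
  `|bint P Q a c w h| <= 4 ^+ k * `|bint P Q z.1 z.2 (w / 2 ^+ k) (h / 2 ^+ k)|].
have wk0 k : 0 <= w / 2 ^+ k by nneg.
have hk0 k : 0 <= h / 2 ^+ k by nneg.
have half (y : R) k : y / 2 ^+ k.+1 = y / 2 ^+ k / 2 by rewrite exprSr invfM mulrA.
(* The invariant is a premise under the existential so that [choice] yields a total successor
   function. *)
have step k z : exists z', ok k z -> ok k.+1 z' /\
    [/\ z.1 <= z'.1, z'.1 + w / 2 ^+ k.+1 <= z.1 + w / 2 ^+ k,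
        z.2 <= z'.2 & z'.2 + h / 2 ^+ k.+1 <= z.2 + h / 2 ^+ k].
  have [[z1 z2 z3 z4 z5]|nz] := pselect (ok k z); last by exists z.
  have Hz : closed_on P Q z.1 z.2 (w / 2 ^+ k) (h / 2 ^+ k) by apply: closed_onS H.
  have [a' [c' [h1 h2 h3 h4 h5]]] := bint_bisect (wk0 k) (hk0 k) Hz.
  exists (a', c') => _; rewrite /ok /= !half; split; last by [].
  split; try lra.
  apply: (le_trans z5); rewrite exprSr -mulrA ler_wpM2l ?exprn_ge0 //.
have [nxt Hnxt] := choice (fun kz : nat * (R * R) => step kz.1 kz.2).
pose z := fix z k := if k is k'.+1 then nxt (k', z k') else (a, c).
have okz k : ok k (z k).
  elim: k => [|k IH]; last by have [] := Hnxt (k, z k) IH.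
  by rewrite /ok /= expr0 !divr1 mul1r.
have mono k m : (k <= m)%N -> [/\ (z k).1 <= (z m).1,
    (z m).1 + w / 2 ^+ m <= (z k).1 + w / 2 ^+ k, (z k).2 <= (z m).2 &
    (z m).2 + h / 2 ^+ m <= (z k).2 + h / 2 ^+ k].
  elim: m => [|m IH]; first by rewrite leqn0 => /eqP ->.
  rewrite leq_eqVlt => /predU1P[->//|]; rewrite ltnS => /IH [i1 i2 i3 i4].
  have [_ [j1 j2 j3 j4]] := Hnxt (m, z m) (okz m).
  by split; [apply: le_trans j1|apply: le_trans i2|apply: le_trans j3|apply: le_trans i4].
have lim (p : nat -> R) (l : nat -> R) : (forall k m, (k <= m)%N -> p k <= p m) ->
    (forall k m, (k <= m)%N -> p m + l m <= p k + l k) -> (forall k, 0 <= l k) ->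
    exists x, forall k, p k <= x <= p k + l k.
  move=> p1 p2 l0; exists (sup (range p)) => k.
  have ub m : range p (p m) by exists m.
  have up j : ubound (range p) (p j + l j).
    move=> _ [m _ <-]; have [jm|mj] := leqP j m.
      by apply: le_trans (p2 _ _ jm); rewrite lerDl.
    by apply: le_trans (p1 _ _ (ltnW mj)) _; rewrite lerDl.
  apply/andP; split; last by apply: ge_sup (up k); exists (p k).
  by apply: ub_le_sup => //; exists (p k + l k).
have [x Hx] := lim (fun k => (z k).1) (fun k => w / 2 ^+ k)
  ltac:(by move=> k m /mono []) ltac:(by move=> k m /mono []) wk0.
have [t Ht] := lim (fun k => (z k).2) (fun k => h / 2 ^+ k)
  ltac:(by move=> k m /mono []) ltac:(by move=> k m /mono []) hk0.
have := Hx 0%N; have := Ht 0%N; rewrite /= expr0 !divr1 => t0 x0.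
have [p1 [p2 [q2 [HP HQ]]]] := H x t x0 t0.
set W := `|bint P Q a c w h| in W0.
(* Makes 2 e (w + h)^2 < W; the + 1 keeps the denominator positive for a degenerate rectangle. *)
pose e := W / (4 * ((w + h) ^+ 2 + 1)).
have wh0 : 0 < (w + h) ^+ 2 + 1 by apply: ltr_wpDl => //; exact: sqr_ge0.
have e0 : 0 < e by rewrite divr_gt0 // mulr_gt0.
have [d1 d10 Hd1] := HP e e0; have [d2 d20 Hd2] := HQ e e0.
pose d := Num.min d1 d2.
have d0 : 0 < d by rewrite lt_min d10.
have [k wk hk] : exists2 k, w / 2 ^+ k < d & h / 2 ^+ k < d.
  pose k := (Num.truncn ((w + h) / d)).+1; exists k.
    rewrite ltr_pdivrMr ?exprn_gt0 // mulrC -ltr_pdivrMr //.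
    apply: le_lt_trans (_ : (w + h) / d < _).
      by rewrite ler_pM2r ?invr_gt0 // lerDl.
    apply: lt_le_trans (truncnS_gt _) _.
    by rewrite -natrX ler_nat ltnW // ltn_expl.
  rewrite ltr_pdivrMr ?exprn_gt0 // mulrC -ltr_pdivrMr //.
  apply: le_lt_trans (_ : (w + h) / d < _).
    by rewrite ler_pM2r ?invr_gt0 // lerDr.
  apply: lt_le_trans (truncnS_gt _) _.
  by rewrite -natrX ler_nat ltnW // ltn_expl.
have [y1 y2 y3 y4 y5] := okz k.
have Hz : closed_on P Q (z k).1 (z k).2 (w / 2 ^+ k) (h / 2 ^+ k) by apply: closed_onS H.
have := @bint_small P Q _ _ _ _ x t p1 p2 q2 d e (wk0 k) (hk0 k) (ltW e0) Hz (Hx k) (Ht k).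
have d1' x' : x' < d -> x' < d1 by rewrite lt_min => /andP[].
have d2' x' : x' < d -> x' < d2 by rewrite lt_min => /andP[].
move=> /(_ ltac:(by move=> ? ? /d1' ? /d1' ?; exact: Hd1)
           ltac:(by move=> ? ? /d2' ? /d2' ?; exact: Hd2) wk hk) small.
have := le_trans y5 (ler_wpM2l (exprn_ge0 k (ler0n _ 4)) small).
have -> : 4 ^+ k * (2 * e * (w / 2 ^+ k + h / 2 ^+ k) ^+ 2) = 2 * e * (w + h) ^+ 2.
  have -> : 4 ^+ k = 2 ^+ k ^+ 2 :> R by rewrite -exprM mulnC exprM; congr (_ ^+ _); ring.
  by field; rewrite expf_eq0 pnatr_eq0 andbF.
rewrite -/W leNgt => /negP; apply.
rewrite /e; have -> : 2 * (W / (4 * ((w + h) ^+ 2 + 1))) * (w + h) ^+ 2 =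
   W * ((w + h) ^+ 2 / (2 * ((w + h) ^+ 2 + 1))) by field; rewrite gt_eqF.
rewrite gtr_pMr // ltr_pdivrMr ?mulr_gt0 // mul1r.
by have := sqr_ge0 (w + h); lra.
Qed.

End Goursat.

(** * Complex exponential and logarithm *)

Section ComplexModulus.
Variable R : realType.
Local Notation C := (C R).
Implicit Types (z w : C) (f g : C -> C).

(** The norm of [C] takes its values in [C]; a modulus in [R] is needed for real estimates. *)
Definition cabs z : R := Normc.normc z.

Lemma normC_cabs z : `|z| = (cabs z)%:C%C. Proof. by []. Qed.

Lemma cabs_ge0 z : 0 <= cabs z.
Proof. by case: z => a b; exact: sqrtr_ge0. Qed.

Lemma cabs0 : cabs 0 = 0. Proof. exact: Normc.normc0. Qed.

Lemma cabs_eq0 z : (cabs z == 0) = (z == 0).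
Proof.
by apply/eqP/eqP => [/Normc.eq0_normc //|->]; exact: cabs0.
Qed.

Lemma cabs_gt0 z : (0 < cabs z) = (z != 0).
Proof. by rewrite lt_def cabs_eq0 cabs_ge0 andbT. Qed.

Lemma cabsM z w : cabs (z * w) = cabs z * cabs w. Proof. exact: Normc.normcM. Qed.

Lemma cabsD z w : cabs (z + w) <= cabs z + cabs w. Proof. exact: le_normcD. Qed.

Lemma cabsN z : cabs (- z) = cabs z. Proof. exact: normcN. Qed.

Lemma cabsB z w : cabs (z - w) <= cabs z + cabs w.
Proof. by rewrite -(cabsN w); exact: cabsD. Qed.

Lemma cabsC z w : cabs (z - w) = cabs (w - z).
Proof. by rewrite -cabsN opprB. Qed.

Lemma cabsV z : cabs z^-1 = (cabs z)^-1. Proof. exact: Normc.normcV. Qed.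

Lemma cabs1 : cabs 1 = 1. Proof. exact: Normc.normc1. Qed.

Lemma cabsX z n : cabs (z ^+ n) = cabs z ^+ n.
Proof.
elim: n => [|n IH]; first by rewrite !expr0 cabs1.
by rewrite !exprS cabsM IH.
Qed.

Lemma cabsE (a b : R) : cabs (Complex a b : C) = Num.sqrt (a ^+ 2 + b ^+ 2).
Proof. by []. Qed.

Lemma cabs_real (a : R) : cabs (a%:C%C : C) = `|a|.
Proof. by rewrite cabsE expr0n addr0 sqrtr_sqr. Qed.

Lemma ReD z w : complex.Re (z + w) = complex.Re z + complex.Re w.
Proof. by case: z w => [a b] [c d]. Qed.
Lemma ImD z w : complex.Im (z + w) = complex.Im z + complex.Im w.
Proof. by case: z w => [a b] [c d]. Qed.
Lemma ReN z : complex.Re (- z) = - complex.Re z. Proof. by case: z. Qed.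
Lemma ImN z : complex.Im (- z) = - complex.Im z. Proof. by case: z. Qed.
Lemma ReB z w : complex.Re (z - w) = complex.Re z - complex.Re w.
Proof. by rewrite ReD ReN. Qed.
Lemma ImB z w : complex.Im (z - w) = complex.Im z - complex.Im w.
Proof. by rewrite ImD ImN. Qed.
Lemma ReM z w : complex.Re (z * w) =
  complex.Re z * complex.Re w - complex.Im z * complex.Im w.
Proof. by case: z w => [a b] [c d]. Qed.
Lemma ImM z w : complex.Im (z * w) =
  complex.Re z * complex.Im w + complex.Im z * complex.Re w.
Proof. by case: z w => [a b] [c d]. Qed.

Lemma complex_ext z w : complex.Re z = complex.Re w -> complex.Im z = complex.Im w -> z = w.
Proof. by case: z w => [a b] [c d] /= -> ->. Qed.

Lemma Re_le_cabs z : `|complex.Re z| <= cabs z.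
Proof.
case: z => a b; rewrite cabsE /= -[leLHS]sqrtr_sqr.
by rewrite ler_sqrt ?lerDl ?addr_ge0 ?sqr_ge0.
Qed.

Lemma Im_le_cabs z : `|complex.Im z| <= cabs z.
Proof.
case: z => a b; rewrite cabsE /= -[leLHS]sqrtr_sqr.
by rewrite ler_sqrt ?lerDr ?addr_ge0 ?sqr_ge0.
Qed.

Lemma cabs_le_ReIm z : cabs z <= `|complex.Re z| + `|complex.Im z|.
Proof.
case: z => a b; have E : (Complex a b : C) = Complex a 0 + Complex 0 b.
  by apply: complex_ext; rewrite ?ReD ?ImD /= ?addr0 ?add0r.
rewrite {1}E; apply: le_trans (cabsD _ _) _.
by rewrite !cabsE expr0n addr0 add0r !sqrtr_sqr.
Qed.

Lemma nbhs_cabsP z (A : set C) :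
  nbhs z A <-> exists2 d : R, 0 < d & forall w, cabs (w - z) < d -> A w.
Proof.
split=> [/nbhs_ballP[e /= e0 eA]|[d d0 dA]].
  have eR : e = (complex.Re e)%:C%C by rewrite RRe_real // gtr0_real.
  exists (complex.Re e); first by move: e0; rewrite eR ltcR.
  move=> w wz; apply: eA; rewrite /ball /= eR normC_cabs ltcR.
  by rewrite cabsC.
apply/nbhs_ballP; exists (d%:C%C); first by rewrite /= ltcR.
by move=> w; rewrite /ball /= normC_cabs ltcR cabsC; exact: dA.
Qed.

(** Complex derivative with real radii; the denominator is cleared, so the case w = z need not be
    excluded. *)
Definition cderiv f z L := forall e : R, 0 < e -> exists2 d : R, 0 < d &
  forall w, cabs (w - z) < d -> cabs (f w - f z - L * (w - z)) <= e * cabs (w - z).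

Lemma derivable_cderiv f z : derivable f z 1 -> exists L, cderiv f z L.
Proof.
move=> /cvg_ex[L] H; exists L => e e0.
have e0' : (0 : C) < e%:C%C by rewrite ltcR.
move/cvgrPdist_le: H => /(_ _ e0').
move=> /nbhs_cabsP[d d0 H]; exists d => // w wd.
have [->|wz] := eqVneq w z; first by rewrite !subrr mulr0 subr0 cabs0 mulr0.
have wz0 : w - z != 0 by rewrite subr_eq0.
have := H (w - z); rewrite subr0 => /(_ wd wz0) /=.
rewrite /GRing.scale /= mulr1 subrK normC_cabs lecR => h.
have -> : f w - f z - L * (w - z) = - ((L - (w - z)^-1 * (f w - f z)) * (w - z)).
  by rewrite mulrBl mulrAC mulVf // mul1r; ring.
by rewrite cabsN cabsM ler_wpM2r ?cabs_ge0.
Qed.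

Lemma cderiv_continuous f z L : cderiv f z L ->
  forall e : R, 0 < e -> exists2 d : R, 0 < d &
    forall w, cabs (w - z) < d -> cabs (f w - f z) <= e.
Proof.
move=> H e e0; have [d d0 Hd] := H 1 ltr01.
pose M := 1 + cabs L; have M0 : 0 < M by rewrite ltr_pwDl ?cabs_ge0.
exists (Num.min d (e / M)); first by rewrite lt_min d0 divr_gt0.
move=> w; rewrite lt_min => /andP[wd we].
have -> : f w - f z = (f w - f z - L * (w - z)) + L * (w - z) by rewrite subrK.
apply: le_trans (cabsD _ _) _; rewrite cabsM.
apply: le_trans (lerD (Hd w wd) (lexx _)) _.
by rewrite -mulrDl mulrC -ler_pdivlMr // ltW.
Qed.

End ComplexModulus.

Section ComplexExp.
Variable R : realType.
Local Notation C := (C R).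
Implicit Types (z w : C) (f g : C -> C).

Lemma derive_approx (f : R -> R) x L : is_derive x (1 : R) f L ->
  forall e : R, 0 < e -> exists2 d : R, 0 < d &
  forall y, `|y - x| < d -> `|f y - f x - L * (y - x)| <= e * `|y - x|.
Proof.
move=> [df Df] e e0.
have : h^-1 *: ((f \o shift x) (h *: (1 : R)) - f x) @[h --> 0^'] --> L.
  by rewrite -Df.
move/cvgrPdist_le => /(_ _ e0) /nbhs_ballP[d /= d0 H]; exists d => // y yd.
have [->|yx] := eqVneq y x; first by rewrite !subrr mulr0 subr0 normr0 mulr0.
have yx0 : y - x != 0 by rewrite subr_eq0.
have := H (y - x); rewrite /ball /= sub0r normrN => /(_ yd yx0).
rewrite /GRing.scale /= mulr1 subrK => h.
have -> : f y - f x - L * (y - x) = - ((L - (y - x)^-1 * (f y - f x)) * (y - x)).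
  by rewrite mulrBl mulrAC mulVf // mul1r; ring.
by rewrite normrN normrM ler_wpM2r.
Qed.

Lemma approx_derive (f : R -> R) x L : (forall e : R, 0 < e ->
  exists2 d : R, 0 < d &
  forall y, `|y - x| < d -> `|f y - f x - L * (y - x)| <= e * `|y - x|) ->
  is_derive x (1 : R) f L.
Proof.
move=> H.
have cL : h^-1 *: ((f \o shift x) (h *: (1 : R)) - f x) @[h --> 0^'] --> L.
  apply/cvgrPdist_le => e e0; have [d d0 Hd] := H _ e0.
  apply/nbhs_ballP; exists d => // h; rewrite /ball /= sub0r normrN => hd h0.
  rewrite /GRing.scale /= mulr1.
  have := Hd (h + x); rewrite addrK => /(_ hd) le.
  rewrite -(ler_pM2r (_ : 0 < `|h|)) ?normr_gt0 // -normrM -[leLHS]normrN.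
  have -> // : - ((L - h^-1 * (f (h + x) - f x)) * h) = f (h + x) - f x - L * h.
  by rewrite mulrBl mulrAC mulVf // mul1r; ring.
split; first by apply/cvg_ex; exists L.
exact: cvg_lim cL.
Qed.

Definition cexp z : C :=
  Complex (expR (complex.Re z) * cos (complex.Im z))
          (expR (complex.Re z) * sin (complex.Im z)).

Lemma cexpD z w : cexp (z + w) = cexp z * cexp w.
Proof.
apply: complex_ext; rewrite ?ReM ?ImM /= ReD ImD expRD ?cosD ?sinD; ring.
Qed.

Lemma cabs_cexp z : cabs (cexp z) = expR (complex.Re z).
Proof.
by rewrite cabsE !exprMn -mulrDr cos2Dsin2 mulr1 sqrtr_sqr ger0_norm ?expR_ge0.
Qed.

Lemma cexp_neq0 z : cexp z != 0.
Proof. by rewrite -cabs_gt0 cabs_cexp expR_gt0. Qed.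

Lemma cexp0 : cexp 0 = 1.
Proof. by apply: complex_ext; rewrite /= expR0 mul1r ?cos0 ?sin0. Qed.

Lemma cexp_approx0 (e : R) : 0 < e -> exists2 d : R, 0 < d &
  forall h : C, cabs h < d -> cabs (cexp h - 1 - h) <= e * cabs h.
Proof.
(* 7 = 3 + 4: three error terms are at most [e' * |x|], and two are at most [2 * (e' * |y|)]. *)
move=> e0; pose e' := e / 7; have e'0 : 0 < e' by rewrite divr_gt0.
have [d1 d10 H1] := derive_approx (is_derive_expR (0 : R)) e'0.
have [d2 d20 H2] := derive_approx (is_derive_cos (0 : R)) e'0.
have [d3 d30 H3] := derive_approx (is_derive_sin (0 : R)) e'0.
exists (Num.min (Num.min d1 d2) (Num.min d3 (Num.min 1 e'))).
  by rewrite !lt_min d10 d20 d30 ltr01 e'0.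
move=> h; rewrite !lt_min => /andP[/andP[h1 h2] /andP[h3 /andP[h4 h5]]].
set x := complex.Re h; set y := complex.Im h.
have xh : `|x| <= cabs h by exact: Re_le_cabs.
have yh : `|y| <= cabs h by exact: Im_le_cabs.
have := H1 x; rewrite subr0 expR0 mul1r => /(_ (le_lt_trans xh h1)) E1.
have := H2 y; rewrite subr0 cos0 sin0 oppr0 mul0r subr0 => /(_ (le_lt_trans yh h2)) E2.
have := H3 y; rewrite subr0 sin0 cos0 mul1r subr0 => /(_ (le_lt_trans yh h3)) E3.
apply: le_trans (cabs_le_ReIm _) _.
rewrite !ReB !ImB /= -/x -/y subr0.
have -> : expR x * cos y - 1 - x = (expR x - 1 - x) * cos y + (1 + x) * (cos y - 1) by ring.
have -> : expR x * sin y - y = (expR x - 1 - x) * sin y + (1 + x) * (sin y - y) + x * y by ring.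
have x1 : `|1 + x| <= 2.
  by apply: le_trans (ler_normD _ _) _; rewrite normr1; have := le_lt_trans xh h4; lra.
have ye : `|y| <= e' by apply: ltW; exact: le_lt_trans yh h5.
have b1 : `|(expR x - 1 - x) * cos y| <= e' * `|x|.
  by rewrite normrM -[leRHS]mulr1 ler_pM // cos_max.
have b2 : `|(1 + x) * (cos y - 1)| <= 2 * (e' * `|y|) by rewrite normrM ler_pM.
have b3 : `|(expR x - 1 - x) * sin y| <= e' * `|x|.
  by rewrite normrM -[leRHS]mulr1 ler_pM // sin_max.
have b4 : `|(1 + x) * (sin y - y)| <= 2 * (e' * `|y|) by rewrite normrM ler_pM.
have b5 : `|x * y| <= e' * `|x| by rewrite normrM mulrC ler_pM.
apply: le_trans (lerD (ler_normD _ _) (le_trans (ler_normD _ _) (lerD (ler_normD _ _) (lexx _)))) _.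
have -> : e * cabs h = 3 * (e' * cabs h) + 4 * (e' * cabs h) by rewrite /e'; field.
have := ler_wpM2l (ltW e'0) xh; have := ler_wpM2l (ltW e'0) yh; lra.
Qed.

Lemma cexp_cderiv z : cderiv cexp z (cexp z).
Proof.
move=> e e0; have c0 : 0 < cabs (cexp z) by rewrite cabs_gt0 cexp_neq0.
have [d d0 H] := cexp_approx0 (divr_gt0 e0 c0); exists d => // w wd.
have -> : cexp w - cexp z - cexp z * (w - z) = cexp z * (cexp (w - z) - 1 - (w - z)).
  have -> : cexp w = cexp (w - z) * cexp z by rewrite -cexpD subrK.
  by ring.
rewrite cabsM; have := ler_wpM2l (ltW c0) (H _ wd).
by rewrite mulrA mulrCA divff ?gt_eqF // mulr1.
Qed.

(** The plane without the half-line of nonpositive reals; the quantity is the denominator of the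
    half-angle formula for the argument. *)
Definition slit w : Prop := 0 < cabs w + complex.Re w.

Lemma slit_cabs w : slit w -> 0 < cabs w.
Proof. by rewrite /slit; have := Re_le_cabs w; rewrite ler_norml => /andP[_]; lra. Qed.

Lemma cabs_sqr w : cabs w ^+ 2 = complex.Re w ^+ 2 + complex.Im w ^+ 2.
Proof. by case: w => a b; rewrite cabsE sqr_sqrtr // addr_ge0 ?sqr_ge0. Qed.

(** The half-angle formula tan (arg / 2) = Im w / (|w| + Re w) replaces the definition by cases
    through [acos] and makes the continuity of the argument visible. *)
Lemma carg_slit w : slit w ->
  carg w = 2 * atan (complex.Im w / (cabs w + complex.Re w)) /\
  cabs w * cos (carg w) = complex.Re w /\ cabs w * sin (carg w) = complex.Im w.
Proof.
move=> sw; have r0 := slit_cabs sw; rewrite /slit in sw.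
have r2 := cabs_sqr w.
rewrite /carg -/(cabs w).
move: sw r0 r2; set rho := cabs w; set x := complex.Re w; set y := complex.Im w => s0 r0 r2.
set u := y / (rho + x).
have su : sin (atan u) = u * cos (atan u).
  rewrite -{2}(atanK u) /tan divfK // cos_atan invr_neq0 // sqrtr_eq0 -ltNge.
  by apply: ltr_pwDl => //; exact: sqr_ge0.
have cu : cos (atan u) ^+ 2 = (rho + x) / (2 * rho).
  rewrite cos_atan exprVn sqr_sqrtr; last by apply: addr_ge0 => //; exact: sqr_ge0.
  have -> : 1 + u ^+ 2 = (2 * rho) / (rho + x).
    rewrite /u; have -> : 1 + (y / (rho + x)) ^+ 2 = ((rho + x) ^+ 2 + y ^+ 2) / (rho + x) ^+ 2.
      by field; rewrite gt_eqF.
    have -> : (rho + x) ^+ 2 + y ^+ 2 = 2 * rho * (rho + x).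
      have -> : y ^+ 2 = rho ^+ 2 - x ^+ 2 by rewrite r2; ring.
      by ring.
    by field; rewrite gt_eqF.
  by rewrite invf_div.
have c2 : cos (2 * atan u) = x / rho.
  rewrite mulr_natl cos_mulr2n cu -mulr_natl; field; rewrite gt_eqF //.
have s2 : sin (2 * atan u) = y / rho.
  rewrite mulr_natl sin_mulr2n su mulrCA -expr2 cu -mulr_natl /u; field.
  by rewrite !gt_eqF.
have aE : (if 0 <= y then acos (x / complex.Re `|w|) else - acos (x / complex.Re `|w|)) =
    2 * atan u.
  rewrite -[complex.Re `|w|]/rho -c2.
  have at1 := atan_ltpi2 u; have at2 := atan_gtNpi2 u.
  case: ifP => y0.
    have u0 : 0 <= u by rewrite divr_ge0 // ltW.
    have := le_atan u0; rewrite atan0 => a0.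
    by apply: cosK; rewrite in_itv /=; apply/andP; split; lra.
  have u0 : u <= 0 by rewrite pmulr_lle0 ?invr_gt0 //; lra.
  have := le_atan u0; rewrite atan0 => a0.
  rewrite cosKN ?opprK //; apply/andP; split; lra.
rewrite aE; split=> //; rewrite c2 s2; split; rewrite mulrC divfK // gt_eqF //.
Qed.

Lemma cexp_clog w : slit w -> cexp (clog w) = w.
Proof.
move=> sw; have [_ [h1 h2]] := carg_slit sw; have r0 := slit_cabs sw.
by apply: complex_ext; rewrite /= -/(cabs w) lnK ?posrE.
Qed.

Lemma cvg_cabsP (f : C -> R) w l : (forall e : R, 0 < e -> exists2 d : R, 0 < d &
  forall z, cabs (z - w) < d -> `|l - f z| <= e) -> f z @[z --> w] --> l.
Proof.
move=> H; apply: (@cvgrPdist_le _ _ _ _ (nbhs_filter w) f l).2 => e e0.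
by apply/nbhs_cabsP; exact: H.
Qed.

Lemma cvg_Re w : complex.Re z @[z --> w] --> complex.Re w.
Proof.
apply: cvg_cabsP => e e0; exists e => // z zd.
by rewrite -ReB; apply: le_trans (Re_le_cabs _) _; rewrite cabsC ltW.
Qed.

Lemma cvg_Im w : complex.Im z @[z --> w] --> complex.Im w.
Proof.
apply: cvg_cabsP => e e0; exists e => // z zd.
by rewrite -ImB; apply: le_trans (Im_le_cabs _) _; rewrite cabsC ltW.
Qed.

Lemma cvg_cabs w : cabs z @[z --> w] --> cabs w.
Proof.
apply: cvg_cabsP => e e0; exists e => // z zd.
apply: le_trans (ltW zd); rewrite ler_norml; apply/andP; split.
  by have := cabsD (z - w) w; rewrite subrK; lra.
by have := cabsD (w - z) z; rewrite subrK cabsC; lra.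
Qed.

Lemma slit_near w : slit w -> \forall z \near w, slit z.
Proof.
move=> sw.
have c : cabs z + complex.Re z @[z --> w] --> cabs w + complex.Re w.
  exact: (@cvgD _ _ _ _ (nbhs_filter w) _ _ _ _ (@cvg_cabs w) (@cvg_Re w)).
exact: (@cvgr_gt _ _ _ (nbhs_filter w) _ _ c _ sw).
Qed.

Lemma clog_continuous w (e : R) : slit w -> 0 < e ->
  \forall z \near w, cabs (clog z - clog w) <= e.
Proof.
move=> sw e0; have [aw _] := carg_slit sw; have r0 := slit_cabs sw.
have e2 : 0 < e / 2 by rewrite divr_gt0.
have c1 : 2 * atan (complex.Im z / (cabs z + complex.Re z)) @[z --> w] --> carg w.
  have cD := @cvgD _ _ _ _ (nbhs_filter w) _ _ _ _ (@cvg_cabs w) (@cvg_Re w).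
  have cV := @cvgV _ _ _ (nbhs_filter w) _ _ (lt0r_neq0 sw) cD.
  have cM := @cvgM _ _ _ (nbhs_filter w) _ _ _ _ (@cvg_Im w) cV.
  have cA := cvg_comp _ (@atan R) cM (@continuous_atan R _).
  rewrite aw.
  exact: (@cvgM _ _ _ (nbhs_filter w) _ _ _ _ (cvg_cst (2 : R)) cA).
have c2 : ln (cabs z) @[z --> w] --> ln (cabs w).
  by apply: (cvg_comp _ (@ln R) (@cvg_cabs w)); exact: continuous_ln.
move/cvgrPdist_le: c1 => /(_ _ e2) n1; move/cvgrPdist_le: c2 => /(_ _ e2) n2.
near=> z; have sz : slit z by near: z; exact: slit_near.
apply: le_trans (cabs_le_ReIm _) _; rewrite ReB ImB /= -/(cabs w) -/(cabs z).
have [-> _] := carg_slit sz; rewrite distrC [X in _ + X]distrC.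
have -> : e = e / 2 + e / 2 by field.
by apply: lerD; near: z.
Unshelve. all: by end_near.
Qed.

(** Derivative of an inverse function: continuity of [l] brings its increment D into the range where
    exp is almost linear. This first yields |D| <= K |t - z|, and then the derivative itself. *)
Lemma cderiv_local_log (m l : C -> C) z M : cderiv m z M -> m z != 0 ->
  (\forall t \near z, cexp (l t) = m t) ->
  (forall e : R, 0 < e -> \forall t \near z, cabs (l t - l z) <= e) ->
  cderiv l z (M / m z).
Proof.
move=> Hm m0 Hl cl e e0.
have a0 : 0 < cabs (m z) by rewrite cabs_gt0.
have lz : cexp (l z) = m z by exact: nbhs_singleton Hl.
set a := cabs (m z) in a0.
pose K := (cabs M + 1) * 2 / a.
have K0 : 0 < K.
  by rewrite divr_gt0 // mulr_gt0 // ltr_wpDl // cabs_ge0.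
(* The first bound lets half of |m z| |D| absorb the error and so gives [K]; the second makes the
   error at most (e / 2) |m z| |t - z|. *)
pose e1 := Num.min (a / 2) (e * a / (2 * K)).
have e10 : 0 < e1 by rewrite lt_min; apply/andP; split; pos.
have e20 : 0 < e * a / 2 by rewrite divr_gt0 // mulr_gt0.
have [d1 d10 H1] := cexp_cderiv (l z) e10.
have [d2 d20 H2] := Hm _ e20.
have [d3 d30 H3] := Hm _ ltr01.
have [d4 d40 H4] := (nbhs_cabsP _ _).1 Hl.
have d12 : 0 < d1 / 2 by rewrite divr_gt0.
have [d5 d50 H5] := (nbhs_cabsP _ _).1 (cl _ d12).
exists (Num.min (Num.min d2 d3) (Num.min d4 d5)); first by rewrite !lt_min d20 d30 d40.
move=> t; rewrite !lt_min => /andP[/andP[t2 t3] /andP[t4 t5]].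
have lt1 : cabs (l t - l z) < d1 by have := H5 t t5; lra.
have E1 := H1 _ lt1; rewrite (H4 t t4) lz in E1.
set D := l t - l z in lt1 E1 *.
set W := m t - m z in E1.
have E2 := H2 t t2; have E3 := H3 t t3; rewrite -/W mul1r in E2 E3.
have Wt : cabs W <= (cabs M + 1) * cabs (t - z).
  have -> : W = (W - M * (t - z)) + M * (t - z) by rewrite subrK.
  by apply: le_trans (cabsD _ _) _; rewrite cabsM; lra.
have Dt : cabs D <= K * cabs (t - z).
  have h1 : a * cabs D <= cabs W + e1 * cabs D.
    rewrite -cabsM; have -> : m z * D = W - (W - m z * D) by ring.
    by apply: le_trans (cabsB _ _) _; rewrite lerD2l.
  have h2 : e1 * cabs D <= a / 2 * cabs D.
    by rewrite ler_wpM2r ?cabs_ge0 // /e1 ge_min lexx.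
  have h3 : a / 2 * cabs D <= (cabs M + 1) * cabs (t - z) by lra.
  have -> : K * cabs (t - z) = 2 * ((cabs M + 1) * cabs (t - z)) / a by rewrite /K; ring.
  by rewrite ler_pdivlMr // mulrC; lra.
have -> : D - M / m z * (t - z) = ((W - M * (t - z)) - (W - m z * D)) / m z.
  by field; exact: m0.
rewrite cabsM cabsV -/a ler_pdivrMr //.
apply: le_trans (cabsB _ _) _.
apply: le_trans (lerD E2 E1) _.
have h4 : e1 * cabs D <= e * a / (2 * K) * (K * cabs (t - z)).
  apply: ler_pM => //; [exact: ltW|exact: cabs_ge0|].
  by rewrite /e1 ge_min lexx orbT.
have h5 : e * a / (2 * K) * (K * cabs (t - z)) = e * a / 2 * cabs (t - z).
  by field; rewrite gt_eqF.
lra.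
Qed.

End ComplexExp.

(** * Taylor expansions at 0, in particular that of log (1 / (1 - t / r)) *)

Section TaylorAtZero.
Variable R : realType.
Local Notation C := (C R).
Implicit Types (z w t : C) (f g : C -> C).

Lemma cexpN z : cexp (- z) = (cexp z)^-1.
Proof.
apply: (mulfI (cexp_neq0 z)); rewrite -cexpD subrr cexp0 divff //.
exact: cexp_neq0.
Qed.

Lemma cabs_real_ge0 (a : R) : 0 <= a -> cabs (a%:C%C : C) = a.
Proof. by move=> a0; rewrite cabs_real ger0_norm. Qed.

Lemma realC_neq0 (a : R) : 0 < a -> (a%:C%C : C) != 0.
Proof. by move=> a0; rewrite -cabs_gt0 cabs_real_ge0 // ltW. Qed.

Lemma slitV w : slit w -> slit w^-1.
Proof.
move=> sw; have w0 := slit_cabs sw; rewrite /slit cabsV.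
have -> : complex.Re w^-1 = complex.Re w / cabs w ^+ 2.
  by rewrite cabs_sqr; case: w {sw w0} => a b.
have -> : (cabs w)^-1 + complex.Re w / cabs w ^+ 2 = (cabs w + complex.Re w) / cabs w ^+ 2.
  by field; rewrite gt_eqF.
by rewrite divr_gt0 // exprn_gt0.
Qed.

Lemma subVC z w : z != 0 -> w != 0 -> 1 / z - 1 / w = (w - z) / (z * w).
Proof. by move=> z0 w0; field; apply/andP. Qed.

Lemma ReMreal z (a : R) : complex.Re z * a = complex.Re (z * a%:C%C).
Proof. by rewrite ReM /= mulr0 subr0. Qed.

Lemma ReMrealX (k z : C) (s : R) i :
  complex.Re (k * z ^+ i.+1) * s ^+ i = complex.Re (k * (z * (s%:C%C * z) ^+ i)).
Proof.
rewrite ReMreal; congr complex.Re; rewrite (rmorphXn (real_complex R)) exprMn exprS /=.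
by rewrite -!mulrA [z ^+ i * _]mulrC.
Qed.

Lemma geo_rest (k t a w x : C) :
  k * (a^-1 / w * t) - k * (t / a * ((1 - x) / w)) = k * (t / a * x / w).
Proof. by ring. Qed.

Lemma cabs_geo_rest (k z c w : C) n : cabs k = 1 ->
  cabs (k * (z * (c * z) ^+ n / w)) = cabs z * (cabs c * cabs z) ^+ n / cabs w.
Proof. by move=> k1; rewrite !cabsM k1 mul1r cabsV cabsX cabsM. Qed.

Lemma Re_sum (I : Type) (s : seq I) (P : pred I) (F : I -> C) :
  complex.Re (\sum_(i <- s | P i) F i) = \sum_(i <- s | P i) complex.Re (F i).
Proof. by apply: (big_morph (@complex.Re R)) => [z w|//]; exact: ReD. Qed.

Variable r : R.
Hypothesis r0 : 0 < r.

Definition slog t : C := clog (1 / (1 - t / r%:C%C)).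

Let rC0 : (r%:C%C : C) != 0. Proof. exact: realC_neq0. Qed.

Lemma cderivN f z L : cderiv f z L -> cderiv (fun t => - f t) z (- L).
Proof.
move=> H e e0; have [d d0 Hd] := H e e0; exists d => // w wd.
have -> : - f w - - f z - - L * (w - z) = - (f w - f z - L * (w - z)) by ring.
by rewrite cabsN; exact: Hd.
Qed.

(** Minus [slog] is a continuous logarithm of 1 - t / r, so [cderiv_local_log] applies; the sign is
    restored at the end. *)
Lemma slog_cderiv t : slit (1 - t / r%:C%C) ->
  cderiv slog t (r%:C%C^-1 / (1 - t / r%:C%C)).
Proof.
move=> st; pose m (s : C) : C := 1 - s / r%:C%C.
have m_near (e : R) : 0 < e -> \forall s \near t, cabs (m s - m t) < e.
  move=> e0; apply/nbhs_cabsP; exists (e * r); first by rewrite mulr_gt0.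
  move=> s st'; have -> : m s - m t = (t - s) / r%:C%C by rewrite /m; ring.
  by rewrite cabsM cabsV cabs_real_ge0 1?ltW // ltr_pdivrMr // cabsC.
have slit_m : \forall s \near t, slit (m s).
  have [d d0 Hd] := (nbhs_cabsP _ _).1 (slit_near st).
  have [d' d'0 Hd'] := (nbhs_cabsP _ _).1 (m_near _ d0).
  by apply/nbhs_cabsP; exists d' => // s sd; exact/Hd/Hd'.
have Hm : cderiv m t (- r%:C%C^-1).
  move=> e e0; exists 1 => // w _.
  have -> : m w - m t - - r%:C%C^-1 * (w - t) = 0 by rewrite /m; ring.
  by rewrite cabs0 mulr_ge0 ?cabs_ge0 // ltW.
have m0 : m t != 0 by rewrite -cabs_gt0; exact: slit_cabs.
have := @cderiv_local_log R m (fun s => - slog s) t _ Hm m0.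
have -> : - r%:C%C^-1 / m t = - (r%:C%C^-1 / m t) by rewrite mulNr.
move=> H; have {}H : cderiv (fun s => - slog s) t (- (r%:C%C^-1 / m t)).
  apply: H.
    have [d d0 Hd] := (nbhs_cabsP _ _).1 slit_m.
    apply/nbhs_cabsP; exists d => // s sd.
    have ss := Hd s sd.
    by rewrite cexpN /slog cexp_clog ?div1r ?invrK //; exact: slitV.
  move=> e e0; have sV : slit (1 / m t) by rewrite div1r; exact: slitV.
  have [d d0 Hd] := (nbhs_cabsP _ _).1 (clog_continuous sV e0).
  have at0 : 0 < cabs (m t) by rewrite cabs_gt0.
  pose d1 := Num.min (cabs (m t) / 2) (d * cabs (m t) ^+ 2 / 2).
  have d10 : 0 < d1 by rewrite lt_min; apply/andP; split; pos.
  have [d2 d20 Hd2] := (nbhs_cabsP _ _).1 (m_near _ d10).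
  have [d3 d30 Hd3] := (nbhs_cabsP _ _).1 slit_m.
  apply/nbhs_cabsP; exists (Num.min d2 d3); first by rewrite lt_min d20.
  move=> s; rewrite lt_min => /andP[s2 s3].
  have -> : - slog s - - slog t = - (slog s - slog t) by ring.
  rewrite cabsN; apply: Hd.
  have := Hd2 s s2; rewrite lt_min => /andP[e1 e2].
  have as0 : cabs (m t) / 2 <= cabs (m s).
    have := cabsB (m s) (m s - m t); rewrite opprB addrC subrK; lra.
  have ms0 : m s != 0 by rewrite -cabs_gt0; lra.
  rewrite -/(m s) (subVC ms0 m0).
  rewrite cabsM cabsV cabsM cabsC ltr_pdivrMr; last by rewrite mulr_gt0 //; lra.
  apply: lt_le_trans e2 _; rewrite expr2 -!mulrA ler_pM2l //.
  by rewrite mulrCA [leLHS]mulrC ler_pM2r //; lra.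
have := cderivN H; rewrite opprK => H' e e0.
have [d d0 Hd] := H' e e0; exists d => // w wd.
by have := Hd w wd; rewrite !opprK.
Qed.

Lemma slog0 : slog 0 = 0.
Proof.
rewrite /slog mul0r subr0 divr1 /clog; apply: complex_ext => /=.
  by rewrite expr1n expr0n addr0 sqrtr1 ln1.
have s1 : slit (1 : C) by rewrite /slit cabs1 /= -mulr2n ltr0n.
by have [-> _] := carg_slit s1; rewrite /= mul0r atan0 mulr0.
Qed.

Lemma cderiv_path f t (s : R) L (k : C) : cderiv f (s%:C%C * t) L ->
  is_derive s (1 : R) (fun s => complex.Re (k * f (s%:C%C * t))) (complex.Re (k * (L * t))).
Proof.
move=> H; apply: approx_derive => e e0.
pose M := cabs k * cabs t + 1.
have M0 : 0 < M by rewrite ltr_wpDl // mulr_ge0 ?cabs_ge0.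
have [d d0 Hd] := H _ (divr_gt0 e0 M0).
exists (d / (cabs t + 1)); first by rewrite divr_gt0 // ltr_wpDl // cabs_ge0.
move=> y yd.
have E : y%:C%C * t - s%:C%C * t = (y - s)%:C%C * t by rewrite rmorphB mulrBl.
have cE : cabs ((y - s)%:C%C * t) = `|y - s| * cabs t by rewrite cabsM cabs_real.
have := Hd (y%:C%C * t); rewrite E cE => h.
have {}h := h ltac:(
  move: yd; rewrite ltr_pdivlMr ?ltr_wpDl ?cabs_ge0 //; apply: le_lt_trans;
  rewrite ler_wpM2l // lerDl //).
have -> : complex.Re (k * f (y%:C%C * t)) - complex.Re (k * f (s%:C%C * t)) -
    complex.Re (k * (L * t)) * (y - s) =
    complex.Re (k * (f (y%:C%C * t) - f (s%:C%C * t) - L * ((y - s)%:C%C * t))).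
  have -> : complex.Re (k * (L * t)) * (y - s) = complex.Re (k * (L * t) * (y - s)%:C%C).
    exact: ReMreal.
  by rewrite -!ReB; congr complex.Re; ring.
apply: le_trans (Re_le_cabs _) _; rewrite cabsM.
apply: le_trans (ler_wpM2l (cabs_ge0 k) h) _.
have -> : cabs k * (e / M * (`|y - s| * cabs t)) = e * `|y - s| * (cabs k * cabs t / M) by ring.
apply: ler_piMr; first by rewrite mulr_ge0 // ltW.
by rewrite ler_pdivrMr // mul1r lerDl.
Qed.

(** Real mean value theorem along s t for 0 <= s <= 1, the unit [k] selecting a real component. With
    z = t / r the remainder has derivative k z (s z)^n / (1 - s z), where |1 - s z| >= 1/2. The
    summand j = 0 is 1 / 0 = 0. *)
Lemma slog_taylor_part n t (k : C) : cabs k = 1 -> cabs t <= r / 2 ->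
  `|complex.Re (k * (slog t - \sum_(j < n.+1) (t / r%:C%C) ^+ j / j%:R))|
    <= 2 * (cabs t / r) ^+ n.+1.
Proof.
move=> k1 tr; set z := t / r%:C%C.
have zE : cabs z = cabs t / r by rewrite cabsM cabsV cabs_real_ge0 // ltW.
have z2 : cabs z <= 2^-1 by rewrite zE ler_pdivrMr // mulrC.
pose p := \poly_(j < n.+1) complex.Re (k * (z ^+ j / j%:R)).
pose psi (s : R) := complex.Re (k * slog (s%:C%C * t)) - p.[s].
pose dpsi (s : R) := complex.Re (k * (z * (s%:C%C * z) ^+ n / (1 - s%:C%C * z))).
have big (s : R) : 0 <= s <= 1 -> 2^-1 <= complex.Re (1 - s%:C%C * z).
  move=> /andP[s0 s1]; rewrite ReB ReM /= mul0r subr0.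
  have := Re_le_cabs z; rewrite ler_norml => /andP[_ h].
  have : s * complex.Re z <= cabs z.
    apply: le_trans (ler_wpM2l s0 h) _.
    by rewrite ler_piMl ?cabs_ge0.
  lra.
have zs (s : R) : s%:C%C * t / r%:C%C = s%:C%C * z by rewrite /z mulrA.
have dpsiE (s : R) : 0 <= s <= 1 -> is_derive s (1 : R) psi (dpsi s).
  move=> s01; have b := big s s01.
  have sl : slit (1 - s%:C%C * t / r%:C%C).
    by rewrite zs /slit; have := cabs_ge0 (1 - s%:C%C * z); lra.
  have n0 : 1 - s%:C%C * z != 0.
    by apply: contraTneq b => ->; rewrite /= -ltNge invr_gt0.
  have D1 := cderiv_path k (slog_cderiv sl).
  have D2 := is_derive_poly p s.
  have D := is_deriveB D1 D2; apply: is_derive_eq D _.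
  have -> : p^`() = \poly_(j < n) complex.Re (k * z ^+ j.+1).
    apply/polyP => j; rewrite coef_deriv !coef_poly ltnS.
    case: ltnP => // _; last by rewrite mul0rn.
    rewrite -[LHS]mulr_natr ReMreal; congr complex.Re.
    have j0 : (j.+1%:R : C) != 0 by rewrite pnatr_eq0.
    by rewrite rmorph_nat -mulrA divfK.
  rewrite horner_poly.
  have -> : \sum_(i < n) complex.Re (k * z ^+ i.+1) * s ^+ i =
     complex.Re (k * (z * \sum_(i < n) (s%:C%C * z) ^+ i)).
    rewrite !mulr_sumr Re_sum; apply: eq_bigr => i _.
    exact: ReMrealX.
  rewrite -ReB /dpsi; congr complex.Re.
  have geo : \sum_(i < n) (s%:C%C * z) ^+ i = (1 - (s%:C%C * z) ^+ n) / (1 - s%:C%C * z).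
    apply: (mulfI n0); rewrite mulrC [RHS]mulrC divfK //.
    by apply: oppr_inj; rewrite opprB subrX1 -mulrN opprB mulrC.
  by rewrite geo zs; exact: geo_rest.
have cpsi : {within `[0, 1], continuous psi}.
  apply: derivable_within_continuous => x; rewrite in_itv /= => x01.
  by case: (dpsiE x x01).
have dpsi' (x : R) : x \in `]0, 1[%R -> is_derive x (1 : R) psi (dpsi x).
  by rewrite in_itv /= => /andP[x0 x1]; apply: dpsiE; rewrite !ltW.
have [c c01 E] := MVT_segment (ler01 : 0 <= 1 :> R) dpsi' cpsi.
rewrite in_itv /= in c01.
have psi0 : psi 0 = 0.
  rewrite /psi mul0r slog0 mulr0 horner_coef0 coef_poly /=.
  by rewrite invr0 !mulr0 subrr.
have psi1 : psi 1 = complex.Re (k * (slog t - \sum_(j < n.+1) z ^+ j / j%:R)).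
  rewrite /psi mul1r horner_poly mulrBr ReB mulr_sumr Re_sum.
  by congr (_ - _); apply: eq_bigr => i _; rewrite expr1n mulr1.
rewrite -psi1 -[psi 1]subr0 -psi0 E subr0 mulr1 /dpsi.
apply: le_trans (Re_le_cabs _) _.
have b := big c c01.
have b' : 2^-1 <= cabs (1 - c%:C%C * z).
  by apply: le_trans b (le_trans (ler_norm _) (Re_le_cabs _)).
rewrite cabs_geo_rest // -zE ler_pdivrMr; last by apply: lt_le_trans b'; rewrite invr_gt0.
have cz : cabs c%:C%C * cabs z <= cabs z.
  case/andP: c01 => c0 c1.
  by rewrite cabs_real_ge0 // ler_piMl ?cabs_ge0.
rewrite mulrAC exprS mulrCA.
apply: le_trans (_ : cabs z * cabs z ^+ n <= _).
  apply: ler_wpM2l; first exact: cabs_ge0.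
  apply: lerXn2r => //; rewrite nnegrE ?cabs_ge0 // mulr_ge0 ?cabs_ge0 //.
have X0 : 0 <= cabs z * cabs z ^+ n by rewrite mulr_ge0 ?exprn_ge0 ?cabs_ge0.
have b2 : 1 <= 2 * cabs (1 - c%:C%C * z) by lra.
have := ler_wpM2l X0 b2; rewrite mulr1; lra.
Qed.

Lemma slog_taylor n t : cabs t <= r / 2 ->
  cabs (slog t - \sum_(j < n.+1) (t / r%:C%C) ^+ j / j%:R) <= 4 * (cabs t / r) ^+ n.+1.
Proof.
move=> tr; apply: le_trans (cabs_le_ReIm _) _.
have := @slog_taylor_part n t 1 (cabs1 R) tr.
(* Multiplication by -i turns the imaginary part into a real part. *)
have kI : cabs (Complex 0 (-1) : C) = 1.
  by rewrite cabsE expr0n add0r sqrrN expr1n sqrtr1.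
have := slog_taylor_part n kI tr; rewrite ReM /= mul0r sub0r mulN1r opprK mul1r.
by move=> h1 h2; lra.
Qed.

(** Convergence at the real point d/2 bounds the terms there, so for |t| <= d/4 the tail is
    geometric of ratio at most 1/2. *)
Lemma has_expansion_taylor (a : nat -> C) g n : has_expansion_at0 a g ->
  exists d M : R, [/\ 0 < d, 0 <= M & forall t, cabs t <= d ->
    cabs (g t - \sum_(j < n.+1) a j * t ^+ j) <= M * cabs t ^+ n.+1].
Proof.
move=> /nbhs_cabsP[d d0 Hd].
have part t : cabs t < d -> forall e : R, 0 < e -> exists N, forall m, (N <= m)%N ->
    cabs (g t - \sum_(j < m) a j * t ^+ j) <= e.
  move=> td e e0; have := Hd t; rewrite subr0 => /(_ td).
  have e0' : (0 : C) < e%:C%C by rewrite ltcR.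
  move/cvgrPdist_le => /(_ _ e0') [N _ HN]; exists N => m Nm.
  have := HN m Nm; rewrite /= normC_cabs lecR.
  by rewrite /series /= big_mkord.
pose t0 : R := d / 2; have t00 : 0 < t0 by rewrite divr_gt0.
have ct0 : cabs (t0%:C%C : C) = t0 by rewrite cabs_real_ge0 // ltW.
have [B B0 HB] : exists2 B, 0 <= B & forall j, cabs (a j) * t0 ^+ j <= B.
  have [|N HN] := part t0%:C%C _ 1 ltr01; first by rewrite ct0 /t0; lra.
  pose S := \sum_(j < N) cabs (a j) * t0 ^+ j.
  have S0 : 0 <= S by apply: sumr_ge0 => j _; rewrite mulr_ge0 ?cabs_ge0 ?exprn_ge0 // ltW.
  exists (2 + S) => [|j]; first by rewrite addr_ge0.
  have [Nj|jN] := leqP N j.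
    have h1 := HN j Nj; have h2 := HN j.+1 (leqW Nj).
    rewrite big_ord_recr /= in h2.
    have -> : cabs (a j) * t0 ^+ j = cabs (a j * t0%:C%C ^+ j) by rewrite cabsM cabsX ct0.
    set u := g _ in h1 h2; set v := \sum_(i < j) _ in h1 h2.
    have -> : a j * t0%:C%C ^+ j = (u - v) - (u - (v + a j * t0%:C%C ^+ j)) by ring.
    apply: le_trans (cabsB _ _) _; lra.
  rewrite /S (bigD1 (Ordinal jN)) //= addrCA lerDl addr_ge0 // sumr_ge0 // => i _.
  by rewrite mulr_ge0 ?cabs_ge0 ?exprn_ge0 // ltW.
exists (t0 / 2), (2 * B / t0 ^+ n.+1); split; first by rewrite divr_gt0.
  by rewrite divr_ge0 ?mulr_ge0 ?exprn_ge0 // ltW.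
move=> t tt; have td : cabs t < d by rewrite /t0 in tt; lra.
pose q := cabs t / t0.
have q0 : 0 <= q by rewrite divr_ge0 ?cabs_ge0 // ltW.
have q2 : q <= 2^-1 by rewrite /q ler_pdivrMr // mulrC.
have -> : 2 * B / t0 ^+ n.+1 * cabs t ^+ n.+1 = 2 * B * q ^+ n.+1.
  by rewrite /q (expr_div_n (cabs t)) -[LHS]mulrA [_^-1 * _]mulrC.
have tailB m : (n < m)%N ->
    cabs (\sum_(j < m) a j * t ^+ j - \sum_(j < n.+1) a j * t ^+ j) <= 2 * B * q ^+ n.+1.
  move=> nm; have [k ->] : exists k, m = (n.+1 + k)%N by exists (m - n.+1)%N; rewrite subnKC.
  (* Subtracting q^(n+1+k) strengthens the claim enough for induction on k, since 2 q <= 1. *)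
  have claim : cabs (\sum_(j < n.+1 + k) a j * t ^+ j - \sum_(j < n.+1) a j * t ^+ j)
      <= 2 * B * (q ^+ n.+1 - q ^+ (n.+1 + k)).
    elim: k => [|k IH]; first by rewrite addn0 !subrr cabs0 mulr0.
    rewrite addnS big_ord_recr /= addrAC; apply: le_trans (cabsD _ _) _.
    have aB : cabs (a (n.+1 + k)%N * t ^+ (n.+1 + k)) <= B * q ^+ (n.+1 + k).
      rewrite cabsM cabsX /q (expr_div_n (cabs t)) mulrA ler_pdivlMr ?exprn_gt0 //.
      by rewrite mulrAC ler_wpM2r ?exprn_ge0 ?cabs_ge0.
    apply: le_trans (lerD IH aB) _.
    have qk : 2 * q ^+ (n.+1 + k).+1 <= q ^+ (n.+1 + k).
      by rewrite exprS mulrA ler_piMl ?exprn_ge0 //; lra.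
    have := ler_wpM2l B0 qk; lra.
  apply: le_trans claim _.
  by rewrite ler_wpM2l ?mulr_ge0 // gerBl exprn_ge0.
apply/ler_addgt0Pr => e e0; have [N HN] := part t td e e0.
have h1 := HN _ (leq_maxl N n.+1); have h2 := tailB _ (leq_maxr N n.+1).
rewrite -(subrK (\sum_(j < maxn N n.+1) a j * t ^+ j) (g t)) -addrA.
apply: le_trans (cabsD _ _) _; lra.
Qed.

End TaylorAtZero.

Section ComplexDerivative.
Variable R : realType.
Local Notation C := (C R).
Implicit Types (z w v : C) (f g F : C -> C).

Lemma cderivD f g z L M : cderiv f z L -> cderiv g z M ->
  cderiv (fun w => f w + g w) z (L + M).
Proof.
move=> Hf Hg e e0; have e20 : 0 < e / 2 by rewrite divr_gt0.
have [d1 d10 H1] := Hf _ e20; have [d2 d20 H2] := Hg _ e20.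
exists (Num.min d1 d2) => [|w]; first by rewrite lt_min d10.
rewrite lt_min => /andP[w1 w2].
have -> : f w + g w - (f z + g z) - (L + M) * (w - z) =
  (f w - f z - L * (w - z)) + (g w - g z - M * (w - z)) by ring.
by apply: le_trans (cabsD _ _) _; have := H1 w w1; have := H2 w w2; lra.
Qed.

Lemma cderiv_comp f g z L M : cderiv g z M -> cderiv f (g z) L ->
  cderiv (fun w => f (g w)) z (L * M).
Proof.
move=> Hg Hf e e0.
have aL := cabs_ge0 L; have aM := cabs_ge0 M.
have k0 : 0 < cabs M + 1 by lra.
have l0 : 0 < cabs L + 1 by lra.
have e1 : 0 < e / (2 * (cabs M + 1)) by rewrite divr_gt0 // mulr_gt0.
have e2 : 0 < e / (2 * (cabs L + 1)) by rewrite divr_gt0 // mulr_gt0.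
have [d1 d10 H1] := Hf _ e1; have [d2 d20 H2] := Hg _ e2; have [d3 d30 H3] := Hg _ ltr01.
exists (Num.min (d1 / (cabs M + 1)) (Num.min d2 d3)).
  by rewrite !lt_min divr_gt0 // d20.
move=> w; rewrite !lt_min => /and3P[w1 w2 w3].
have gw : cabs (g w - g z) <= (cabs M + 1) * cabs (w - z).
  have -> : g w - g z = (g w - g z - M * (w - z)) + M * (w - z) by ring.
  apply: le_trans (cabsD _ _) _; rewrite cabsM; have := H3 w w3; lra.
have gd : cabs (g w - g z) < d1.
  by apply: le_lt_trans gw _; rewrite mulrC -ltr_pdivlMr.
have -> : f (g w) - f (g z) - L * M * (w - z) =
  (f (g w) - f (g z) - L * (g w - g z)) + L * (g w - g z - M * (w - z)) by ring.
apply: le_trans (cabsD _ _) _; rewrite cabsM.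
have a1 : cabs (f (g w) - f (g z) - L * (g w - g z)) <= e / 2 * cabs (w - z).
  apply: le_trans (H1 _ gd) _; apply: le_trans (ler_wpM2l (ltW e1) gw) _.
  by rewrite mulrA invfM mulrA divfK // gt_eqF.
have a2 : cabs L * cabs (g w - g z - M * (w - z)) <= e / 2 * cabs (w - z).
  apply: le_trans (_ : (cabs L + 1) * (e / (2 * (cabs L + 1)) * cabs (w - z)) <= _).
    by apply: ler_pM; rewrite ?cabs_ge0 ?H2 // lerDl.
  by rewrite mulrA [_ * (e / _)]mulrC invfM mulrA divfK // gt_eqF.
lra.
Qed.

Lemma cderivZ a z : cderiv (fun v => a * v) z a.
Proof.
move=> e e0; exists 1 => // w _; have -> : a * w - a * z - a * (w - z) = 0 by ring.
by rewrite cabs0 mulr_ge0 ?cabs_ge0 // ltW.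
Qed.

Lemma cderiv_cst a z : cderiv (fun=> a) z 0.
Proof.
move=> e e0; exists 1 => // w _.
by rewrite subrr mul0r subr0 cabs0 mulr_ge0 ?cabs_ge0 // ltW.
Qed.

Lemma cderivM f g z L M : cderiv f z L -> cderiv g z M ->
  cderiv (fun w => f w * g w) z (L * g z + f z * M).
Proof.
move=> Hf Hg e e0.
have aL := cabs_ge0 L; have af := cabs_ge0 (f z); have ag := cabs_ge0 (g z).
pose k := 3 * (cabs L + cabs (f z) + cabs (g z) + 1).
have k0 : 0 < k by rewrite /k; lra.
have e1 : 0 < e / k by rewrite divr_gt0.
have [d1 d10 H1] := Hf _ e1; have [d2 d20 H2] := Hg _ e1.
have [d3 d30 H3] := Hf _ ltr01; have [d4 d40 H4] := cderiv_continuous Hg e1.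
exists (Num.min (Num.min d1 d2) (Num.min d3 d4)); first by rewrite !lt_min d10 d20 d30.
move=> w; rewrite !lt_min => /andP[/andP[w1 w2] /andP[w3 w4]].
set D := cabs (w - z); have D0 : 0 <= D := cabs_ge0 _.
have fw : cabs (f w - f z) <= (cabs L + 1) * D.
  have -> : f w - f z = (f w - f z - L * (w - z)) + L * (w - z) by ring.
  apply: le_trans (cabsD _ _) _; rewrite cabsM -/D; have := H3 w w3; rewrite -/D; lra.
have -> : f w * g w - f z * g z - (L * g z + f z * M) * (w - z) =
  (f w - f z - L * (w - z)) * g z + f z * (g w - g z - M * (w - z))
  + (f w - f z) * (g w - g z) by ring.
apply: le_trans (cabsD _ _) _; apply: le_trans (lerD (cabsD _ _) (lexx _)) _.
rewrite !cabsM.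
have a1 := ler_wpM2r ag (H1 w w1); have a2 := ler_wpM2l af (H2 w w2).
have a3 := ler_pM (cabs_ge0 _) (cabs_ge0 _) fw (H4 w w4).
rewrite -/D in a1 a2.
have -> : e * D = e / k * D * (3 * (cabs L + cabs (f z) + cabs (g z) + 1)).
  by rewrite -/k [RHS]mulrAC divfK // gt_eqF.
have X0 : 0 <= e / k * D by rewrite mulr_ge0 // ltW.
have := mulr_ge0 X0 aL; have := mulr_ge0 X0 af; have := mulr_ge0 X0 ag.
by move: (e / k) a1 a2 a3 X0 => y; lra.
Qed.

End ComplexDerivative.

(** * Contour integrals in logarithmic coordinates *)

Section Contour.
Variables (R : realType) (c : R).
Hypothesis c0 : 0 < c.
Local Notation C := (C R).
Implicit Types (z w v q k : C) (F G H : C -> C).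

Definition qup : C := Complex c 1.
Definition qdown : C := Complex c (-1).
Definition pt q (x t : R) : C := x%:C%C + t%:C%C * q.
(** The form Im (F dv) on the upper segment minus the same on the lower one: its dx component for k1
    = k2 = 1, its dt component for [qup] and [qdown]. The difference makes one closed form on a
    rectangle out of both segments. *)
Definition im_form k1 k2 F (x t : R) : R :=
  complex.Im (k1 * F (pt qup x t)) - complex.Im (k2 * F (pt qdown x t)).

(* The imaginary part of the integral of F v dv along the path that goes from
   x + pi * qdown to x and from there to x + pi * qup; the endpoints differ by
   2 pi i, the period of F. *)
Definition contour F (x : R) : R := sint (im_form qup qdown F x) 0 pi.

Definition good F (x t : R) : Prop :=
  (exists L, cderiv F (pt qup x t) L) /\ (exists L, cderiv F (pt qdown x t) L).

Lemma Im_lin_approx F k q x t L : cderiv F (pt q x t) L ->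
  lin_approx (fun x t => complex.Im (k * F (pt q x t))) x t
    (complex.Im (k * L)) (complex.Im (k * (q * L))).
Proof.
move=> HF e e0; have aq := cabs_ge0 q; have ak := cabs_ge0 k.
have m0 : 0 < (cabs k + 1) * (1 + cabs q) by rewrite mulr_gt0; lra.
have [d d0 Hd] := HF _ (divr_gt0 e0 m0).
exists (d / (2 * (1 + cabs q))); first by rewrite divr_gt0 // mulr_gt0; lra.
move=> x' t' xd td.
have E : pt q x' t' - pt q x t = (x' - x)%:C%C + (t' - t)%:C%C * q.
  by rewrite /pt !rmorphB /=; ring.
have bE : cabs (pt q x' t' - pt q x t) <= (1 + cabs q) * (`|x' - x| + `|t' - t|).
  rewrite E; apply: le_trans (cabsD _ _) _; rewrite cabsM !cabs_real.
  have := mulr_ge0 aq (normr_ge0 (x' - x)); have := normr_ge0 (t' - t); lra.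
have wd : cabs (pt q x' t' - pt q x t) < d.
  apply: le_lt_trans bE _; rewrite mulrC -ltr_pdivlMr; last lra.
  move: xd td; rewrite invfM; lra.
have := Hd _ wd; rewrite E.
have Ek : complex.Im (k * F (pt q x' t')) - complex.Im (k * F (pt q x t)) -
  (complex.Im (k * L) * (x' - x) + complex.Im (k * (q * L)) * (t' - t)) =
  complex.Im (k * (F (pt q x' t') - F (pt q x t) - L * ((x' - x)%:C%C + (t' - t)%:C%C * q))).
  case: (F (pt q x' t')) => ? ?; case: (F (pt q x t)) => ? ?.
  clear; case: k L q => ? ? [? ?] [? ?].
  by rewrite !(ImM, ReM, ImB, ReB, ImD, ReD) /=; ring.
move=> h; rewrite Ek; apply: le_trans (Im_le_cabs _) _; rewrite cabsM.
apply: le_trans (ler_wpM2l ak (le_trans h (ler_wpM2l (ltW (divr_gt0 e0 m0)) _))) _.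
  by rewrite -E; exact: bE.
have -> : cabs k * (e / ((cabs k + 1) * (1 + cabs q)) *
   ((1 + cabs q) * (`|x' - x| + `|t' - t|))) =
   e * (`|x' - x| + `|t' - t|) * (cabs k / (cabs k + 1)).
  by field; apply/andP; split; rewrite gt_eqF //; lra.
apply: ler_piMr; first by rewrite mulr_ge0 ?addr_ge0 // ltW.
by rewrite ler_pdivrMr ?mul1r; lra.
Qed.

Lemma lin_approxB (P Q : R -> R -> R) (x t p1 p2 q1 q2 : R) :
  lin_approx P x t p1 p2 -> lin_approx Q x t q1 q2 ->
  lin_approx (fun x t => P x t - Q x t) x t (p1 - q1) (p2 - q2).
Proof.
move=> HP HQ e e0; have e20 : 0 < e / 2 by rewrite divr_gt0.
have [d1 d10 H1] := HP _ e20; have [d2 d20 H2] := HQ _ e20.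
exists (Num.min d1 d2) => [|x' t']; first by rewrite lt_min d10.
rewrite !lt_min => /andP[x1 x2] /andP[t1 t2].
have := H1 _ _ x1 t1; have := H2 _ _ x2 t2; rewrite !ler_norml.
by move=> /andP[? ?] /andP[? ?]; apply/andP; split; lra.
Qed.

Lemma good_closed_at F x t : good F x t ->
  closed_at (im_form 1 1 F) (im_form qup qdown F) x t.
Proof.
move=> [[L HL] [M HM]].
exists (complex.Im (1 * L) - complex.Im (1 * M)).
exists (complex.Im (1 * (qup * L)) - complex.Im (1 * (qdown * M))).
exists (complex.Im (qup * (qup * L)) - complex.Im (qdown * (qdown * M))).
split; first by apply: lin_approxB; exact: Im_lin_approx.
by rewrite !mul1r; apply: lin_approxB; exact: Im_lin_approx.
Qed.

Lemma good_cont F x : (forall t, 0 <= t <= pi -> good F x t) ->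
  cont_on (im_form qup qdown F x) 0 pi.
Proof.
move=> HF t tpi; have [p1 [p2 [q2 [_ HQ]]]] := good_closed_at (HF t tpi).
exact: (lin_approx_continuous HQ).2.
Qed.

Definition two_pi_i : C := Complex 0 (2 * pi).

Lemma pt_up_pi x : pt qup x pi = pt qdown x pi + two_pi_i.
Proof.
apply: complex_ext; rewrite ?(ReD, ImD, ReM, ImM) /=; ring.
Qed.

Lemma pt_0 q x : pt q x 0 = x%:C%C.
Proof. by rewrite /pt mul0r addr0. Qed.

(** Goursat on [a1, a2] x [0, pi]. The sides t = 0 and t = pi carry nothing: both segments start at
    x, and their far ends differ by the period. *)
Lemma contour_const F a1 a2 : a1 <= a2 ->
  (forall v, F (v + two_pi_i) = F v) ->
  (forall x t, a1 <= x <= a2 -> 0 <= t <= pi -> good F x t) ->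
  contour F a1 = contour F a2.
Proof.
move=> a12 per HF.
have w0 : 0 <= a2 - a1 by rewrite subr_ge0.
have E2 : a1 + (a2 - a1) = a2 by ring.
have cl : closed_on (im_form 1 1 F) (im_form qup qdown F) a1 0 (a2 - a1) pi.
  by move=> x t; rewrite E2 add0r => xa t0; apply: good_closed_at; exact: HF.
have := goursat w0 (pi_ge0 R) cl; rewrite /bint E2 add0r.
rewrite (@eq_sint _ (im_form 1 1 F ^~ 0) (fun=> 0)); last first.
  by move=> x _; rewrite /im_form !pt_0 subrr.
rewrite (@eq_sint _ (im_form 1 1 F ^~ pi) (fun=> 0)); last first.
  by move=> x _; rewrite /im_form pt_up_pi per subrr.
by rewrite !sint_cst // !mul0r add0r subr0 => /eqP; rewrite subr_eq0 => /eqP.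
Qed.

(* A primitive of F multiplied by dv with increment 2 pi i res over a period. *)
Definition log_primitive F (res : C) := (forall v, exists L, cderiv F v L) /\
  exists2 H, (forall v, cderiv H v (F v)) &
    forall v, H (v + two_pi_i) = H v + res * two_pi_i.

Lemma log_primitive_good F res x t : log_primitive F res -> good F x t.
Proof. by move=> [HF _]; split; exact: HF. Qed.

Lemma cderiv_pt_Im H q x t L : cderiv H (pt q x t) L ->
  is_derive t (1 : R) (fun t => complex.Im (H (pt q x t))) (complex.Im (q * L)).
Proof.
move=> HH; apply: approx_derive => e e0.
have [d d0 Hd] := Im_lin_approx 1 HH e0; exists d => // y yd.
have := Hd x y; rewrite subrr normr0 mulr0 !add0r !mul1r; apply => //.
Qed.

Lemma contour_log_primitive F res x : log_primitive F res ->
  contour F x = 2 * pi * complex.Re res.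
Proof.
move=> [dF [H HF per]].
have D t : is_derive t (1 : R) (im_form 1 1 H x) (im_form qup qdown F x t).
  apply: is_derive_eq.
    by apply: is_deriveB; under eq_fun do rewrite mul1r; exact: cderiv_pt_Im (HF _).
  by [].
have cF : continuous (im_form qup qdown F x).
  move=> t; have [p1 [p2 [q2 [_ HQ]]]] := @good_closed_at F x t (conj (dF _) (dF _)).
  exact: (lin_approx_continuous HQ).2.
rewrite /contour (sint_FTC (pi_ge0 R) D cF) /im_form !pt_0 pt_up_pi per subrr subr0.
by rewrite !mul1r ImD ImM /=; ring.
Qed.

Lemma log_primitive0 : log_primitive (fun=> 0) 0.
Proof.
split=> [v|]; first by exists 0; exact: cderiv_cst.
exists (fun=> 0) => [v|v]; first exact: cderiv_cst.
by rewrite mul0r addr0.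
Qed.

Lemma log_primitiveD F G a b : log_primitive F a -> log_primitive G b ->
  log_primitive (fun v => F v + G v) (a + b).
Proof.
move=> [dF [H HF pH]] [dG [K KG pK]]; split=> [v|].
  by have [L HL] := dF v; have [M HM] := dG v; exists (L + M); exact: cderivD.
exists (fun v => H v + K v) => [v|v]; first exact: cderivD.
by rewrite pH pK; ring.
Qed.

Lemma log_primitive_cst a : log_primitive (fun=> a) a.
Proof.
split=> [v|]; first by exists 0; exact: cderiv_cst.
by exists (fun v => a * v) => [v|v]; [exact: cderivZ|rewrite mulrDr].
Qed.

Lemma cexp_natM n v : cexp (n%:R * v) = cexp v ^+ n.
Proof.
elim: n => [|n IH]; first by rewrite mul0r cexp0 expr0.
by rewrite -(natr1 n) mulrDl mul1r cexpD IH exprSr.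
Qed.

Lemma cexp_two_pi_i : cexp two_pi_i = 1.
Proof.
apply: complex_ext; rewrite /= expR0 mul1r.
  by rewrite mulr_natl cos2pi.
by rewrite mulr_natl sin2pi.
Qed.

Lemma cexp_per v : cexp (v + two_pi_i) = cexp v.
Proof. by rewrite cexpD cexp_two_pi_i mulr1. Qed.

Lemma cderiv_cexpZ a v : cderiv (fun v => cexp (a * v)) v (cexp (a * v) * a).
Proof. by apply: (cderiv_comp (f := @cexp R)); [exact: cderivZ|exact: cexp_cderiv]. Qed.

(** For m > 0 the function exp (-m v) has a primitive of the same period; only a constant term
    leaves a residue. *)
Lemma log_primitive_monomial k m : (0 < m)%N ->
  log_primitive (fun v => k * cexp (- m%:R * v)) 0.
Proof.
move=> m0; have m0' : (m%:R : C) != 0 by rewrite pnatr_eq0 -lt0n.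
split=> [v|].
  by eexists; exact: cderiv_comp (cderiv_cexpZ (- m%:R) v) (cderivZ k _).
exists (fun v => (k / - m%:R) * cexp (- m%:R * v)) => [v|v].
  have := cderiv_comp (cderiv_cexpZ (- m%:R) v) (cderivZ (k / - m%:R) _).
  congr (cderiv _ _ _).
  by rewrite [_ * - _]mulrC mulrA divfK // oppr_eq0.
have E : cexp (- m%:R * two_pi_i) = 1.
  by rewrite mulNr cexpN cexp_natM cexp_two_pi_i expr1n invr1.
by rewrite mul0r addr0 mulrDr cexpD E mulr1.
Qed.

Lemma norm_im_form F x t (B : R) : cabs (F (pt qup x t)) <= B ->
  cabs (F (pt qdown x t)) <= B -> `|im_form qup qdown F x t| <= 2 * (c + 1) * B.
Proof.
move=> h1 h2.
have cq : cabs qup <= c + 1.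
  by apply: le_trans (cabs_le_ReIm _) _; rewrite /= normr1 gtr0_norm.
have cq' : cabs qdown <= c + 1.
  by apply: le_trans (cabs_le_ReIm _) _; rewrite /= normrN normr1 gtr0_norm.
have i1 := Im_le_cabs (qup * F (pt qup x t)).
have i2 := Im_le_cabs (qdown * F (pt qdown x t)).
rewrite cabsM in i1; rewrite cabsM in i2.
have j1 := ler_pM (cabs_ge0 _) (cabs_ge0 _) cq h1.
have j2 := ler_pM (cabs_ge0 _) (cabs_ge0 _) cq' h2.
rewrite /im_form; apply: le_trans (ler_normB _ _) _; lra.
Qed.

Lemma Re_pt q x t : complex.Re (pt q x t) = x + t * complex.Re q.
Proof. by rewrite /pt ReD ReM /= mul0r subr0. Qed.

Lemma contourD F G x : (forall t, 0 <= t <= pi -> good F x t) ->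
  (forall t, 0 <= t <= pi -> good G x t) ->
  contour (fun v => F v + G v) x = contour F x + contour G x.
Proof.
move=> HF HG; rewrite /contour -sintD; try exact: good_cont.
by apply: eq_sint => t _; rewrite /im_form !mulrDr !ImD; ring.
Qed.

Lemma log_primitive_sum m (G : nat -> C -> C) :
  (forall j, (j < m)%N -> log_primitive (G j) 0) ->
  log_primitive (fun v => \sum_(j < m) G j v) 0.
Proof.
elim: m => [|m IH] HG.
  have -> : (fun v => \sum_(j < 0) G j v) = (fun=> 0).
    by apply/funext => v; rewrite big_ord0.
  exact: log_primitive0.
have -> : (fun v => \sum_(j < m.+1) G j v) = (fun v => \sum_(j < m) G j v + G m v).
  by apply/funext => v; rewrite big_ord_recr.
have Hm : forall j, (j < m)%N -> log_primitive (G j) 0.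
  by move=> j jm; apply: HG; rewrite ltnS ltnW.
by have := log_primitiveD (IH Hm) (HG m (ltnSn m)); rewrite addr0.
Qed.

(** A Taylor polynomial in exp v multiplied by exp (-n v), so that the coefficient of index n
    becomes the constant term. *)
Definition main_part (k : nat -> C) n v : C :=
  \sum_(j < n.+1) k j * cexp (- (n - j)%:R * v).

Lemma log_primitive_main_part (k : nat -> C) n : log_primitive (main_part k n) (k n).
Proof.
have -> : main_part k n = fun v => \sum_(j < n) k j * cexp (- (n - j)%:R * v) + k n.
  apply/funext => v; rewrite /main_part big_ord_recr /= subnn oppr0 mul0r cexp0.
  by rewrite mulr1.
pose G j v := k j * cexp (- (n - j)%:R * v).
have HG j : (j < n)%N -> log_primitive (G j) 0.
  by move=> jn; apply: log_primitive_monomial; rewrite subn_gt0.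
by have := log_primitiveD (log_primitive_sum HG) (log_primitive_cst (k n)); rewrite add0r.
Qed.

(** The contour can be moved left to any y <= x, where F differs from its main part by O(exp y); as
    y tends to -infinity only the residue of the main part remains. *)
Lemma contour_coef F (k : nat -> C) n (l M x : R) :
  0 <= M -> x < 0 ->
  (forall v, F (v + two_pi_i) = F v) ->
  (forall x t, x < 0 -> 0 <= t <= pi -> good F x t) ->
  (forall v, complex.Re v <= l ->
     cabs (F v - main_part k n v) <= M * expR (complex.Re v)) ->
  contour F x = 2 * pi * complex.Re (k n).
Proof.
move=> M0 x0 per gF near0.
apply/eqP; rewrite -subr_eq0 -normr_le0; apply/ler_addgt0Pr => e e0; rewrite add0r.
pose A := 2 * (c + 1) * (M * expR (pi * c)) * pi.
have A0 : 0 <= A by rewrite /A !mulr_ge0 ?pi_ge0 ?expR_ge0 // addr_ge0 // ltW.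
have A1 : 0 < e / (A + 1) by rewrite divr_gt0 // ltr_wpDl.
(* The segments reach real part y + pi c, so l - pi c keeps them where the Taylor estimate holds;
   the logarithm brings the error below e. *)
pose y := Num.min x (Num.min (l - pi * c) (ln (e / (A + 1)))).
have yx : y <= x by rewrite ge_min lexx.
have yl : y <= l - pi * c by rewrite !ge_min lexx orbT.
have ye : expR y <= e / (A + 1).
  by rewrite -[leRHS]lnK ?posrE // ler_expR !ge_min lexx !orbT.
have y0 : y < 0 by exact: le_lt_trans yx x0.
rewrite -(@contour_const F y x yx per); last first.
  by move=> z t /andP[_ zx]; apply: gF; exact: le_lt_trans zx x0.
pose rem v := F v - main_part k n v.
have lpm := log_primitive_main_part k n.
have grem t : 0 <= t <= pi -> good rem y t.
  move=> tpi; have [[L1 H1] [L2 H2]] := gF y t y0 tpi.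
  have [[K1 G1] [K2 G2]] := log_primitive_good y t lpm.
  by split; [exists (L1 - K1)|exists (L2 - K2)]; apply: cderivD => //; exact: cderivN.
have -> : F = fun v => rem v + main_part k n v.
  by apply/funext => v; rewrite /rem subrK.
rewrite contourD //; last by move=> t _; exact: log_primitive_good lpm.
rewrite (contour_log_primitive _ lpm) addrK.
have remB q t : complex.Re q = c -> 0 <= t <= pi ->
    cabs (rem (pt q y t)) <= M * expR (pi * c) * expR y.
  move=> qc /andP[t0 tpi]; have Re : complex.Re (pt q y t) <= y + pi * c.
    by rewrite Re_pt qc lerD2l ler_wpM2r // ltW.
  apply: le_trans (near0 _ _) _; first by lra.
  by rewrite -mulrA -expRD ler_wpM2l // ler_expR addrC.
apply: le_trans (_ : A * expR y <= _); last first.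
  apply: le_trans (ler_wpM2l A0 ye) _.
  by rewrite mulrCA ler_piMr ?(ltW e0) // ler_pdivrMr ?mul1r ?ltr_wpDl // lerDl.
have -> : A * expR y = sint (fun=> 2 * (c + 1) * (M * expR (pi * c) * expR y)) 0 pi.
  by rewrite sint_cst ?pi_ge0 // /A; ring.
apply: sint_norm_le.
- exact: good_cont.
- by move=> z _; exact: cvg_cst.
- by move=> t tpi; apply: norm_im_form; exact: remB.
Qed.

Lemma sint_exp_le (n : nat) : (0 < n)%N ->
  sint (fun t => (n%:R^-1 + t) * expR (- (n%:R * c) * t)) 0 pi
    <= (c^-1 + c ^- 2) * n%:R ^- 2.
Proof.
move=> n0; have nR0 : 0 < n%:R :> R by rewrite ltr0n.
pose k : R := n%:R * c; have k0 : 0 < k by rewrite mulr_gt0.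
pose G (t : R) : R := - ((n%:R^-1 + t) / k + k ^- 2) * expR (- k * t).
have D t : is_derive t (1 : R) G ((n%:R^-1 + t) * expR (- k * t)).
  apply: is_derive_eq; rewrite /= /GRing.scale /=.
  have kk : k != 0 by rewrite gt_eqF.
  by clear -kk; move: (expR _) (n%:R^-1) => y m; move: k kk => k' kk; field.
have cf : continuous (fun t : R => (n%:R^-1 + t) * expR (- k * t)).
  move=> t; apply: cvgM.
    by apply: cvgD; [exact: cvg_cst|exact: cvg_id].
  apply: continuous_comp; last exact: continuous_expR.
  by apply: cvgM; [exact: cvg_cst|exact: cvg_id].
rewrite (sint_FTC (pi_ge0 R) D cf).
have G0 : - G 0 = (c^-1 + c ^- 2) * n%:R ^- 2.
  rewrite /G mulr0 expR0 addr0 mulr1 opprK /k; field.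
  by apply/andP; split; rewrite gt_eqF.
have Gpi : G pi <= 0.
  rewrite /G mulNr oppr_le0 mulr_ge0 ?expR_ge0 //.
  have p0 := pi_ge0 R; have k0' := ltW k0.
  apply: addr_ge0; last by rewrite invr_ge0 exprn_ge0.
  by rewrite divr_ge0 // addr_ge0 // invr_ge0.
by rewrite -G0 gerDr.
Qed.

Lemma contour_bound F (B : R) (n : nat) : (0 < n)%N -> 0 <= B ->
  (forall t, 0 <= t <= pi -> good F (- n%:R^-1) t) ->
  (forall q t, complex.Re q = c -> 0 <= t <= pi -> q = qup \/ q = qdown ->
    cabs (F (pt q (- n%:R^-1) t)) <= B * ((n%:R^-1 + t) * expR (- (n%:R * c) * t))) ->
  `|contour F (- n%:R^-1)| <= 2 * (c + 1) * B * ((c^-1 + c ^- 2) * n%:R ^- 2).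
Proof.
move=> n0 B0 gF bF; pose f (t : R) := (n%:R^-1 + t) * expR (- (n%:R * c) * t).
have cf : continuous f.
  move=> t; apply: cvgM.
    by apply: cvgD; [exact: cvg_cst|exact: cvg_id].
  apply: continuous_comp; last exact: continuous_expR.
  by apply: cvgM; [exact: cvg_cst|exact: cvg_id].
have K0 : 0 <= 2 * (c + 1) * B by rewrite !mulr_ge0 // addr_ge0 // ltW.
apply: le_trans (ler_wpM2l K0 (sint_exp_le n0)); rewrite -sintZ; last first.
  by move=> t _; exact: cf.
apply: sint_norm_le.
- exact: good_cont.
- by move=> t _; apply: cvgM; [exact: cvg_cst|exact: cf].
- by move=> t tpi; rewrite -[leRHS]mulrA; apply: norm_im_form; apply: bF => //; [left|right].
Qed.

End Contour.

(** * The contour stays in the domain of class F *)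

Section Geometry.
Variable R : realType.
Local Notation C := (C R).

(** The function k sin s - cos s - c s has derivative k cos s + sin s - c, positive because cos s +
    sin s >= 1 and c < min (k, 1). *)
Lemma wedge_linear (k c t : R) : 0 < k -> c < k -> c < 1 -> 0 < t -> t < pi / 2 ->
  cos t - k * sin t < 1 - c * t.
Proof.
move=> k0 ck c1 t0 tpi.
pose f (s : R) := k * sin s - cos s - c * s.
have D (s : R) : is_derive s (1 : R) f (k * cos s + sin s - c).
  by apply: is_derive_eq; rewrite /GRing.scale /=; ring.
have cf : {within `[0, t], continuous f}.
  by apply: derivable_within_continuous => s _; case: (D s).
have [s st E] := MVT t0 (fun s _ => D s) cf.
rewrite in_itv /= in st; case/andP: st => s0 st.
have sp : s < pi / 2 by exact: lt_trans tpi.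
have cs : 0 < cos s by apply: cos_gt0_pihalf; rewrite sp andbT (lt_trans _ s0) // oppr_lt0 divr_gt0 ?pi_gt0.
have ss : 0 < sin s by apply: sin_gt0_pihalf; rewrite s0 sp.
have cs1 := cos_le1 s; have ss1 := sin_le1 s; have e1 := cos2Dsin2 s.
have sum1 : 1 <= cos s + sin s.
  rewrite -e1; apply: lerD; rewrite expr2; exact: ler_piMl (ltW _) _.
have df0 : 0 < k * cos s + sin s - c.
  have [k1|k1] := lerP 1 k.
    by have := ler_wpM2r (ltW cs) k1; lra.
  have := ler_wpM2l (ltW k0) sum1.
  by have := ler_wpM2r (ltW ss) (ltW k1); lra.
have := mulr_gt0 df0 t0; move: E; rewrite /f subr0 sin0 cos0 !mulr0 => E.
lra.
Qed.

(** For k = cot phi this places exp v, v on one of the two segments, outside the wedge of half-angle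
    phi with vertex 1. The growth exp (c t) is compensated through 1 - c t <= exp (-c t). *)
Lemma wedge (k c x t : R) : 0 < k -> c < k -> c < 1 -> x <= 0 -> 0 <= t <= pi ->
  (x < 0 \/ 0 < t) -> expR (x + c * t) * (cos t - k * sin t) < 1.
Proof.
move=> k0 ck c1 x0 /andP[t0 tpi] xt.
have st : 0 <= sin t by apply: sin_ge0_pi; rewrite t0.
have [D0|D0] := lerP (cos t - k * sin t) 0.
  by apply: le_lt_trans ltr01; rewrite mulr_ge0_le0 ?expR_ge0.
have ct : 0 < cos t by have := mulr_ge0 (ltW k0) st; lra.
have t2 : t < pi / 2.
  rewrite ltNge; apply/negP => h.
  have : cos t <= cos (pi / 2).
    have p2 : (pi / 2 : R) \in `[0, pi].
      by rewrite in_itv /= divr_ge0 ?pi_ge0 // ler_pdivrMr // ler_peMr ?pi_ge0 // ler1n.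
    have tp : t \in `[0, pi] by rewrite in_itv /= t0.
    by rewrite leNgt ltr_cos // -leNgt.
  by rewrite cos_pihalf leNgt ct.
have e1 := expR_ge1Dx (- (c * t)).
have E : expR (x + c * t) * expR (- (c * t)) = expR x by rewrite -expRD addrK.
have Dle : t = 0 \/ cos t - k * sin t < 1 - c * t.
  move: t0; rewrite le_eqVlt => /predU1P[<-|t0]; [by left|right].
  exact: wedge_linear.
case: Dle xt => [-> [xl|]|Dlt _].
- by rewrite mulr0 addr0 cos0 sin0 mulr0 subr0 mulr1 expR_lt1.
- by rewrite ltxx.
apply: lt_le_trans (_ : expR x <= _); last by rewrite -expR0 ler_expR.
by rewrite -E ltr_pM2l ?expR_gt0 //; lra.
Qed.

Variables (r rho phi : R).
Hypotheses (r0 : 0 < r) (rrho : r < rho) (phi0 : 0 < phi) (phi2 : phi < pi / 2).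

Lemma carg_gt (w : C) : complex.Re w < cos phi * cabs w -> 0 < cabs w ->
  phi < `|carg w|.
Proof.
move=> h w0; set y := complex.Re w / cabs w.
have y1 : -1 <= y <= 1.
  have := Re_le_cabs w; rewrite ler_norml => /andP[h1 h2].
  by rewrite /y ler_pdivlMr // mulN1r h1 ler_pdivrMr // mul1r.
have -> : `|carg w| = acos y.
  by rewrite /carg -/(cabs w) -/y; case: ifP => _; rewrite ?normrN ger0_norm // acos_ge0.
rewrite ltNge; apply/negP => ya; have [/andP[a0 api] ca] := acos_def y1.
have pp : phi \in `[0, pi].
  rewrite in_itv /= (ltW phi0); apply/ltW/(lt_trans phi2).
  by rewrite ltr_pdivrMr // ltr_pMr ?pi_gt0 // ltr1n.
have ap : acos y \in `[0, pi] by rewrite in_itv /= a0.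
have : cos phi <= cos (acos y) by rewrite leNgt ltr_cos // -leNgt.
by rewrite ca leNgt => /negP; apply; rewrite /y ltr_pdivrMr.
Qed.

Lemma wedge_Delta0 : exists2 c : R, 0 < c &
  forall q x t, q = qup c \/ q = qdown c -> x <= 0 -> 0 <= t <= pi ->
    (x < 0 \/ 0 < t) -> let z : C := r%:C%C * cexp (pt q x t) in
    Delta0 r rho phi z /\ slit (1 - z / r%:C%C).
Proof.
have cphi : 0 < cos phi.
  apply: cos_gt0_pihalf; rewrite phi2 andbT (lt_trans _ phi0) // oppr_lt0.
  by rewrite divr_gt0 ?pi_gt0.
have sphi : 0 < sin phi by apply: sin_gt0_pihalf; rewrite phi0 phi2.
pose k := cos phi / sin phi; have k0 : 0 < k by rewrite divr_gt0.
have rr : 1 < rho / r by rewrite ltr_pdivlMr // mul1r.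
pose l := ln (rho / r); have l0 : 0 < l by rewrite ln_gt0.
have p0 := pi_gt0 R.
(* c < cot phi and c < 1 serve the wedge; c pi < ln (rho / r) keeps z in the disc of radius
   [rho]. *)
pose c := Num.min (k / 2) (Num.min (2^-1) (l / (2 * pi))).
have c0 : 0 < c by rewrite !lt_min invr_gt0 ltr0n !divr_gt0 ?mulr_gt0.
have ck : c < k.
  by apply: le_lt_trans (_ : k / 2 < k); [rewrite ge_min lexx|lra].
have c1 : c < 1.
  by apply: le_lt_trans (_ : 2^-1 < 1); [rewrite !ge_min lexx orbT|lra].
have cl : c * pi < l.
  apply: le_lt_trans (_ : l / (2 * pi) * pi < l).
    by rewrite ler_pM2r // !ge_min lexx !orbT.
  by rewrite invfM mulrA divfK ?gt_eqF //; lra.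
exists c => // q x t qE x0 tpi xt z.
have lt1 := wedge k0 ck c1 x0 tpi xt.
case/andP: (tpi) => t0 tp.
pose w : C := cexp (pt q x t) - 1.
have zw : z - r%:C%C = r%:C%C * w by rewrite /z /w mulrBr mulr1.
set E := expR (x + c * t) in lt1.
have Req : complex.Re (pt q x t) = x + c * t.
  by rewrite Re_pt [c * t]mulrC; case: qE => ->.
have Imq : complex.Im (pt q x t) = t \/ complex.Im (pt q x t) = - t.
  by case: qE => ->; [left|right]; rewrite /pt ImD ImM /=; ring.
have Rew : complex.Re w = E * cos t - 1.
  by rewrite /w ReB /= Req -/E; case: Imq => ->; rewrite ?cosN.
have Imw : `|complex.Im w| = E * sin t.
  have s0 : 0 <= sin t by exact: sin_ge0_pi.
  have E0 : 0 <= E by exact: expR_ge0.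
  rewrite /w ImB /= subr0 Req -/E normrM (ger0_norm E0); congr (_ * _).
  by case: Imq => ->; rewrite ?sinN ?normrN ger0_norm.
have key : complex.Re w < k * `|complex.Im w|.
  by rewrite Rew Imw; move: lt1; rewrite mulrBr; lra.
have w0 : 0 < cabs w.
  rewrite cabs_gt0; apply/negP => /eqP w0; move: key.
  by rewrite w0 /= normr0 mulr0 ltxx.
have Rc : complex.Re w < cos phi * cabs w.
  have [h|h] := lerP (complex.Re w) 0.
    by apply: le_lt_trans h _; rewrite mulr_gt0.
  rewrite -(ltr_pXn2r (n := 2)) ?nnegrE ?(ltW h) ?mulr_ge0 ?ltW //.
  rewrite exprMn cabs_sqr mulrDr.
  have key2 : complex.Re w * sin phi < cos phi * `|complex.Im w|.
    by move: key; rewrite /k mulrAC ltr_pdivlMr.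
  have key3 : complex.Re w ^+ 2 * sin phi ^+ 2 < cos phi ^+ 2 * complex.Im w ^+ 2.
    rewrite -!exprMn -(real_normK (num_real (cos phi * complex.Im w))) normrM (ger0_norm (ltW cphi)).
    rewrite ltr_pXn2r // nnegrE mulr_ge0 ?normr_ge0 ?ltW //.
  have := cos2Dsin2 phi => e1.
  have {e1} e1 : sin phi ^+ 2 = 1 - cos phi ^+ 2 by lra.
  by rewrite e1 in key3; lra.
have zr : cabs (z - r%:C%C) = r * cabs w by rewrite zw cabsM cabs_real_ge0 ?ltW.
split.
  split; last split.
  - rewrite normC_cabs ltcR /z cabsM cabs_cexp cabs_real_ge0 ?ltW // Req.
    have q0 : 0 < rho / r by exact: lt_trans rr.
    rewrite mulrC -ltr_pdivlMr // -[ltRHS]lnK ?posrE //.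
    rewrite ltr_expR; apply: le_lt_trans cl.
    by have := ler_wpM2l (ltW c0) tp; lra.
  - by rewrite -subr_eq0 -cabs_gt0 zr mulr_gt0.
  - apply: carg_gt; last by rewrite zr mulr_gt0.
    by rewrite zr zw ReM /= mul0r subr0 mulrCA ltr_pM2l.
have -> : 1 - z / r%:C%C = - w.
  have rC0 := realC_neq0 r0.
  by rewrite /z mulrAC divff // mul1r /w opprB.
rewrite /slit cabsN.
have -> : complex.Re (- w) = - complex.Re w by case: (w).
have : cos phi * cabs w <= cabs w by rewrite ler_piMl ?cabs_ge0 ?cos_le1.
lra.
Qed.

End Geometry.

(** * Coefficients of a function of class F *)

Section ClassF.
Variable R : realType.
Local Notation C := (C R).
Implicit Types (q z v : C) (f g u : C -> C).

Lemma Re_natN n v : complex.Re (- n%:R * v) = - n%:R * complex.Re v.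
Proof.
have -> : (- n%:R : C) = (- n%:R : R)%:C%C by rewrite rmorphN rmorph_nat.
by rewrite ReM /= mul0r subr0.
Qed.

Lemma cabs_pt_le (c : R) q x t : 0 < c -> q = qup c \/ q = qdown c -> x <= 0 -> 0 <= t ->
  cabs (pt q x t) <= (c + 1) * (- x + t).
Proof.
move=> c0 qE x0 t0; rewrite /pt; apply: le_trans (cabsD _ _) _.
rewrite cabsM !cabs_real (ler0_norm x0) (ger0_norm t0).
have cq : cabs q <= c + 1.
  by apply: le_trans (cabs_le_ReIm _) _; case: qE => ->; rewrite /= ?normrN normr1 gtr0_norm.
have := ler_wpM2l t0 cq; have := mulr_ge0 (ltW c0) (eqbRL (oppr_ge0 x) x0); lra.
Qed.

Lemma pt_continuous q (x t e : R) : 0 < e -> \forall p \near (x, t),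
  cabs (pt q p.1 p.2 - pt q x t) < e.
Proof.
move=> e0; have q0 : 0 < 1 + cabs q by have := cabs_ge0 q; lra.
have d0 : 0 < e / (1 + cabs q) / 2 by rewrite !divr_gt0.
apply/nbhs_ballP; exists (e / (1 + cabs q) / 2) => //= -[x' t'] [/= hx ht].
rewrite /ball /= in hx ht.
have -> : pt q x' t' - pt q x t = (x' - x)%:C%C + (t' - t)%:C%C * q.
  by rewrite /pt !rmorphB /=; ring.
apply: le_lt_trans (cabsD _ _) _; rewrite cabsM !cabs_real.
rewrite distrC in hx; rewrite distrC in ht.
have : `|x' - x| + `|t' - t| < e / (1 + cabs q) by lra.
rewrite ltr_pdivlMr //.
by have := mulr_ge0 (cabs_ge0 q) (normr_ge0 (x' - x)); have := normr_ge0 (t' - t); lra.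
Qed.

(* Near the origin the estimate is the hypothesis at r; the rest of the
   strip is compact. *)
Lemma strip_bound (F : C -> C) q (eta B0 : R) : 0 < eta -> 0 <= B0 ->
  (forall x t, x <= 0 -> 0 <= t <= pi -> x < 0 \/ 0 < t ->
     exists L, cderiv F (pt q x t) L) ->
  (forall x t, x <= 0 -> 0 <= t <= pi -> x < 0 \/ 0 < t -> - x + t < eta ->
     cabs (F (pt q x t)) <= B0 * (- x + t)) ->
  exists2 B : R, 0 <= B & forall x t, -1 <= x < 0 -> 0 <= t <= pi ->
    cabs (F (pt q x t)) <= B * (- x + t).
Proof.
move=> eta0 B00 dF nearF.
pose A := (`[(-1 : R), 0] `*` `[(0 : R), pi]) `&` [set p : R * R | eta <= - p.1 + p.2].
pose f (p : R * R) := cabs (F (pt q p.1 p.2)).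
have Acompact : compact A.
  apply: compact_closedI; first by apply: compact_setX; exact: segment_compact.
  apply: (@preimage_closed _ _ (fun p : R * R => - p.1 + p.2) [set y : R | eta <= y]).
    move=> p _; apply: cvgD; last exact: cvg_snd.
    by apply: cvgN; exact: cvg_fst.
  exact: closed_ge.
have AP x t : A (x, t) -> [/\ -1 <= x <= 0, 0 <= t <= pi & eta <= - x + t].
  by case=> -[/= ]; rewrite !in_itv /=.
have cf : {within A, continuous f}.
  apply: continuous_in_subspaceT => -[x t]; rewrite inE => /AP[/andP[x1 x0] tpi xt].
  have xt' : x < 0 \/ 0 < t.
    by move: xt; case: (ltP x 0) => [|x0']; [left|right; lra].
  have [L HL] := dF x t x0 tpi xt'.
  apply/cvgrPdist_le => e e0; have [d d0 Hd] := cderiv_continuous HL e0.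
  near=> p; rewrite /f /=.
  have h : cabs (F (pt q p.1 p.2) - F (pt q x t)) <= e.
    by apply: Hd; near: p; exact: pt_continuous.
  have h1 := cabsD (F (pt q p.1 p.2) - F (pt q x t)) (F (pt q x t)).
  have h2 := cabsD (F (pt q x t) - F (pt q p.1 p.2)) (F (pt q p.1 p.2)).
  rewrite !subrK cabsC in h1 h2.
  by rewrite ler_norml; apply/andP; split; rewrite cabsC in h; lra.
have [B1 B10 HB1] : exists2 B1 : R, 0 <= B1 & forall p, A p -> f p <= B1.
  have [A0|A0] := pselect (A !=set0).
    have [p Ap Hp] := compact_EVT_max A0 Acompact cf.
    exists (f p) => [|p' Ap']; first exact: cabs_ge0.
    by apply: Hp; rewrite inE.
  by exists 0 => // p Ap; case: A0; exists p.
exists (B0 + B1 / eta); first by rewrite addr_ge0 // divr_ge0 // ltW.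
move=> x t /andP[x1 x0] tpi; case/andP: (tpi) => t0 tp.
have s0 : 0 <= - x + t by lra.
rewrite mulrDl; have [small|large] := ltP (- x + t) eta.
  apply: le_trans (nearF x t (ltW x0) tpi (or_introl x0) small) _.
  by rewrite lerDl mulr_ge0 // divr_ge0 // ltW.
have := HB1 (x, t); rewrite /f /= => HB1'.
have Axt : A (x, t) by split; [split; rewrite /= in_itv /= ?x1 ?(ltW x0)|].
apply: le_trans (HB1' Axt) _.
apply: le_trans (_ : B1 / eta * (- x + t) <= _); last by rewrite lerDr mulr_ge0.
by rewrite mulrAC ler_pdivlMr // ler_wpM2l.
Unshelve. all: by end_near. Qed.

Variables (r theta : R).
Hypothesis r0 : 0 < r.

Definition regular_part g (K : C) (t : C) : C := g t - (singular_log r theta t + K).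

Lemma regular_part_cderiv g K t L : cderiv g t L -> slit (1 - t / r%:C%C) ->
  exists M, cderiv (regular_part g K) t M.
Proof.
move=> Hg sl; have H1 := slog_cderiv r0 sl.
have H2 := cderiv_comp H1 (cderivZ theta%:C%C _).
have H3 := cderivN (cderivD H2 (cderiv_cst K t)).
by eexists; exact: cderivD Hg H3.
Qed.

(** At j = 0 the logarithm contributes 1 / 0 = 0 and only [K] is subtracted; [K] does not affect the
    other coefficients. *)
Definition regular_coef (a : nat -> C) (K : C) (j : nat) : C :=
  a j - (theta%:C%C * (r%:C%C ^- j / j%:R) + (j == 0%N)%:R * K).

Lemma regular_part_taylor g a K n : 0 <= theta -> has_expansion_at0 a g ->
  exists d M : R, [/\ 0 < d, 0 <= M & forall t, cabs t <= d ->
    cabs (regular_part g K t - \sum_(j < n.+1) regular_coef a K j * t ^+ j)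
      <= M * cabs t ^+ n.+1].
Proof.
move=> th0 ga; have [d [M [d0 M0 H]]] := has_expansion_taylor n ga.
exists (Num.min d (r / 2)), (M + theta * (4 / r ^+ n.+1)); split.
- by rewrite lt_min d0 divr_gt0.
- by apply: addr_ge0 => //; rewrite mulr_ge0 // divr_ge0 // exprn_ge0 // ltW.
move=> t; rewrite le_min => /andP[td tr].
have h1 := H t td; have h2 := slog_taylor r0 n tr.
have -> : regular_part g K t - \sum_(j < n.+1) regular_coef a K j * t ^+ j =
  (g t - \sum_(j < n.+1) a j * t ^+ j)
  - theta%:C%C * (slog r t - \sum_(j < n.+1) (t / r%:C%C) ^+ j / j%:R).
  have -> : \sum_(j < n.+1) regular_coef a K j * t ^+ j = \sum_(j < n.+1) a j * t ^+ j
    - theta%:C%C * (\sum_(j < n.+1) (t / r%:C%C) ^+ j / j%:R) - K.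
    rewrite /regular_coef mulr_sumr.
    under eq_bigr do rewrite mulrBl mulrDl.
    rewrite sumrB big_split /= opprD addrA; congr (_ - _ - _).
      by apply: eq_bigr => j _; rewrite expr_div_n; ring.
    rewrite big_ord_recl /= big1 ?addr0 ?mul1r ?mulr1 // => j _.
    by rewrite /= !mul0r.
  by rewrite /regular_part /singular_log -/(slog r t); ring.
apply: le_trans (cabsB _ _) _; rewrite mulrDl; apply: lerD => //.
rewrite cabsM cabs_real_ge0 // -mulrA; apply: ler_wpM2l => //.
by apply: le_trans h2 _; rewrite expr_div_n mulrA mulrAC.
Qed.

Lemma contour_estimate (p D m a e : R) : 0 < p -> 0 < m ->
  2 * p * (D / m) <= 2 * a * (e / m ^+ 2) -> D <= a * e / p / m.
Proof.
move=> p0 m0 h; have s0 : 0 <= m / (2 * p) by rewrite divr_ge0 ?mulr_ge0 ?ltW.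
have := ler_wpM2r s0 h; congr (_ <= _); by field; rewrite !gt_eqF.
Qed.

(** The contour integral of u(r exp v) exp (-n v) equals 2 pi (Theta_n r^n - theta) / n and is
    O(n^-2) at x = -1/n; the division by n turns this into the rate 1/n. *)
Lemma classF_coef (Theta : nat -> R) : series_of_class (classF r theta) (g_coef Theta) ->
  exists E : R, forall n, (0 < n)%N -> `|Theta n * r ^+ n - theta| <= E / n%:R.
Proof.
move=> [g ga [_ th0 [rho [phi [rrho /andP[phi0 phi2] hol [K bigO]]]]]].
have [c c0 geo] := wedge_Delta0 r0 rrho phi0 phi2.
pose u := regular_part g K.
have [b0 [d1 [b00 d10 near_r]]] : exists b0 d1 : R, [/\ 0 <= b0, 0 < d1 &
    forall z, Delta0 r rho phi z -> cabs (z - r%:C%C) < d1 ->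
      cabs (u z) <= b0 * cabs (z - r%:C%C)].
  move/eqO_exP: bigO => -[k k0 /nbhs_cabsP[d d0 Hd]].
  exists (complex.Re k), d; split => //; first by apply: ltW; rewrite -ltcR RRe_real ?gtr0_real.
  move=> z zD zd; have := Hd z zd zD.
  have -> : k = (complex.Re k)%:C%C by rewrite RRe_real ?gtr0_real.
  by rewrite !normC_cabs -rmorphM lecR.
have du q x t : q = qup c \/ q = qdown c -> x <= 0 -> 0 <= t <= pi ->
    x < 0 \/ 0 < t -> exists L, cderiv (fun v => u (r%:C%C * cexp v)) (pt q x t) L.
  move=> qE x0 tpi xt; have [zD sl] := geo q x t qE x0 tpi xt.
  have [L HL] := derivable_cderiv (hol _ zD).
  have [M HM] := regular_part_cderiv K HL sl.
  have H1 := cderiv_comp (cexp_cderiv (pt q x t)) (cderivZ r%:C%C _).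
  by eexists; exact: cderiv_comp H1 HM.
have [d2 d20 Hd2] := @cexp_approx0 R 1 ltr01.
have c1 : 0 < c + 1 by rewrite addr_gt0.
(* Since |v| <= (c + 1) (-x + t), this gives |exp v - 1| <= 2 |v| and then |r exp v - r| < d1. *)
pose eta := Num.min d2 (d1 / (2 * r)) / (c + 1).
have eta0 : 0 < eta by rewrite divr_gt0 // lt_min d20 divr_gt0 // mulr_gt0.
have nearu q x t : q = qup c \/ q = qdown c -> x <= 0 -> 0 <= t <= pi ->
    x < 0 \/ 0 < t -> - x + t < eta ->
    cabs (u (r%:C%C * cexp (pt q x t))) <= b0 * (2 * r * (c + 1)) * (- x + t).
  move=> qE x0 tpi xt; case/andP: (tpi) => t0 tp.
  have [zD _] := geo q x t qE x0 tpi xt.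
  rewrite ltr_pdivlMr // lt_min => /andP[s1 s2].
  have ptle := cabs_pt_le c0 qE x0 t0.
  have e1 : cabs (cexp (pt q x t) - 1) <= 2 * cabs (pt q x t).
    rewrite -[cexp _ - 1](subrK (pt q x t)); apply: le_trans (cabsD _ _) _.
    have := Hd2 (pt q x t); rewrite mul1r => H.
    by rewrite mulr2n mulrDl mul1r lerD2r; apply: H; lra.
  have zr : cabs (r%:C%C * cexp (pt q x t) - r%:C%C) <= 2 * r * ((c + 1) * (- x + t)).
    have -> : r%:C%C * cexp (pt q x t) - r%:C%C = r%:C%C * (cexp (pt q x t) - 1) by ring.
    rewrite cabsM cabs_real_ge0 ?(ltW r0) // [2 * r]mulrC -mulrA ler_pM2l //; lra.
  rewrite -!mulrA; apply: le_trans (near_r _ zD _) _.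
    apply: le_lt_trans zr _; move: s2; rewrite ltr_pdivlMr ?mulr_gt0 //; lra.
  by apply: ler_wpM2l => //; rewrite mulrA.
have [B B0 HB] : exists2 B : R, 0 <= B & forall q x t, q = qup c \/ q = qdown c ->
    -1 <= x < 0 -> 0 <= t <= pi -> cabs (u (r%:C%C * cexp (pt q x t))) <= B * (- x + t).
  have b0' : 0 <= b0 * (2 * r * (c + 1)) by rewrite !mulr_ge0 // ltW.
  have [B1 B10 HB1] := strip_bound (F := fun v => u (r%:C%C * cexp v)) eta0 b0' (fun x t => du _ x t (or_introl erefl))
    (fun x t => nearu _ x t (or_introl erefl)).
  have [B2 B20 HB2] := strip_bound (F := fun v => u (r%:C%C * cexp v)) eta0 b0' (fun x t => du _ x t (or_intror erefl))
    (fun x t => nearu _ x t (or_intror erefl)).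
  exists (B1 + B2); first exact: addr_ge0.
  move=> q x t qE xx tpi; have s0 : 0 <= - x + t by case/andP: xx; case/andP: tpi; lra.
  have := mulr_ge0 B10 s0; have := mulr_ge0 B20 s0; rewrite mulrDl.
  by case: qE => ->; [have := HB1 x t xx tpi|have := HB2 x t xx tpi]; lra.
pose E := (c + 1) * (B * expR 1) * (c^-1 + c ^- 2) / pi.
exists E => n n0; have nR0 : 0 < n%:R :> R by rewrite ltr0n.
pose F v : C := u (r%:C%C * cexp v) * cexp (- n%:R * v).
have perF v : F (v + two_pi_i R) = F v.
  rewrite /F cexp_per; congr (_ * _).
  by rewrite !mulNr !cexpN !cexp_natM cexp_per.
have goodF x t : x < 0 -> 0 <= t <= pi -> good c F x t.
  move=> x0 tpi; split.
    have [L HL] := du _ x t (or_introl erefl) (ltW x0) tpi (or_introl x0).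
    by eexists; exact: cderivM HL (cderiv_cexpZ _ _).
  have [L HL] := du _ x t (or_intror erefl) (ltW x0) tpi (or_introl x0).
  by eexists; exact: cderivM HL (cderiv_cexpZ _ _).
have [d [M [d0 M0 Hd]]] := regular_part_taylor K n th0 ga.
pose k j : C := regular_coef (g_coef Theta) K j * r%:C%C ^+ j.
have mainF v : complex.Re v <= ln (d / r) ->
    cabs (F v - main_part k n v) <= M * r ^+ n.+1 * expR (complex.Re v).
  move=> vl; pose z : C := r%:C%C * cexp v.
  have zE : cabs z = r * expR (complex.Re v) by rewrite cabsM cabs_cexp cabs_real_ge0 ?ltW.
  have zd : cabs z <= d.
    by rewrite zE mulrC -ler_pdivlMr // -[leRHS]lnK ?ler_expR // posrE divr_gt0.
  have -> : F v - main_part k n v =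
      cexp (- n%:R * v) * (u z - \sum_(j < n.+1) regular_coef (g_coef Theta) K j * z ^+ j).
    rewrite mulrBr /F -/z [u z * _]mulrC; congr (_ - _).
    rewrite /main_part mulr_sumr; apply: eq_bigr => -[j /= jn] _.
    have -> : cexp (- (n - j)%:R * v) = cexp (- n%:R * v) * cexp v ^+ j.
      rewrite -cexp_natM -cexpD; congr cexp; rewrite natrB ?ltnS //; ring.
    by rewrite /k /z exprMn; ring.
  rewrite cabsM cabs_cexp.
  apply: le_trans (ler_wpM2l (expR_ge0 _) (Hd z zd)) _.
  have eE : expR (complex.Re (- n%:R * v)) * expR (complex.Re v) ^+ n.+1 = expR (complex.Re v).
    by rewrite Re_natN -expRM_natl -expRD -(natr1 n); congr expR; ring.
  rewrite -[in leRHS]eE zE exprMn le_eqVlt; apply/orP; left; apply/eqP; ring.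
have x0 : - n%:R^-1 < 0 :> R by rewrite oppr_lt0 invr_gt0.
have M0' : 0 <= M * r ^+ n.+1 by rewrite mulr_ge0 // exprn_ge0 // ltW.
have J1 := contour_coef c0 M0' x0 perF goodF mainF.
have BE0 : 0 <= B * expR 1 by rewrite mulr_ge0 ?expR_ge0.
have J2 := @contour_bound R c c0 F (B * expR 1) n n0 BE0 (fun t => goodF _ t x0).
have {J2}J2 : `|contour c F (- n%:R^-1)| <=
    2 * (c + 1) * (B * expR 1) * ((c^-1 + c ^- 2) * n%:R ^- 2).
  apply: J2 => q t qc tpi qE.
  have xx : -1 <= (- n%:R^-1 : R) < 0 by rewrite x0 andbT lerN2 invf_le1 // ler1n.
  rewrite /F cabsM cabs_cexp.
  (* The vertex -1/n contributes the 1, which is the source of [expR 1] in the constant. *)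
  have -> : complex.Re (- n%:R * pt q (- n%:R^-1) t) = 1 + - (n%:R * c) * t.
    by rewrite Re_natN Re_pt qc; field; rewrite gt_eqF.
  rewrite expRD mulrA [leRHS](_ : _ = B * (n%:R^-1 + t) * (expR 1 * expR (- (n%:R * c) * t))); last by ring.
  rewrite -[_ * expR 1 * _]mulrA; apply: ler_wpM2r; first by rewrite mulr_ge0 ?expR_ge0.
  by have := HB q _ t qE xx tpi; rewrite opprK.
have kn : complex.Re (k n) = (Theta n * r ^+ n - theta) / n%:R.
  have -> : k n = ((Theta n / n%:R - theta * (r ^- n / n%:R)) * r ^+ n)%:C%C.
    rewrite /k /regular_coef /g_coef eqn0Ngt n0 mul0r addr0.
    by rewrite -(rmorph_nat (real_complex R)) -(rmorphXn (real_complex R)) -!fmorphV -!rmorphM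
      -rmorphB -rmorphM.
  by rewrite /=; field; rewrite !gt_eqF ?exprn_gt0.
move: J2; have q0 : 0 <= 2 * pi :> R by rewrite mulr_ge0 ?pi_ge0.
rewrite J1 kn normrM (ger0_norm q0) normf_div (gtr0_norm nR0) -[2 * (c + 1) * _]mulrA.
exact: contour_estimate (pi_gt0 R) nR0.
Qed.

End ClassF.

(** * Coefficients of a function of class eF *)

Section ClassEF.
Variable R : realType.
Local Notation C := (C R).
Implicit Types (t : C) (g : C -> C).

(** Letting t tend to 0 kills the constant coefficient, and division by t then lowers n; t = 0 is
    excluded to make the division legitimate. *)
Lemma poly_small_coef (c : nat -> C) n (d M : R) : 0 < d -> 0 <= M ->
  (forall t, 0 < cabs t <= d ->
     cabs (\sum_(j < n.+1) c j * t ^+ j) <= M * cabs t ^+ n.+1) -> c n = 0.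
Proof.
elim: n c => [|n IH] c d0 M0 H.
  apply/eqP; rewrite -(negbK (c 0%N == 0)) -cabs_gt0 -leNgt; apply/ler_addgt0Pr => e e0.
  pose s := Num.min d (e / (M + 1)).
  have s0 : 0 < s by rewrite lt_min d0 divr_gt0 // ltr_wpDl.
  have sE : cabs (s%:C%C : C) = s by rewrite cabs_real_ge0 ?ltW.
  have := H s%:C%C; rewrite sE s0 /s ge_min lexx -/s => /(_ isT).
  rewrite big_ord_recl big_ord0 expr0 mulr1 addr0 expr1 => h.
  rewrite add0r; apply: le_trans h _.
  apply: le_trans (_ : M * (e / (M + 1)) <= _).
    by apply: ler_wpM2l => //; rewrite ge_min lexx orbT.
  by rewrite mulrCA ler_piMr ?(ltW e0) // ler_pdivrMr ?mul1r ?lerDl // ltr_wpDl.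
have c00 : c 0%N = 0.
  apply/eqP; rewrite -(negbK (c 0%N == 0)) -cabs_gt0 -leNgt; apply/ler_addgt0Pr => e e0.
  pose S := \sum_(j < n.+1) cabs (c j.+1).
  have S0 : 0 <= S by apply: sumr_ge0 => j _; exact: cabs_ge0.
  pose s := Num.min (Num.min d 1) (e / (M + S + 1)).
  have k0 : 0 < M + S + 1 by rewrite ltr_wpDl // addr_ge0.
  have s0 : 0 < s by rewrite !lt_min d0 ltr01 divr_gt0.
  have s1 : s <= 1 by rewrite !ge_min lexx orbT.
  have sX k : s ^+ k.+1 <= s.
    rewrite exprS; apply: ler_piMr; first exact: ltW.
    by apply: exprn_ile1 => //; exact: ltW.
  have sE : cabs (s%:C%C : C) = s by rewrite cabs_real_ge0 ?ltW.
  have := H s%:C%C; rewrite sE s0 /s !ge_min lexx -/s => /(_ isT).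
  rewrite big_ord_recl expr0 mulr1 => h.
  set T := \sum_(j < n.+1) _ in h.
  have TB : cabs T <= s * S.
    rewrite /T /S mulr_sumr.
    have sumB (I : Type) (l : seq I) (P : pred I) (x : I -> C) :
        cabs (\sum_(i <- l | P i) x i) <= \sum_(i <- l | P i) cabs (x i).
      elim/big_ind2: _ => [|? ? ? ? h1 h2|//]; first by rewrite cabs0.
      exact: le_trans (cabsD _ _) (lerD h1 h2).
    apply: le_trans (sumB _ _ _ _) _; apply: ler_sum => j _.
    rewrite cabsM cabsX sE mulrC; apply: ler_wpM2r; first exact: cabs_ge0.
    exact: sX.
  have -> : c 0%N = c 0%N + T - T by rewrite addrK.
  rewrite add0r; apply: le_trans (cabsB _ _) _.
  have h' : M * s ^+ n.+2 <= M * s.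
    by apply: ler_wpM2l => //; exact: sX.
  apply: le_trans (_ : s * (M + S + 1) <= _).
    by have := ltW s0; lra.
  by rewrite -ler_pdivlMr // ge_min lexx orbT.
apply: (IH (fun j => c j.+1)) => // t td; case/andP: (td) => t0 _.
have := H t td; rewrite big_ord_recl c00 mul0r add0r.
have -> : \sum_(i < n.+1) c (lift ord0 i) * t ^+ lift ord0 i =
    t * \sum_(i < n.+1) c i.+1 * t ^+ i.
  by rewrite mulr_sumr; apply: eq_bigr => i _; rewrite /bump /= exprS mulrCA.
by rewrite cabsM exprS mulrCA ler_pM2l.
Qed.

Lemma powR_bound_from_1 (x : nat -> R) (gamma k : R) (N : nat) :
  (forall n, (N <= n)%N -> x n <= k * n%:R `^ (- gamma)) ->
  exists E, forall n, (0 < n)%N -> x n <= E * n%:R `^ (- gamma).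
Proof.
move=> H; pose y n := `|x n| / n%:R `^ (- gamma).
have y0 n : 0 <= y n by rewrite divr_ge0 // powR_ge0.
exists (`|k| + \sum_(n < N) y n) => n n0.
have p0 : 0 < n%:R `^ (- gamma) :> R by rewrite powR_gt0 // ltr0n.
have [Nn|nN] := leqP N n.
  apply: le_trans (H n Nn) _; rewrite ler_pM2r //.
  by apply: le_trans (ler_norm _) _; rewrite lerDl sumr_ge0.
rewrite -ler_pdivrMr //; apply: le_trans (_ : y n <= _).
  by rewrite /y ler_pM2r ?invr_gt0 // ler_norm.
by rewrite (bigD1 (Ordinal nN)) //= addrCA lerDl addr_ge0 // sumr_ge0.
Qed.

(** Uniqueness of Taylor coefficients at 0 gives Theta_n r^n - theta = n r^n a_n, with a_n the
    coefficient of g0, so the assumed bound on a_n translates directly. *)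
Lemma class_eF_coef (r theta gamma : R) (Theta : nat -> R) :
  series_of_class (class_eF r theta gamma) (g_coef Theta) ->
  exists E : R, forall n, (0 < n)%N ->
    `|Theta n * r ^+ n - theta| <= E * n%:R `^ (- gamma).
Proof.
move=> [g ga [r0 th0 _ [g0 [_ gE [a g0a bigO]]]]].
have aE n : (0 < n)%N -> g_coef Theta n = theta%:C%C * (r%:C%C ^- n / n%:R) + a n.
  move=> n0; have [d1 [M1 [d10 M10 H1]]] := has_expansion_taylor n ga.
  have [d2 [M2 [d20 M20 H2]]] := has_expansion_taylor n g0a.
  pose c j : C := g_coef Theta j - (theta%:C%C * (r%:C%C ^- j / j%:R) + a j).
  pose M := M1 + theta * (4 / r ^+ n.+1) + M2.
  pose d := Num.min (Num.min d1 d2) (r / 2).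
  have d0 : 0 < d by rewrite !lt_min d10 d20 divr_gt0.
  have M0 : 0 <= M.
    by rewrite /M !addr_ge0 // mulr_ge0 // divr_ge0 // exprn_ge0 // ltW.
  apply/eqP; rewrite -subr_eq0; apply/eqP; apply: (@poly_small_coef c n d M d0 M0) => t.
  rewrite /d !le_min => /andP[_ /andP[/andP[t1 t2] t3]].
  have gt : g t = theta%:C%C * slog r t + g0 t.
    by apply: gE; rewrite normC_cabs ltcR; lra.
  have -> : \sum_(j < n.+1) c j * t ^+ j =
      theta%:C%C * (slog r t - \sum_(j < n.+1) (t / r%:C%C) ^+ j / j%:R)
      + (g0 t - \sum_(j < n.+1) a j * t ^+ j)
      - (g t - \sum_(j < n.+1) g_coef Theta j * t ^+ j).
    rewrite gt.
    have -> : \sum_(j < n.+1) c j * t ^+ j = \sum_(j < n.+1) g_coef Theta j * t ^+ j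
      - theta%:C%C * (\sum_(j < n.+1) (t / r%:C%C) ^+ j / j%:R)
      - \sum_(j < n.+1) a j * t ^+ j.
      rewrite /c mulr_sumr -!sumrB; apply: eq_bigr => j _.
      by rewrite expr_div_n; ring.
    by ring.
  apply: le_trans (cabsB _ _) _; apply: le_trans (lerD (cabsD _ _) (lexx _)) _.
  rewrite cabsM (cabs_real_ge0 th0).
  have := ler_wpM2l th0 (slog_taylor r0 n t3); have := H1 t t1; have := H2 t t2.
  by rewrite expr_div_n /M; lra.
move/eqO_exP: bigO => -[k k0 [N _ HN]].
have kE : k = (complex.Re k)%:C%C by rewrite RRe_real ?gtr0_real.
apply: (@powR_bound_from_1 _ gamma (complex.Re k) N.+1) => n Nn.
have n0 : (0 < n)%N by exact: leq_trans Nn.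
have nR0 : 0 < n%:R :> R by rewrite ltr0n.
have rn0 : 0 < r ^+ n by rewrite exprn_gt0.
have := HN n (ltnW Nn); rewrite /= !normC_cabs kE -rmorphM lecR cabs_real ger0_norm; last first.
  by rewrite mulr_ge0 ?powR_ge0 // invr_ge0 ltW.
move=> h.
have e1 : (Theta n * r ^+ n - theta)%:C%C = (n%:R * r ^+ n)%:C%C * a n :> C.
  have -> : a n = g_coef Theta n - theta%:C%C * (r%:C%C ^- n / n%:R).
    by rewrite (aE n n0) addrC addKr.
  rewrite /g_coef -(rmorph_nat (real_complex R)) -(rmorphXn (real_complex R)) -!fmorphV -!rmorphM.
  rewrite -rmorphB -rmorphM; congr (_ %:C%C).
  by field; rewrite !gt_eqF.
have -> : `|Theta n * r ^+ n - theta| = n%:R * r ^+ n * cabs (a n).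
  by rewrite -(cabs_real (Theta n * _ - _)) e1 cabsM cabs_real_ge0 // mulr_ge0 // ltW.
have -> : n%:R `^ (- gamma) = n%:R `^ (- 1 - gamma) * n%:R :> R.
  rewrite -[X in _ * X]powRr1 // -powRD; first by congr (_ `^ _); ring.
  by rewrite (gt_eqF nR0) implybT.
apply: le_trans (ler_wpM2l _ h) _; first by rewrite mulr_ge0 // ltW.
by rewrite le_eqVlt; apply/orP; left; apply/eqP; field; rewrite gt_eqF.
Qed.

End ClassEF.

(** * Poisson limit *)

Section PoissonLimit.
Variables (R : realType) (Theta : nat -> R) (r theta E : R) (phi : nat -> R).
Hypotheses (Theta_ge0 : forall m, (0 < m)%N -> 0 <= Theta m) (r0 : 0 < r)
  (theta0 : 0 < theta) (phi_rate : decay_rate phi)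
  (Theta_phi : forall k, (0 < k)%N -> `|Theta k * r ^+ k - theta| <= E * phi k).

Definition poisson_weights b (c : 'I_b -> nat) : R :=
  \prod_(i < b) ((Theta i.+1 / i.+1%:R * r ^+ i.+1) ^+ c i / (c i)`!%:R *
    expR (- (Theta i.+1 / i.+1%:R * r ^+ i.+1))).

Lemma decay_rate_ge0 n : (0 < n)%N -> 0 <= phi n.
Proof. by case: phi_rate => h _ _ _ n0; apply: le_trans (h n n0); rewrite invr_ge0. Qed.

(** The powers r^s, r^(n-s) and r^n cancel, so the ratio may be computed with the weights Theta_k
    r^k, which are close to theta. *)
Lemma count_weight_ratio b n (c : nat -> nat) :
  (short_cycle_size b c <= n)%N -> 0 < expseq Theta n ->
  count_weight Theta b n c / expseq Theta n =
  short_cycle_weight (fun k => Theta k * r ^+ k) b c *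
    (expseq (fun k => if (k <= b)%N then 0 else Theta k * r ^+ k)
       (n - short_cycle_size b c) / expseq (fun k => Theta k * r ^+ k) n).
Proof.
move=> sn e0; rewrite /count_weight sn expseq_scale.
have -> : expseq (fun k => if (k <= b)%N then 0 else Theta k * r ^+ k)
    (n - short_cycle_size b c) =
    expseq (long_weights Theta b) (n - short_cycle_size b c) *
    r ^+ (n - short_cycle_size b c).
  rewrite -expseq_scale; apply: eq_expseq => k _; rewrite /long_weights.
  by case: ifP; rewrite ?mul0r.
have -> : short_cycle_weight (fun k => Theta k * r ^+ k) b c =
    short_cycle_weight Theta b c * r ^+ short_cycle_size b c.
  rewrite /short_cycle_size -prodrXr -big_split /=; apply: eq_bigr => i _.
  by rewrite exprM mulrAC exprMn; ring.
have -> : r ^+ n = r ^+ short_cycle_size b c * r ^+ (n - short_cycle_size b c).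
  by rewrite -exprD subnKC.
by field; rewrite !gt_eqF ?exprn_gt0.
Qed.

Lemma expseq_Theta_gt0 : exists K, forall n, (K <= n)%N -> 0 < expseq Theta n.
Proof.
have al0 k : (0 < k)%N -> 0 <= Theta k * r ^+ k.
  by move=> k0; rewrite mulr_ge0 ?Theta_ge0 // exprn_ge0 // ltW.
have [C [K H]] := expseq_ratio 0 0 theta0 phi_rate Theta_phi al0.
exists K => n Kn; have [_ h _] := H n Kn.
by move: h; rewrite expseq_scale pmulr_lgt0 // exprn_gt0.
Qed.

Lemma Pr_Theta_poisson b (c : 'I_b -> nat) : exists (A : R) K, forall n, (K <= n)%N ->
  `|Pr_Theta Theta [set s : 'S_n | [forall i : 'I_b, cycle_count i.+1 s == c i]]%SET
    - poisson_weights c| <= A * phi n.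
Proof.
pose c' k := if insub k is Some i then c i else 0%N.
have cE (i : 'I_b) : c' i = c i by rewrite /c' valK.
have al0 k : (0 < k)%N -> 0 <= Theta k * r ^+ k.
  by move=> k0; rewrite mulr_ge0 ?Theta_ge0 // exprn_ge0 // ltW.
have [C [K H]] := expseq_ratio b (short_cycle_size b c') theta0 phi_rate Theta_phi al0.
pose W := short_cycle_weight (fun k => Theta k * r ^+ k) b c'.
have W0 : 0 <= W.
  apply: prodr_ge0 => i _; rewrite divr_ge0 // exprn_ge0 // divr_ge0 //.
  exact: al0.
have pE : poisson_weights c =
    W * expR (- \sum_(j < b) (Theta j.+1 * r ^+ j.+1) / j.+1%:R).
  rewrite -sumrN expR_sum /W -big_split /=; apply: eq_bigr => i _.
  by rewrite cE (mulrAC (Theta i.+1) (r ^+ i.+1)).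
exists (W * C), K => n Kn; have [sn e0 h] := H n Kn.
have -> : [set s : 'S_n | [forall i : 'I_b, cycle_count i.+1 s == c i]]%SET =
    [set s : 'S_n | [forall i : 'I_b, cycle_count i.+1 s == c' i]]%SET.
  by apply/setP => s; rewrite !inE; apply: eq_forallb => i; rewrite cE.
have eT : 0 < expseq Theta n.
  by move: e0; rewrite expseq_scale pmulr_lgt0 // exprn_gt0.
rewrite Pr_Theta_counts count_weight_ratio // pE -mulrBr normrM (ger0_norm W0) -mulrA.
exact: ler_wpM2l.
Qed.

End PoissonLimit.

Section PoissonVector.
Variables (R : realType) (d : measure_display) (T : measurableType d).
Variables (P : probability T R) (b : nat) (Y : 'I_b -> {RV P >-> nat}).
Variables (Theta : nat -> R) (r : R).
Hypotheses (Theta_ge0 : forall m, (0 < m)%N -> 0 <= Theta m) (r0 : 0 < r).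
Hypotheses (Y_indep : mutually_independent Y)
  (Y_poisson : forall i : 'I_b,
     poisson_rv (Y i) (Theta i.+1 / i.+1%:R * r ^+ i.+1)).

(** For mean 0 the law is the Dirac mass at 0, which the formula covers because 0^0 = 1. *)
Lemma poisson_prob_set1 (l : R) n : 0 <= l ->
  poisson_prob l 0 [set n] = (l ^+ n / n`!%:R * expR (- l))%:E.
Proof.
rewrite /poisson_prob le_eqVlt => /predU1P[<-|l0].
  rewrite ltxx oppr0 expR0 mulr1 diracE expr0n.
  by case: n => [|n]; [rewrite mem_set // divr1|rewrite mul0r memNset].
by rewrite l0 esum_set1 ?lee_fin ?poisson_pmf_ge0 // /poisson_pmf l0.
Qed.

Lemma poisson_vector_pmf (c : 'I_b -> nat) :
  fine (P [set w | forall i, Y i w = c i]) = poisson_weights Theta r c.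
Proof.
have := Y_indep [set: 'I_b]%SET (fun i => [set c i]).
have -> : [set w | forall i, i \in [set: 'I_b]%SET -> [set c i] (Y i w)] =
    [set w | forall i, Y i w = c i].
  by apply/seteqP; split=> w /= h i; [apply: h; rewrite finset.in_setT|move=> _; exact: h].
move=> ->; rewrite /poisson_weights; apply: eq_big => [i|i _]; first by rewrite finset.in_setT.
have := Y_poisson i [set c i]; rewrite /distribution /pushforward => ->.
by rewrite poisson_prob_set1 // mulr_ge0 ?divr_ge0 ?Theta_ge0 ?exprn_ge0 ?ltW.
Qed.

End PoissonVector.

(** * Truncation of expectations to finite boxes *)

Section BoxLimit.
Variables (R : realType) (d : measure_display) (T : measurableType d).
Variables (P : probability T R) (b : nat) (Y : 'I_b -> {RV P >-> nat}).
Variables (F : ('I_b -> nat) -> R) (M : R).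
Hypothesis F_le : forall c, `|F c| <= M.

Definition vector_event (c : 'I_b -> nat) : set T := [set w | forall i, Y i w = c i].

Lemma measurable_vector_event c : measurable (vector_event c).
Proof.
have -> : vector_event c = \bigcap_(i in [set: 'I_b]) (Y i @^-1` [set c i]).
  by apply/seteqP; split=> w /= h i => [_|]; exact: h.
apply: fin_bigcap_measurable => // i _; rewrite -[X in measurable X]setTI.
exact: (measurable_funPT (Y i)).
Qed.

Definition box_sum K (w : T) : R :=
  \sum_(c : {ffun 'I_b -> 'I_K}) F (fun i => c i) * \1_(vector_event (fun i => c i)) w.

Lemma box_sumE K w : box_sum K w =
  if [forall i, (Y i w < K)%N] then F (fun i => Y i w) else 0.
Proof.
rewrite /box_sum; case: ifP => [/forallP h|/negbT h].
  pose c0 : {ffun 'I_b -> 'I_K} := [ffun i => Ordinal (h i)].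
  have c0E : (fun i => nat_of_ord (c0 i)) = (fun i => Y i w).
    by apply/funext => i; rewrite ffunE.
  rewrite (bigD1 c0) //= c0E indicE mem_set ?mulr1 // big1 ?addr0 // => c cc0.
  rewrite indicE memNset ?mulr0 //= => hc; move/eqP: cc0; apply.
  by apply/ffunP => i; apply/val_inj; rewrite ffunE /= hc.
rewrite big1 // => c _; rewrite indicE memNset ?mulr0 //= => hc.
by move/negP: h; apply; apply/forallP => i; rewrite hc.
Qed.

Lemma box_sum_cvg w : box_sum K w @[K --> \oo] --> F (fun i => Y i w).
Proof.
apply: cvg_near_cst; exists (\max_(i < b) Y i w).+1 => // K /= wK.
rewrite box_sumE ifT //; apply/forallP => i.
by apply: leq_trans wK; rewrite ltnS; exact: leq_bigmax.
Qed.

Lemma integral_box_sum K : (\int[P]_w (box_sum K w)%:E)%E =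
  (\sum_(c : {ffun 'I_b -> 'I_K}) F (fun i => c i) *
     fine (P (vector_event (fun i => c i))))%:E.
Proof.
transitivity (\int[P]_w (\sum_(c : {ffun 'I_b -> 'I_K})
    ((F (fun i => c i))%:E * (\1_(vector_event (fun i => c i)) w)%:E)%E))%E.
  by apply: eq_integral => w _; rewrite /box_sum -sumEFin.
have int1 (c : {ffun 'I_b -> 'I_K}) : P.-integrable [set: T]
    (fun w => (\1_(vector_event (fun i => c i)) w)%:E).
  by apply: integrable_indic; exact: measurable_vector_event.
rewrite integral_sum //; last by move=> c; apply: integrableZl => //; exact: int1.
rewrite -sumEFin; apply: eq_bigr => c _.
rewrite (integralZl measurableT (int1 c)).
rewrite integral_indic ?setIT //; last exact: measurable_vector_event.
by rewrite EFinM fineK // fin_num_measure //; exact: measurable_vector_event.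
Qed.

(** The box sums are simple functions bounded by [M], so their pointwise limit is measurable for any
    bounded [F], and dominated convergence applies. *)
Lemma box_expectation :
  (\int[P]_w (F (fun i => Y i w))%:E)%E \is a fin_num /\
  (fun K => \sum_(c : {ffun 'I_b -> 'I_K}) F (fun i => c i) *
     fine (P (vector_event (fun i => c i)))) @ \oo -->
  fine (\int[P]_w (F (fun i => Y i w))%:E)%E.
Proof.
have M0 : 0 <= M by apply: le_trans (F_le (fun=> 0%N)).
have mbox K : measurable_fun [set: T] (EFin \o box_sum K).
  apply/measurable_EFinP; apply: measurable_sum => c; apply: measurable_funM.
    exact: measurable_cst.
  by apply: measurable_indic; exact: measurable_vector_event.
have cvgbox w : (box_sum K w)%:E @[K --> \oo] --> (F (fun i => Y i w))%:E.
  by apply: cvg_EFin; [exact: nearW|exact: box_sum_cvg].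
have intM : P.-integrable [set: T] (EFin \o cst M) by exact: finite_measure_integrable_cst.
pose FY w := F (fun i => Y i w).
have mF : measurable_fun [set: T] (EFin \o FY).
  by apply: emeasurable_fun_cvg mbox _ => w _; exact: cvgbox.
have intF : P.-integrable [set: T] (EFin \o FY).
  apply: le_integrable intM => // w _ /=.
  by rewrite lee_fin (le_trans (F_le _)) // ler_norm.
have fin : (\int[P]_w (F (fun i => Y i w))%:E)%E \is a fin_num.
  exact: integrable_fin_num.
split => //.
have := @dominated_cvg _ _ _ P [set: T] measurableT
  (fun K => EFin \o box_sum K) _ _ mbox (fun w _ => cvgbox w) _ intM.
move=> /(_ (fun w _ => isT)) H.
have {}H : (\int[P]_w (box_sum K w)%:E)%E @[K --> \oo] -->
    (\int[P]_w (F (fun i => Y i w))%:E)%E.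
  apply: H => K w _ /=; rewrite box_sumE lee_fin; case: ifP => // _.
  by rewrite normr0.
have -> : (fun K => \sum_(c : {ffun 'I_b -> 'I_K}) F (fun i => c i) *
    fine (P (vector_event (fun i => c i)))) = fine \o (fun K => \int[P]_w (box_sum K w)%:E)%E.
  by apply/funext => K; rewrite /= integral_box_sum.
by apply: fine_cvg; rewrite fineK.
Qed.

End BoxLimit.

(** * Convergence in distribution from point probabilities *)

Section CycleCountLimit.
Variables (R : realType) (Theta : nat -> R).
Hypothesis Theta_ge0 : forall m, (0 < m)%N -> 0 <= Theta m.

Definition count_event b n (c : 'I_b -> nat) : {set 'S_n} :=
  [set s : 'S_n | [forall i : 'I_b, cycle_count i.+1 s == c i]]%SET.

Lemma PTheta_ge0 n (s : 'S_n) : 0 <= PTheta Theta s.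
Proof.
rewrite /PTheta mulr_ge0 //.
  rewrite invr_ge0 mulr_ge0 // h_normE; exact: expseq_ge0.
by rewrite /weight big_nat; apply: prodr_ge0 => m /andP[m0 _]; rewrite exprn_ge0 // Theta_ge0.
Qed.

Lemma sum_count_event b K n (G : ('I_b -> nat) -> R) :
  \sum_(c : {ffun 'I_b -> 'I_K}) G (fun i => c i) *
     Pr_Theta Theta (count_event n (fun i => c i)) =
  \sum_(s : 'S_n | [forall i : 'I_b, (cycle_count i.+1 s < K)%N])
     PTheta Theta s * G (fun i => cycle_count i.+1 s).
Proof.
transitivity (\sum_(c : {ffun 'I_b -> 'I_K}) \sum_(s | s \in count_event n (fun i => c i))
    PTheta Theta s * G (fun i => cycle_count i.+1 s)).
  apply: eq_bigr => c _; rewrite /Pr_Theta mulr_sumr; apply: eq_bigr => s.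
  rewrite inE => /forallP h; rewrite mulrC; congr (_ * G _).
  by apply/funext => i; rewrite (eqP (h i)).
rewrite (exchange_big_dep xpredT) //= [RHS]big_mkcond /=; apply: eq_bigr => s _.
case: ifP => [/forallP h|/negbT h]; last first.
  rewrite big_pred0 // => c; rewrite inE; apply: contraNF h => /forallP h.
  by apply/forallP => i; rewrite (eqP (h i)).
pose c0 : {ffun 'I_b -> 'I_K} := [ffun i => Ordinal (h i)].
rewrite (big_pred1 c0) // => c; rewrite inE /=; apply/forallP/eqP => [hc|-> i].
  by apply/ffunP => i; apply/val_inj; rewrite ffunE /= (eqP (hc i)).
by rewrite ffunE.
Qed.

(** The error is the expectation outside the box, at most M times the mass there; this mass is 1
    minus that of the box once the normalisation is nonzero. *)
Lemma E_Theta_box b K n (G : ('I_b -> nat) -> R) (M : R) :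
  (forall c, `|G c| <= M) -> expseq Theta n != 0 ->
  `|E_Theta Theta (fun s : 'S_n => G (fun i => cycle_count i.+1 s)) -
    \sum_(c : {ffun 'I_b -> 'I_K}) G (fun i => c i) *
      Pr_Theta Theta (count_event n (fun i => c i))| <=
  M * (1 - \sum_(c : {ffun 'I_b -> 'I_K}) Pr_Theta Theta (count_event n (fun i => c i))).
Proof.
move=> GM e0; have := @sum_count_event b K n (fun=> 1 : R).
under eq_bigr do rewrite mul1r.
under [in RHS]eq_bigr do rewrite mulr1.
move=> ->; rewrite sum_count_event -(sum_PTheta e0) /E_Theta.
set B := fun s : 'S_n => [forall i : 'I_b, (cycle_count i.+1 s < K)%N].
rewrite (bigID B) /= [X in _ * (X - _)](bigID B) /= ![_ + _ - _]addrAC !subrr !add0r.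
apply: le_trans (ler_norm_sum _ _ _) _; rewrite mulr_sumr; apply: ler_sum => s _.
by rewrite normrM (ger0_norm (PTheta_ge0 s)) mulrC ler_wpM2r ?PTheta_ge0.
Qed.

Lemma eventually_sum_le (I : finType) (x : I -> nat -> R) :
  (forall i e, 0 < e -> exists N, forall n, (N <= n)%N -> x i n <= e) ->
  forall e, 0 < e -> exists N, forall n, (N <= n)%N -> \sum_i x i n <= e.
Proof.
move=> H e e0; have e1 : 0 < e / #|I|.+1%:R by rewrite divr_gt0.
have [N HN] := choice (fun i => H i _ e1).
exists (\max_i N i) => n Nn.
apply: le_trans (_ : \sum_(i : I) e / #|I|.+1%:R <= _).
  by apply: ler_sum => i _; apply: HN; apply: leq_trans Nn; exact: leq_bigmax.
rewrite sumr_const -[leLHS]mulr_natr mulrAC ler_pdivrMr // ler_pM2l // ler_nat.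
exact: leqnSn.
Qed.

Lemma approx_chain (L a SG SGn S1 S1n M e : R) : 0 <= M ->
  `|1 - S1| <= e -> `|L - SG| <= e -> `|S1n - S1| <= e -> `|SGn - SG| <= M * e ->
  `|a - SGn| <= M * (1 - S1n) -> `|L - a| <= e * (1 + 3 * M).
Proof.
move=> M0 h1 h2 h3 h4 h5; have hS : 1 - S1n <= 2 * e.
  by move: h1 h3; rewrite !ler_norml => /andP[_ ?] /andP[? _]; lra.
have hM := ler_wpM2l M0 hS.
move: h2 h4 h5; rewrite !ler_norml => /andP[? ?] /andP[? ?] /andP[? ?].
by apply/andP; split; lra.
Qed.

Variables (d : measure_display) (T : measurableType d).
Variables (P : probability T R) (b : nat) (Y : 'I_b -> {RV P >-> nat}).

(** Tightness comes for free: the limit has mass 1, so a large box has limit mass at least 1 - e,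
    and convergence on its finitely many cells gives it mass at least 1 - 2 e for large n. *)
Lemma cvg_in_distribution_of_pmf :
  (exists K, forall n, (K <= n)%N -> expseq Theta n != 0) ->
  (forall (c : 'I_b -> nat) e, 0 < e -> exists N, forall n, (N <= n)%N ->
     `|Pr_Theta Theta (count_event n c) - fine (P (vector_event Y c))| <= e) ->
  cycles_cvg_in_distribution Theta Y.
Proof.
move=> [N0 HN0] Hpmf f _ [M0 [_ HM0]].
pose M := Num.max (M0 + 1) 0.
have M_ge0 : 0 <= M by rewrite le_max lexx orbT.
pose G (c : 'I_b -> nat) : R := f (\row_(i < b) (c i)%:R).
have GM c : `|G c| <= M.
  by apply: le_trans (HM0 (M0 + 1) _ _ I) _; rewrite ?ltrDl // le_max lexx.
rewrite unlock.
have [fin boxG] := @box_expectation R d T P b Y G M GM.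
have norm1 : ('I_b -> nat) -> `|1 : R| <= 1 by rewrite normr1.
have [_ box1] := @box_expectation R d T P b Y (fun=> 1) 1 norm1.
change ((fun n => (E_Theta Theta (fun s : 'S_n => G (fun i => cycle_count i.+1 s)))%:E)
  @ \oo --> (\int[P]_w (G (fun i => Y i w))%:E)%E).
rewrite -(fineK fin); apply: cvg_EFin; first exact: nearW.
set L := fine _ in boxG *.
have L1 : fine (\int[P]_w (1 : R)%:E)%E = 1.
  transitivity (fine (P [set: T])); last by rewrite probability_setT.
  by rewrite (@integral_cst _ _ _ P _ measurableT 1) mul1e.
rewrite L1 in box1.
(* One e1 for truncating the limit expectation, M e1 for the cells of the box and 2 M e1 for the
   mass outside it. *)
apply/cvgrPdist_le => e e0; pose e1 := e / (1 + 3 * M).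
have k0 : 0 < 1 + 3 * M by rewrite ltr_pwDl // mulr_ge0.
have e10 : 0 < e1 by rewrite divr_gt0.
have [K1 _ HK1] := (cvgrPdist_le _ _).1 boxG e1 e10.
have [K2 _ HK2] := (cvgrPdist_le _ _).1 box1 e1 e10.
pose K := maxn K1 K2.
have := HK1 K (leq_maxl _ _); have {HK1 HK2} := HK2 K (leq_maxr _ _); rewrite /=.
under eq_bigr do rewrite mul1r.
set S1 := \sum_c _; set SG := \sum_c _ => h1 hG.
pose D n (c : {ffun 'I_b -> 'I_K}) :=
  `|Pr_Theta Theta (count_event n (fun i => c i)) - fine (P (vector_event Y (fun i => c i)))|.
have [N1 HN1] := eventually_sum_le (x := fun c n => D n c) (fun c => Hpmf (fun i => c i)) e10.
exists (maxn N0 N1) => // n /=; rewrite geq_max => /andP[n0 n1].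
have hD := HN1 n n1.
have hE := @E_Theta_box b K n G M GM (HN0 n n0).
set a := E_Theta _ _ in hE *; set SGn := \sum_c _ in hE; set S1n := \sum_c _ in hE.
have d1 : `|S1n - S1| <= e1.
  apply: le_trans hD; rewrite /S1n /S1 -sumrB; exact: ler_norm_sum.
have dG : `|SGn - SG| <= M * e1.
  apply: le_trans (ler_wpM2l M_ge0 hD); rewrite /SGn /SG -sumrB mulr_sumr.
  apply: le_trans (ler_norm_sum _ _ _) _; apply: ler_sum => c _.
  by rewrite -mulrBr normrM ler_wpM2r.
have eE : e = e1 * (1 + 3 * M) by rewrite /e1 divfK // gt_eqF.
by have := approx_chain M_ge0 h1 hG d1 dG hE; rewrite -eE.
Qed.

(** A negative entry of [c] makes both events empty; otherwise [c] is a tuple of naturals. *)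
Lemma pmf_diffE (c : 'I_b -> int) :
  (exists k : 'I_b -> nat, forall n, pmf_diff Theta Y c n =
     `|Pr_Theta Theta (count_event n k) - fine (P (vector_event Y k))|) \/
  forall n, pmf_diff Theta Y c n = 0.
Proof.
have [/forallP c0|/forallPn[i ci]] := boolP [forall i, 0 <= c i].
  left; exists (fun i => `|c i|%N) => n.
  have cE i : c i = `|c i|%N%:Z by rewrite gez0_abs.
  rewrite /pmf_diff; congr (`| Pr_Theta _ _ - fine (P _) |).
    by apply/setP => s; rewrite !inE; apply: eq_forallb => i; rewrite {1}cE.
  apply/seteqP; split=> w /= h i; first by rewrite /= -(h i).
  by rewrite (h i) [RHS]cE.
right=> n; rewrite /pmf_diff.
have -> : [set s : 'S_n | [forall i : 'I_b, (cycle_count i.+1 s)%:Z == c i]]%SET = finset.set0.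
  apply/setP => s; rewrite !inE; apply/negbTE/forallPn; exists i.
  by apply: contraNneq ci => <-.
have -> : [set w | forall i : 'I_b, (Y i w)%:Z = c i] = classical_sets.set0.
  by apply/seteqP; split=> w //= /(_ i) h; move: ci; rewrite -h.
by rewrite /Pr_Theta big_set0 measure0 subrr normr0.
Qed.

End CycleCountLimit.

(** * Rates of convergence for the two classes *)

Section Rates.
Variable R : realType.

Lemma class_eF_rate (Theta : nat -> R) (r theta gamma : R) :
  series_of_class (class_eF r theta gamma) (g_coef Theta) ->
  0 < r /\ decay_rate (fun n => n%:R `^ (- gamma) : R).
Proof. by move=> [g _ [r0 _ /andP[g0 g1] _]]; split=> //; exact: decay_rate_powR. Qed.

Lemma classF_rate (Theta : nat -> R) (r theta : R) :
  series_of_class (classF r theta) (g_coef Theta) ->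
  [/\ 0 < r, decay_rate (fun n => n%:R `^ (- 1) : R) & exists E : R, forall n, (0 < n)%N ->
    `|Theta n * r ^+ n - theta| <= E * n%:R `^ (- 1)].
Proof.
move=> HF; have [g _ [r0 _ _]] := HF; have [E HE] := classF_coef r0 HF; split=> //.
  exact: decay_rate_powR.
by exists E => n n0; rewrite powR_inv1 //; exact: HE.
Qed.

Variables (Theta : nat -> R) (r theta : R).
Hypotheses (Theta_ge0 : forall m, (0 < m)%N -> 0 <= Theta m) (theta_gt0 : 0 < theta).
Variables (b : nat) (d : measure_display) (T : measurableType d).
Variables (P : probability T R) (Y : 'I_b -> {RV P >-> nat}).
Hypotheses (Y_indep : mutually_independent Y)
  (Y_poisson : forall i : 'I_b,
     poisson_rv (Y i) (Theta i.+1 / i.+1%:R * r ^+ i.+1)).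
Variables (E : R) (phi : nat -> R).
Hypotheses (r0 : 0 < r) (phi_rate : decay_rate phi)
  (Theta_phi : forall k, (0 < k)%N -> `|Theta k * r ^+ k - theta| <= E * phi k).

Lemma pmf_rate (c : 'I_b -> nat) : exists (A : R) K, forall n, (K <= n)%N ->
  `|Pr_Theta Theta (count_event n c) - fine (P (vector_event Y c))| <= A * phi n.
Proof.
rewrite (poisson_vector_pmf Theta_ge0 r0 Y_indep Y_poisson c).
exact: Pr_Theta_poisson Theta_ge0 r0 theta_gt0 phi_rate Theta_phi b c.
Qed.

Lemma pmf_diff_rate (c : 'I_b -> int) : exists (A : R) K, forall n, (K <= n)%N ->
  pmf_diff Theta Y c n <= A * phi n.
Proof.
have [[k kE]|z] := pmf_diffE Theta Y c.
  by have [A [K H]] := pmf_rate k; exists A, K => n Kn; rewrite kE; exact: H.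
by exists 0, 0%N => n _; rewrite z mul0r.
Qed.

(** The comparison of rates starts at n = 2 because ln 1 = 0. *)
Lemma pmf_diff_bigO (c : 'I_b -> int) (psi : nat -> R) (k : R) : 0 < k ->
  (forall n, (1 < n)%N -> phi n <= k * psi n) -> pmf_diff Theta Y c =O_\oo psi.
Proof.
move=> k0 phi_psi; have [A [K H]] := pmf_diff_rate c; apply/eqO_exP.
exists ((`|A| + 1) * k); first by rewrite mulr_gt0 // ltr_wpDl.
exists (maxn K 2) => // n /=; rewrite geq_max => /andP[Kn n1].
rewrite ger0_norm ?normr_ge0 //; apply: le_trans (H n Kn) _.
have phi0 := decay_rate_ge0 phi_rate (ltnW n1).
apply: le_trans (_ : (`|A| + 1) * phi n <= _).
  by apply: ler_wpM2r => //; apply: le_trans (ler_norm A) _; rewrite lerDl.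
rewrite -mulrA; apply: ler_wpM2l; first by rewrite addr_ge0.
apply: le_trans (phi_psi n n1) _.
by apply: ler_wpM2l; [exact: ltW|exact: ler_norm].
Qed.

Lemma cycles_cvg : cycles_cvg_in_distribution Theta Y.
Proof.
apply: cvg_in_distribution_of_pmf => //.
  have [K HK] := expseq_Theta_gt0 Theta_ge0 r0 theta_gt0 phi_rate Theta_phi.
  by exists K => n Kn; rewrite gt_eqF // HK.
move=> c e e0; have [A [K H]] := pmf_rate c.
case: (phi_rate) => _ _ _ small.
have A0 : 0 < `|A| + 1 by rewrite ltr_wpDl.
have [N HN] := small _ (divr_gt0 e0 A0).
exists (maxn (maxn K N) 1) => n; rewrite !geq_max => /andP[/andP[Kn Nn] n0].
apply: le_trans (H n Kn) _; have phi0 := decay_rate_ge0 phi_rate n0.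
apply: le_trans (_ : (`|A| + 1) * phi n <= _).
  by apply: ler_wpM2r => //; apply: le_trans (ler_norm A) _; rewrite lerDl.
by rewrite mulrC -ler_pdivlMr // HN.
Qed.

End Rates.

Theorem corollary3p1p1 (R : realType) (Theta : nat -> R) (r theta gamma : R)
    (Theta_ge0 : forall m, (0 < m)%N -> 0 <= Theta m)
    (theta_gt0 : 0 < theta)
    (g_class : series_of_class (classF r theta) (g_coef Theta) \/
               series_of_class (class_eF r theta gamma) (g_coef Theta))
    (b : nat) (d : measure_display) (T : measurableType d)
    (P : probability T R) (Y : 'I_b -> {RV P >-> nat})
    (Y_indep : mutually_independent Y)
    (Y_poisson : forall i : 'I_b,
       poisson_rv (Y i) (Theta i.+1 / i.+1%:R * r ^+ i.+1)) :
  [/\ cycles_cvg_in_distribution Theta Y,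
      series_of_class (classF r theta) (g_coef Theta) ->
        forall c : 'I_b -> int,
          pmf_diff Theta Y c =O_\oo (fun n => n%:R^-1 : R) &
      series_of_class (class_eF r theta gamma) (g_coef Theta) ->
        forall c : 'I_b -> int,
          pmf_diff Theta Y c =O_\oo (fun n => ln n%:R / n%:R `^ gamma : R)].
Proof.
split.
- case: g_class => HF.
    have [r0 rate [E HE]] := classF_rate HF.
    exact: cycles_cvg rate HE.
  have [r0 rate] := class_eF_rate HF; have [E HE] := class_eF_coef HF.
  exact: cycles_cvg rate HE.
- move=> HF c; have [r0 rate [E HE]] := classF_rate HF.
  apply: (pmf_diff_bigO Theta_ge0 theta_gt0 Y_indep Y_poisson r0 rate HE _ ltr01) => // n n1.
  by rewrite powR_inv1 // mul1r.
move=> HF c; have [r0 rate] := class_eF_rate HF; have [E HE] := class_eF_coef HF.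
(* The error obtained is O(n^-gamma); as ln n >= ln 2 for n >= 2, the factor 1 / ln 2 brings it to
   the stated form. *)
have ln2 : 0 < ln 2 :> R by rewrite ln_gt0 // ltr1n.
have l2 : 0 < (ln 2)^-1 :> R by rewrite invr_gt0.
apply: (pmf_diff_bigO Theta_ge0 theta_gt0 Y_indep Y_poisson r0 rate HE _ l2) => // n n1.
rewrite powRN mulrA; apply: ler_peMl; first by rewrite invr_ge0 powR_ge0.
rewrite mulrC ler_pdivlMr // mul1r ler_ln ?posrE ?ltr0n //; last exact: ltnW.
by rewrite ler_nat.
Qed.
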